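(* Let $\tilde\delta=\delta+D\nabla$ on $\mathrm{fGC}_0^{\ge 2}$. Then there is a spectral sequence, namely the one associated with the filtration by $b=e-v$, converging to $H\left(\mathrm{fGC}_0^{\ge 2},\tilde\delta\right)=0$, whose first page is $H\left(\mathrm{fGC}_0^{\ge 2},\delta\right)$. Furthermore, the differentials on the odd pages of this spectral sequence are $0$.
   Context: Let $\mathbb K$ be a field of characteristic zero. $\mathrm{fGC}_0^{\ge i}$ is the space of formal, possibly infinite, $\mathbb K$-linear combinations of isomorphism classes of finite, not necessarily connected graphs with $v\ge1$ vertices and $e\ge 0$ edges, without tadpoles (edges from a vertex to itself), all vertices at least $i$-valent, equipped with an ordering of the edges, modulo the relation that permuting the ordering multiplies by the sign of the permutation (the product over $(v,e)$ of coinvariant spaces; vertices are unordered and edges undirected, so graphs with a multiple edge are zero). The degree of a graph is $e$. $\delta(\Gamma)=\sum_{x\in V(\Gamma)}\left(\tfrac12 s_x(\Gamma)-a_x(\Gamma)\right)$, where $s_x$ adds a new vertex $z$ and a new edge $xz$ and sums over all ways of distributing the edge-ends previously at $x$ among $x$ and $z$, and $a_x$ adds a new vertex $z$ and a new edge $xz$ and changes nothing else. The new edge is placed last in the ordering. $\nabla$ adds one new edge (placed last in the ordering) in all possible ways: $\nabla(\Gamma)$ is the sum over all ordered pairs of distinct vertices $(x,y)$ of $\Gamma$ with a new edge between $x$ and $y$ (so every edge is added twice). $D(\Gamma)=\sum_{x\in V(\Gamma)}(-1)^{v(x)}\tilde D_x(\Gamma)$, where $v(x)$ is the valence of $x$ and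 $\tilde D_x$ deletes the vertex $x$ and sums over all ways of reconnecting the edge-ends that were at $x$ to the other vertices, skipping graphs with a tadpole; the edges keep their order. The filtration by $b$ is by the subspaces spanned by graphs with $e-v\ge b$; $\delta$ preserves $e-v$ and $D\nabla$ raises it by $2$. Pages are numbered so that the differential $d_r$ on the $r$-th page raises $b$ by $r$; the zeroth differential is $\delta$ and $E_1=H(\mathrm{fGC}_0^{\ge 2},\delta)$. *)

(* Defs.v *)
From HB Require Import structures.
From mathcomp Require Import all_boot all_order perm all_algebra.
From mathcomp Require Import boolp.

Set Implicit Arguments.
Unset Strict Implicit.
Unset Printing Implicit Defensive.

Import Order.TTheory GRing.Theory.

Local Open Scope quotient_scope.
Local Open Scope ring_scope.

(******************************************************************************)
(* Quotients and subquotients of modules                                      *)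
(*           lquot U == V / U as an lmodType, for U : submodClosed V          *)
(*     subquot Z B   == Z / (Z :&: B), for Z B : submodClosed V               *)
(*     sqclass Z B x == the class of x in subquot Z B if x \in Z, else 0      *)
(*          ker_in C g, im_of C f == the submodules {x in C | g x = 0}, f(C)  *)
(* homology C' f C g == the homology at C of C' --f--> C --g-->               *)
(* induced_iso f Z B Z' B' <-> f maps Z to Z' and induces a linear            *)
(*                      isomorphism of subquot Z B with subquot Z' B'         *)
(******************************************************************************)

Section ModuleQuotient.
Variables (K : fieldType) (V : lmodType K) (U : submodClosed V).

(* An abstract submodClosed is not seen as a zmodClosed, which the quotient   *)
(* needs; this copy of U is.                                                  *)
Definition lquot_ideal : {pred V} := [pred x | x \in U].

Fact lquot_ideal_closed : subsemimod_closed lquot_ideal.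
Proof.
split=> [|a x Ux]; last by rewrite inE rpredZ.
by split=> [|x y Ux Uy]; rewrite inE ?rpred0 ?rpredD.
Qed.

HB.instance Definition _ :=
  GRing.isSubmodClosed.Build K V lquot_ideal lquot_ideal_closed.

Definition lquot : Type := Quotient.quot lquot_ideal.

HB.instance Definition _ := GRing.Zmodule.on lquot.
HB.instance Definition _ : EqQuotient V (Quotient.equiv lquot_ideal) lquot :=
  EqQuotient.on lquot.

Definition lproj (x : V) : lquot := \pi_lquot x.

Lemma lprojP x y : reflect (lproj x = lproj y) (x - y \in U).
Proof.
rewrite -[_ \in U]/(x - y \in lquot_ideal) Quotient.idealrBE.
exact: eqP.
Qed.

Lemma lproj_repr (X : lquot) : lproj (repr X) = X.
Proof. exact: reprK. Qed.

Lemma lprojD x y : lproj (x + y) = lproj x + lproj y.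
Proof. exact: Quotient.pi_add. Qed.

Definition lquot_scale (a : K) (X : lquot) : lquot := lproj (a *: repr X).

Lemma lprojZ a x : lproj (a *: x) = lquot_scale a (lproj x).
Proof.
apply/lprojP; rewrite -scalerBr rpredZ //.
by apply/lprojP; rewrite lproj_repr.
Qed.

Fact lquot_scaleA a b X :
  lquot_scale a (lquot_scale b X) = lquot_scale (a * b) X.
Proof. by rewrite -[X]lproj_repr -!lprojZ scalerA. Qed.

Fact lquot_scale1 : left_id 1 lquot_scale.
Proof. by move=> X; rewrite -[X]lproj_repr -lprojZ scale1r. Qed.

Fact lquot_scaleDr : right_distributive lquot_scale +%R.
Proof.
move=> a X Y; rewrite -[X]lproj_repr -[Y]lproj_repr.
by rewrite -lprojD -!lprojZ -lprojD scalerDr.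
Qed.

Fact lquot_scaleDl X : {morph lquot_scale^~ X : a b / a + b}.
Proof.
by move=> a b; rewrite -[X]lproj_repr -!lprojZ -lprojD scalerDl.
Qed.

HB.instance Definition _ := GRing.Zmodule_isLmodule.Build K lquot
  lquot_scaleA lquot_scale1 lquot_scaleDr lquot_scaleDl.

Fact lproj_linear : linear lproj.
Proof. by move=> a x y; rewrite lprojD lprojZ. Qed.

HB.instance Definition _ := GRing.isLinear.Build K V lquot _ lproj lproj_linear.

End ModuleQuotient.

Section Subquotient.
Variables (K : fieldType) (V : lmodType K) (Z B : submodClosed V).

Definition submod : Type := {x : V | x \in Z}.

HB.instance Definition _ := SubChoice.on submod.
HB.instance Definition _ := [SubChoice_isSubLmodule of submod by <:].

Definition sq_bound : {pred submod} := [pred x : submod | \val x \in B].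

Fact sq_bound_closed : subsemimod_closed sq_bound.
Proof.
split=> [|a x]; first split=> [|x y]; rewrite !inE.
- by rewrite GRing.val0 rpred0.
- by move=> Bx By; rewrite GRing.valD rpredD.
- by move=> Bx; rewrite GRing.valZ rpredZ.
Qed.

HB.instance Definition _ :=
  GRing.isSubmodClosed.Build K submod sq_bound sq_bound_closed.

Definition subquot : lmodType K := lquot sq_bound.

Definition sqclass (x : V) : subquot := lproj sq_bound (insubd 0 x).

Lemma sqclassP x y : x \in Z -> y \in Z ->
  reflect (sqclass x = sqclass y) (x - y \in B).
Proof.
move=> Zx Zy.
have -> : (x - y \in B) = (insubd 0 x - insubd 0 y \in sq_bound).
  by rewrite inE GRing.valB !insubdK.
exact: lprojP.
Qed.

Lemma sqclass_surj (X : subquot) : exists2 x, x \in Z & X = sqclass x.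
Proof.
exists (\val (repr X)); first exact: valP.
by rewrite /sqclass valKd [RHS]lproj_repr.
Qed.

Lemma sqclass0 : sqclass 0 = 0.
Proof.
rewrite /sqclass (_ : insubd 0 0 = 0) ?linear0 //.
by apply: val_inj; rewrite GRing.val0 insubdK ?rpred0.
Qed.

Lemma sqclass_linear a x y : x \in Z -> y \in Z ->
  sqclass (a *: x + y) = a *: sqclass x + sqclass y.
Proof.
move=> Zx Zy; rewrite /sqclass -linearP; congr (lproj _ _).
by apply: val_inj; rewrite GRing.valD GRing.valZ !insubdK // rpredD ?rpredZ.
Qed.

End Subquotient.

Section Intersection.
Variables (K : fieldType) (V : lmodType K) (Z Z' : submodClosed V).

Definition cap_sub : {pred V} := [predI Z & Z'].

Fact cap_sub_closed : subsemimod_closed cap_sub.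
Proof.
split=> [|a x]; first split=> [|x y]; rewrite !inE ?rpred0 //.
- by move=> /andP[? ?] /andP[? ?]; rewrite !rpredD.
- by move=> /andP[? ?]; rewrite !rpredZ.
Qed.

HB.instance Definition _ :=
  GRing.isSubmodClosed.Build K V cap_sub cap_sub_closed.

End Intersection.

Section KernelImage.
Variables (K : fieldType) (V' V V'' : lmodType K).

Definition full : {pred V} := predT.

Fact full_closed : subsemimod_closed full.
Proof. by []. Qed.

HB.instance Definition _ := GRing.isSubmodClosed.Build K V full full_closed.

Definition ker_in (C : submodClosed V) (g : {linear V -> V''}) : {pred V} :=
  [pred x | (x \in C) && (g x == 0)].

Fact ker_in_closed C g : subsemimod_closed (ker_in C g).
Proof.
split=> [|a x]; first split=> [|x y]; rewrite !inE /= ?rpred0 ?linear0 ?eqxx //.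
- move=> /andP[Cx /eqP gx] /andP[Cy /eqP gy].
  by rewrite rpredD // linearD gx gy addr0 eqxx.
- by move=> /andP[Cx /eqP gx]; rewrite rpredZ // linearZ_LR gx scaler0 eqxx.
Qed.

HB.instance Definition _ C g :=
  GRing.isSubmodClosed.Build K V (ker_in C g) (ker_in_closed C g).

Definition im_of (C' : submodClosed V') (f : {linear V' -> V}) : {pred V} :=
  [pred x | `[< exists2 y, y \in C' & x = f y >]].

Fact im_of_closed C' f : subsemimod_closed (im_of C' f).
Proof.
split=> [|a x]; first split=> [|x y]; rewrite !inE.
- by apply/asboolP; exists 0; rewrite ?rpred0 ?linear0.
- move=> /asboolP[x' Cx ->] /asboolP[y' Cy ->].
  by apply/asboolP; exists (x' + y'); rewrite ?rpredD ?linearD.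
- move=> /asboolP[x' Cx ->].
  by apply/asboolP; exists (a *: x'); rewrite ?rpredZ ?linearZ_LR.
Qed.

HB.instance Definition _ C' f :=
  GRing.isSubmodClosed.Build K V (im_of C' f) (im_of_closed C' f).

Definition homology C' f C g : lmodType K :=
  subquot (ker_in C g) (im_of C' f).

Definition hclass C' f C g : V -> homology C' f C g :=
  sqclass (ker_in C g) (im_of C' f).

End KernelImage.

Arguments full {K} V.

Definition induced_iso (K : fieldType) (V W : lmodType K) (f : V -> W)
    (Z B : submodClosed V) (Z' B' : submodClosed W) : Prop :=
  exists2 phi : {linear subquot Z B -> subquot Z' B'}, bijective phi &
    {in Z, forall x, f x \in Z' /\ phi (sqclass Z B x) = sqclass Z' B' (f x)}.

(******************************************************************************)
(* The spectral sequence of a filtered complex                                *)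
(* The complex is a family A n of submodules of one module V, preserved in    *)
(* degree + 1 by an endomorphism d of V; F is a decreasing filtration.        *)
(*    page d A F r b n == the term in filtration b and degree n of page r     *)
(* page_diff fc Hb Hn == the differential of page r, from filtration b and    *)
(*                      degree n to filtration b' = b + r and degree n' = n+1 *)
(*       coh d A n   == the cohomology of the complex in degree n             *)
(* coh_filt d A F n b == the filtration of coh d A n by the classes of the    *)
(*                      cocycles in F b                                       *)
(******************************************************************************)

Record filtered_complex (K : fieldType) (V : lmodType K) (d : {linear V -> V})
    (A F : int -> submodClosed V) : Prop := FilteredComplex {
  fc_degree : forall n x, x \in A n -> d x \in A (n + 1);
  fc_square : forall n x, x \in A n -> d (d x) = 0;
  fc_filtered : forall n b x, x \in A n -> x \in F b -> d x \in F b;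
  fc_decreasing : forall b, {subset F (b + 1) <= F b}
}.

Section SpectralSequence.
Variables (K : fieldType) (V : lmodType K) (d : {linear V -> V}).
Variables (A F : int -> submodClosed V).

(* The index p is an integer because page_bound 0 refers to page_cycle (-1).  *)
Definition page_cycle (p b n : int) : {pred V} :=
  [pred x | [&& x \in A n, x \in F b & d x \in F (b + p)]].

Fact page_cycle_closed p b n : subsemimod_closed (page_cycle p b n).
Proof.
split=> [|a x]; first split=> [|x y]; rewrite !inE.
- by rewrite linear0 !rpred0.
- by move=> /and3P[? ? ?] /and3P[? ? ?]; rewrite linearD !rpredD.
- by move=> /and3P[? ? ?]; rewrite linearZ_LR !rpredZ.
Qed.

HB.instance Definition _ p b n :=
  GRing.isSubmodClosed.Build K V (page_cycle p b n) (page_cycle_closed p b n).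

Definition page_bound (p b n : int) : {pred V} :=
  [pred x | `[< exists y z, [/\ y \in page_cycle (p - 1) (b + 1) n,
      z \in page_cycle (p - 1) (b - p + 1) (n - 1) & x = y + d z] >]].

Fact page_bound_closed p b n : subsemimod_closed (page_bound p b n).
Proof.
split=> [|a x]; first split=> [|x x'].
- by apply/asboolP; exists 0, 0; rewrite !rpred0 linear0 addr0.
- move=> /asboolP[y [z [Zy Zz ->]]] /asboolP[y' [z' [Zy' Zz' ->]]].
  apply/asboolP; exists (y + y'), (z + z').
  by rewrite !rpredD // linearD addrACA.
- move=> /asboolP[y [z [Zy Zz ->]]].
  by apply/asboolP; exists (a *: y), (a *: z); rewrite !rpredZ // linearZ_LR scalerDr.
Qed.

HB.instance Definition _ p b n :=
  GRing.isSubmodClosed.Build K V (page_bound p b n) (page_bound_closed p b n).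

Definition page (r : nat) (b n : int) : lmodType K :=
  subquot (page_cycle r%:Z b n) (page_bound r%:Z b n).

Definition page_class r b n : V -> page r b n :=
  sqclass (page_cycle r%:Z b n) (page_bound r%:Z b n).

Section PageDifferential.
Hypothesis fc : filtered_complex d A F.
Variables (r : nat) (b n b' n' : int).
Hypotheses (Hb : b' = b + r%:Z) (Hn : n' = n + 1).

Definition page_diff of filtered_complex d A F & b' = b + r%:Z & n' = n + 1 :=
  fun X : page r b n => page_class r b' n' (d (\val (repr X))).

Lemma page_cycle_diff x :
  x \in page_cycle r%:Z b n -> d x \in page_cycle r%:Z b' n'.
Proof.
case/and3P=> Ax Fx Fdx; apply/and3P; rewrite Hb Hn.
by rewrite (fc_degree fc) // Fdx (fc_square fc Ax) rpred0.
Qed.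

Lemma page_bound_diff x :
  x \in page_bound r%:Z b n -> d x \in page_bound r%:Z b' n'.
Proof.
case/asboolP=> y [z [Zy Zz ->]]; apply/asboolP; exists 0, y.
rewrite rpred0 add0r linearD; have /and3P[Az _ _] := Zz.
by rewrite (fc_square fc Az) addr0 Hb Hn !addrK.
Qed.

Lemma page_diff_class x : x \in page_cycle r%:Z b n ->
  page_diff fc Hb Hn (page_class r b n x) = page_class r b' n' (d x).
Proof.
move=> Zx; rewrite /page_diff.
set X := page_class r b n x; set y := \val (repr X).
have Zy : y \in page_cycle r%:Z b n by exact: valP.
apply/(sqclassP _ (page_cycle_diff Zy) (page_cycle_diff Zx)); rewrite -linearB.
apply: page_bound_diff; apply/(sqclassP _ Zy Zx).
by rewrite {1}/sqclass /y valKd [LHS]lproj_repr.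
Qed.

Fact page_diff_linear : linear (page_diff fc Hb Hn).
Proof.
move=> a X Y; have [x Zx ->] := sqclass_surj X.
have [y Zy ->] := sqclass_surj Y; rewrite -sqclass_linear //.
rewrite !page_diff_class ?rpredD ?rpredZ // linearP.
by rewrite [LHS]sqclass_linear ?page_cycle_diff.
Qed.

HB.instance Definition _ := GRing.isLinear.Build K (page r b n) (page r b' n') _
  (page_diff fc Hb Hn) page_diff_linear.

End PageDifferential.

Definition spectral_sequence (fc : filtered_complex d A F) : Prop :=
  (forall r b n b' n' b'' n'' (Hb : b' = b + r%:Z) (Hn : n' = n + 1)
      (Hb' : b'' = b' + r%:Z) (Hn' : n'' = n' + 1) (X : page r b n),
    page_diff fc Hb' Hn' (page_diff fc Hb Hn X) = 0) /\
  (forall r b n,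
    induced_iso (page_class r b n)
      (page_cycle r.+1%:Z b n) (page_bound r.+1%:Z b n)
      (ker_in (full (page r b n))
        (page_diff fc (erefl (b + r%:Z)) (erefl (n + 1))))
      (im_of (full (page r (b - r%:Z) (n - 1)))
        (page_diff fc (esym (subrK r%:Z b)) (esym (subrK 1 n))))).

Definition coh (n : int) : lmodType K := homology (A (n - 1)) d (A n) d.

Definition coh_class n : V -> coh n := hclass (A (n - 1)) d (A n) d.

Definition coh_filt (n b : int) : {pred coh n} :=
  [pred X | `[< exists2 x, (x \in ker_in (A n) d) && (x \in F b) &
                           X = coh_class n x >]].

Arguments coh_filt : clear implicits.

Fact coh_filt_closed n b : subsemimod_closed (coh_filt n b).
Proof.
apply: GRing.submod_closed_semi; split=> [|a X Y].
  apply/asboolP; exists 0; first by rewrite !rpred0.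
  by rewrite /coh_class /hclass sqclass0.
move=> /asboolP[x /andP[Zx Fx] ->] /asboolP[y /andP[Zy Fy] ->].
apply/asboolP; exists (a *: x + y); first by rewrite !rpredD ?rpredZ.
by rewrite /coh_class /hclass sqclass_linear.
Qed.

HB.instance Definition _ n b :=
  GRing.isSubmodClosed.Build K (coh n) (coh_filt n b) (coh_filt_closed n b).

(* In each degree, the filtration of the cohomology is finite and its graded  *)
(* pieces are canonically the terms of all far enough pages.                  *)
Definition converges : Prop := forall n : int,
  [/\ exists b, forall X : coh n, X \in coh_filt n b,
      exists b, forall X : coh n, X \in coh_filt n b -> X = 0
    & forall b, exists r0, forall r, (r0 <= r)%N ->
        exists2 phi : {linear subquot (coh_filt n b) (coh_filt n (b + 1)) ->
                              page r b n},
          bijective phi &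
          forall x, x \in ker_in (A n) d -> x \in F b ->
            phi (sqclass (coh_filt n b) (coh_filt n (b + 1)) (coh_class n x)) =
            page_class r b n x].

End SpectralSequence.

(******************************************************************************)
(* Graph complexes                                                            *)
(*  lgraph v e == graphs on the vertices 'I_v with edges numbered by 'I_e     *)
(*                and directed, without tadpoles; the half-edges are the      *)
(*                (k, i) : 'I_e * bool, and g h is the vertex h is attached to*)
(* coinv K v e == the K-module spanned by lgraph v e, modulo renumbering the  *)
(*                vertices and reversing edges (no sign) and renumbering the  *)
(*                edges (sign of the permutation)                             *)
(*    gclass g == the class of g                                              *)
(*       fGC K == the product of all coinv K v e, v >= 1; beware that the     *)
(*                component of c : fGC K on v.+1 vertices and e edges is c v e*)
(*  fGC_ge K i == the subspace of fGC K for at least i-valent graphs          *)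
(* fGC_degree K i n, fGC_part K i b n == the parts of fGC_ge K i with e = n,  *)
(*                and with e = n and e - v = b                                *)
(* fGC_filt K b == the subspace of fGC K for graphs with e - v >= b           *)
(* delta, nabla, Dop, tdelta == the operators delta, nabla, D and             *)
(*                delta + D nabla on fGC K                                    *)
(******************************************************************************)

Record lgraph (v e : nat) := LGraph {
  ends :> {ffun 'I_e * bool -> 'I_v};
  _ : [forall k, ends (k, false) != ends (k, true)]
}.

HB.instance Definition _ v e := [isSub for @ends v e].
HB.instance Definition _ v e := [Finite of lgraph v e by <:].

Definition valence v e (g : lgraph v e) (x : 'I_v) : nat :=
  #|[set h | g h == x]|.

Definition min_valence v e (i : nat) (g : lgraph v e) : bool :=
  [forall x, (i <= valence g x)%N].

Section Relabel.
Variables (v e : nat) (s : 'S_v) (t : 'S_e) (f : {ffun 'I_e -> bool}).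

Definition relabel_half (h : 'I_e * bool) : 'I_e * bool :=
  (t h.1, f h.1 (+) h.2).

Lemma relabel_half_inj : injective relabel_half.
Proof.
move=> [k i] [l j] [/perm_inj<- /(congr1 (addb (f k)))].
by rewrite !addbA addbb /= => ->.
Qed.

Fact relabel_subproof (g : lgraph v e) :
  [forall k, [ffun h => s (g (relabel_half h))] (k, false) !=
             [ffun h => s (g (relabel_half h))] (k, true)].
Proof.
apply/forallP=> k; rewrite !ffunE (inj_eq perm_inj) /relabel_half /=.
have /forallP/(_ (t k)) := valP g.
by case: (f k) => //=; rewrite eq_sym.
Qed.

Definition relabel (g : lgraph v e) : lgraph v e := LGraph (relabel_subproof g).

Lemma relabelE g h : relabel g h = s (g (relabel_half h)).
Proof. by rewrite /= ffunE. Qed.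

Lemma forall_relabel_half (P : pred ('I_e * bool)) :
  [forall h, P (relabel_half h)] = [forall h, P h].
Proof.
apply/forallP/forallP=> Ph h //.
by rewrite -(f_finv relabel_half_inj h).
Qed.

Lemma relabel_inj : injective relabel.
Proof.
move=> g g' /(congr1 (@ends v e))/ffunP eq_g; apply/val_inj/ffunP=> h.
move: (eq_g (finv relabel_half h)); rewrite !relabelE.
by rewrite (f_finv relabel_half_inj) => /perm_inj.
Qed.

Lemma valence_relabel g x : valence (relabel g) (s x) = valence g x.
Proof.
rewrite /valence -[RHS](card_preimset _ relabel_half_inj).
by apply: eq_card => h; rewrite !inE relabelE (inj_eq perm_inj).
Qed.

End Relabel.

Section Coinvariants.
Variable K : fieldType.

Section Fixed.
Variables v e : nat.

Definition gvect (g : lgraph v e) : {ffun lgraph v e -> K^o} :=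
  [ffun g' => (g' == g)%:R].

Definition relator (p : 'S_v * 'S_e * {ffun 'I_e -> bool} * lgraph v e) :=
  let: (s, t, f, g) := p in
  gvect (relabel s t f g) - (-1) ^+ odd_perm t *: gvect g.

Definition coinv : lmodType K := lquot <<codom relator>>%VS.

Definition gclass (g : lgraph v e) : coinv := lproj <<codom relator>>%VS (gvect g).

Lemma gclass_relabel s t f g :
  gclass (relabel s t f g) = (-1) ^+ odd_perm t *: gclass g.
Proof.
rewrite /gclass -linearZ_LR; apply/lprojP.
by apply/memv_span/codomP; exists (s, t, f, g).
Qed.

Definition coinv_ge (i : nat) : {pred coinv} :=
  [pred X | `[< exists c : lgraph v e -> K,
                 X = \sum_(g | min_valence i g) c g *: gclass g >]].

Fact coinv_ge_closed i : subsemimod_closed (coinv_ge i).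
Proof.
split=> [|a X]; first split=> [|X Y].
- by apply/asboolP; exists (fun=> 0); rewrite big1 // => g _; rewrite scale0r.
- move=> /asboolP[c ->] /asboolP[c' ->]; apply/asboolP.
  exists (fun g => c g + c' g); rewrite -big_split.
  by apply: eq_bigr => g _; rewrite scalerDl.
- move=> /asboolP[c ->]; apply/asboolP; exists (fun g => a * c g).
  by rewrite scaler_sumr; apply: eq_bigr => g _; rewrite scalerA.
Qed.

HB.instance Definition _ i :=
  GRing.isSubmodClosed.Build K coinv (coinv_ge i) (coinv_ge_closed i).

Section Map.
Variables (W : lmodType K) (phi : lgraph v e -> W).

Definition extend (x : {ffun lgraph v e -> K^o}) : W := \sum_g x g *: phi g.

Fact extend_linear : linear extend.
Proof.
move=> a x y; rewrite /extend scaler_sumr -big_split; apply: eq_bigr => g _.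
by rewrite !ffunE scalerDl scalerA.
Qed.

HB.instance Definition _ :=
  GRing.isLinear.Build K _ W _ extend extend_linear.

Lemma extend_gvect g : extend (gvect g) = phi g.
Proof.
rewrite /extend (bigD1 g) //= ffunE eqxx scale1r big1 ?addr0 // => g' /negPf ne.
by rewrite ffunE ne scale0r.
Qed.

(* The map induced by phi on coinvariants, for phi compatible with relabelling*)
Definition coinv_map (X : coinv) : W := extend (repr X).

Hypothesis phi_relabel : forall s t f g,
  phi (relabel s t f g) = (-1) ^+ odd_perm t *: phi g.

Lemma coinv_map_proj x : coinv_map (lproj <<codom relator>>%VS x) = extend x.
Proof.
have rel0 p : extend (relator p) = 0.
  case: p => [[[s t] f] g]; rewrite /relator linearB linearZ_LR.
  by rewrite /= !extend_gvect phi_relabel subrr.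
rewrite /coinv_map; set y := repr _; apply/eqP; rewrite -subr_eq0 -linearB.
have: y - x \in <<in_tuple (codom relator)>>%VS.
  by apply/lprojP; rewrite lproj_repr.
move=> /coord_span->; rewrite linear_sum big1 // => i _; rewrite linearZ_LR.
have : (in_tuple (codom relator))`_i \in codom relator by rewrite mem_nth.
by case/codomP=> p ->; rewrite /= rel0 scaler0.
Qed.

Lemma coinv_map_linear : linear coinv_map.
Proof.
move=> a X Y; rewrite -[X]lproj_repr -[Y]lproj_repr -linearP.
by rewrite !coinv_map_proj linearP.
Qed.

Lemma coinv_map_class g : coinv_map (gclass g) = phi g.
Proof. by rewrite coinv_map_proj extend_gvect. Qed.

End Map.

Lemma sum_gclass_relabel s t f (P Q : pred (lgraph v e)) :
    (forall g, Q (relabel s t f g) = P g) ->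
  \sum_(g | Q g) gclass g = (-1) ^+ odd_perm t *: \sum_(g | P g) gclass g.
Proof.
move=> PQ; rewrite (reindex_inj (@relabel_inj v e s t f)) scaler_sumr.
by apply: eq_big => g; rewrite ?PQ // => _; rewrite gclass_relabel.
Qed.

End Fixed.

(* A new vertex or a new edge is numbered by ord_max, so that lift ord_max    *)
(* renumbers the old ones.                                                    *)
Definition old_half e (h : 'I_e * bool) : 'I_e.+1 * bool :=
  (lift ord_max h.1, h.2).

Definition new_edge v e (x y : 'I_v) (g : lgraph v e.+1) : bool :=
  (g (ord_max, false) == x) && (g (ord_max, true) == y).

(* The relations below single out the labelled graphs g' obtained from g, by  *)
(* splitting x, by adding an edge from x to a new vertex, by adding an edge   *)
(* from x to y, and by deleting x; in the last one, lift x numbers in 'I_v.+1 *)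
(* the vertices other than x, and the half-edges at x go anywhere in g',      *)
(* which is without tadpoles.                                                 *)
Definition split_at v e (x : 'I_v) (g : lgraph v e) (g' : lgraph v.+1 e.+1) :=
  [forall h, if g h == x then g' (old_half h) \in [:: lift ord_max x; ord_max]
             else g' (old_half h) == lift ord_max (g h)]
  && new_edge (lift ord_max x) ord_max g'.

Definition antenna_at v e (x : 'I_v) (g : lgraph v e) (g' : lgraph v.+1 e.+1) :=
  [forall h, g' (old_half h) == lift ord_max (g h)]
  && new_edge (lift ord_max x) ord_max g'.

Definition joined v e (x y : 'I_v) (g : lgraph v e) (g' : lgraph v e.+1) :=
  [forall h, g' (old_half h) == g h] && new_edge x y g'.

Definition reconnected v e (x : 'I_v.+1) (g : lgraph v.+1 e) (g' : lgraph v e) :=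
  [forall h, (g h != x) ==> (lift x (g' h) == g h)].

Definition delta_graph v e (g : lgraph v e) : coinv v.+1 e.+1 :=
  \sum_x (2%:R^-1 *: (\sum_(g' | split_at x g g') gclass g')
          - \sum_(g' | antenna_at x g g') gclass g').

Definition nabla_graph v e (g : lgraph v e) : coinv v e.+1 :=
  \sum_(p : 'I_v * 'I_v | p.1 != p.2)
    \sum_(g' | joined p.1 p.2 g g') gclass g'.

Definition D_graph v e (g : lgraph v.+1 e) : coinv v e :=
  \sum_x (-1) ^+ valence g x *: \sum_(g' | reconnected x g g') gclass g'.

Section Compatibility.
Variables (v e : nat) (t : 'S_e) (f : {ffun 'I_e -> bool}).

Let t' : 'S_e.+1 := lift_perm ord_max ord_max t.
Let f' : {ffun 'I_e.+1 -> bool} :=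
  [ffun k => if unlift ord_max k is Some j then f j else false].

Let odd_t' : odd_perm t' = odd_perm t.
Proof. by rewrite odd_lift_perm addbb. Qed.

Let old_half_relabel h :
  relabel_half t' f' (old_half h) = old_half (relabel_half t f h).
Proof. by rewrite /relabel_half /old_half /= lift_perm_lift ffunE liftK. Qed.

Let new_half_relabel i : relabel_half t' f' (ord_max, i) = (ord_max, i).
Proof. by rewrite /relabel_half /= lift_perm_id ffunE unlift_none. Qed.

Let new_edge_relabel n (s : 'S_n) x y (g : lgraph n e.+1) :
  new_edge (s x) (s y) (relabel s t' f' g) = new_edge x y g.
Proof.
by rewrite /new_edge !relabelE !new_half_relabel !(inj_eq perm_inj).
Qed.

Fact delta_graph_relabel (s : 'S_v) g :
  delta_graph (relabel s t f g) = (-1) ^+ odd_perm t *: delta_graph g.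
Proof.
pose s' : 'S_v.+1 := lift_perm ord_max ord_max s.
have s'l x : lift ord_max (s x) = s' (lift ord_max x).
  by rewrite /s' lift_perm_lift.
have s'm : ord_max = s' ord_max by rewrite /s' lift_perm_id.
have new_s x g' : new_edge (lift ord_max (s x)) ord_max (relabel s' t' f' g') =
                  new_edge (lift ord_max x) ord_max g'.
  by rewrite -[RHS](new_edge_relabel s') s'l -s'm.
rewrite /delta_graph scaler_sumr (reindex_inj (@perm_inj _ s)).
apply: eq_bigr => x _; rewrite scalerBr; congr (_ - _).
  rewrite scalerA mulrC -scalerA -odd_t'; congr (_ *: _).
  apply: (@sum_gclass_relabel _ _ s' t' f') => g'; rewrite /split_at.
  rewrite new_s; congr (_ && _).
  rewrite -[RHS](forall_relabel_half t f); apply: eq_forallb => h.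
  rewrite !relabelE old_half_relabel !s'l !inE.
  have eq_m a : (s' a == ord_max) = (a == ord_max).
    by rewrite [in LHS]s'm (inj_eq perm_inj).
  by rewrite eq_m !(inj_eq perm_inj).
rewrite -odd_t'.
apply: (@sum_gclass_relabel _ _ s' t' f') => g'; rewrite /antenna_at.
rewrite new_s; congr (_ && _).
rewrite -[RHS](forall_relabel_half t f); apply: eq_forallb => h.
by rewrite !relabelE old_half_relabel s'l (inj_eq perm_inj).
Qed.

Fact nabla_graph_relabel (s : 'S_v) g :
  nabla_graph (relabel s t f g) = (-1) ^+ odd_perm t *: nabla_graph g.
Proof.
rewrite /nabla_graph scaler_sumr.
rewrite (reindex_inj (h := fun p : 'I_v * 'I_v => (s p.1, s p.2))); last first.
  by move=> [x y] [x' y'] [/perm_inj-> /perm_inj->].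
apply: eq_big => [p|p _]; first by rewrite (inj_eq perm_inj).
rewrite -odd_t'; apply: (@sum_gclass_relabel _ _ s t' f') => g'.
rewrite /joined new_edge_relabel; congr (_ && _).
rewrite -[RHS](forall_relabel_half t f); apply: eq_forallb => h.
by rewrite !relabelE old_half_relabel (inj_eq perm_inj).
Qed.

Fact D_graph_relabel (s : 'S_v.+1) g :
  D_graph (relabel s t f g) = (-1) ^+ odd_perm t *: D_graph g.
Proof.
rewrite /D_graph scaler_sumr (reindex_inj (@perm_inj _ s)).
apply: eq_bigr => x _; rewrite valence_relabel scalerA mulrC -scalerA.
congr (_ *: _).
have lift_ex j : {k | s (lift x j) = lift (s x) k}.
  have : s x != s (lift x j) by rewrite (inj_eq perm_inj) neq_lift.
  by case/unlift_some=> k -> _; exists k.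
pose r j := sval (lift_ex j).
have sl j : s (lift x j) = lift (s x) (r j) by exact: (svalP (lift_ex j)).
have r_inj : injective r.
  move=> i j /(congr1 (lift (s x))); rewrite -!sl.
  by move=> /perm_inj/lift_inj.
apply: (@sum_gclass_relabel _ _ (perm r_inj) t f) => g'; rewrite /reconnected.
rewrite -[RHS](forall_relabel_half t f); apply: eq_forallb => h.
by rewrite !relabelE permE -sl !(inj_eq perm_inj).
Qed.

End Compatibility.

Definition delta_coinv v e : coinv v e -> coinv v.+1 e.+1 :=
  coinv_map (@delta_graph v e).

Definition nabla_coinv v e : coinv v e -> coinv v e.+1 :=
  coinv_map (@nabla_graph v e).

Definition D_coinv v e : coinv v.+1 e -> coinv v e :=
  coinv_map (@D_graph v e).

HB.instance Definition _ v e := GRing.isLinear.Build K _ _ _ (@delta_coinv v e)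
  (coinv_map_linear (fun s t f g => delta_graph_relabel t f s g)).
HB.instance Definition _ v e := GRing.isLinear.Build K _ _ _ (@nabla_coinv v e)
  (coinv_map_linear (fun s t f g => nabla_graph_relabel t f s g)).
HB.instance Definition _ v e := GRing.isLinear.Build K _ _ _ (@D_coinv v e)
  (coinv_map_linear (fun s t f g => D_graph_relabel t f s g)).

Lemma delta_coinv_class v e (g : lgraph v e) :
  delta_coinv (gclass g) = delta_graph g.
Proof. by apply: coinv_map_class => *; apply: delta_graph_relabel. Qed.

Lemma nabla_coinv_class v e (g : lgraph v e) :
  nabla_coinv (gclass g) = nabla_graph g.
Proof. by apply: coinv_map_class => *; apply: nabla_graph_relabel. Qed.

Lemma D_coinv_class v e (g : lgraph v.+1 e) : D_coinv (gclass g) = D_graph g.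
Proof. by apply: coinv_map_class => *; apply: D_graph_relabel. Qed.

End Coinvariants.

Section GraphComplex.
Variable K : fieldType.

Definition fGC : Type := forall v e : nat, coinv K v.+1 e.

HB.instance Definition _ := Choice.on fGC.

Implicit Types c : fGC.

Lemma fGCP c c' : (forall v e, c v e = c' v e) -> c = c'.
Proof.
by move=> eq_c; do 2!apply: functional_extensionality_dep => ?; apply: eq_c.
Qed.

Definition fGC_zero : fGC := fun v e => 0.
Definition fGC_opp c : fGC := fun v e => - c v e.
Definition fGC_add c c' : fGC := fun v e => c v e + c' v e.
Definition fGC_scale (a : K) c : fGC := fun v e => a *: c v e.

Fact fGC_addA : associative fGC_add.
Proof. by move=> *; apply: fGCP => v e; apply: addrA. Qed.
Fact fGC_addC : commutative fGC_add.
Proof. by move=> *; apply: fGCP => v e; apply: addrC. Qed.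
Fact fGC_add0 : left_id fGC_zero fGC_add.
Proof. by move=> *; apply: fGCP => v e; apply: add0r. Qed.
Fact fGC_addN : left_inverse fGC_zero fGC_opp fGC_add.
Proof. by move=> *; apply: fGCP => v e; apply: addNr. Qed.

HB.instance Definition _ :=
  GRing.isZmodule.Build fGC fGC_addA fGC_addC fGC_add0 fGC_addN.

Fact fGC_scaleA a b c : fGC_scale a (fGC_scale b c) = fGC_scale (a * b) c.
Proof. by apply: fGCP => v e; apply: scalerA. Qed.
Fact fGC_scale1 : left_id 1 fGC_scale.
Proof. by move=> c; apply: fGCP => v e; apply: scale1r. Qed.
Fact fGC_scaleDr : right_distributive fGC_scale +%R.
Proof. by move=> *; apply: fGCP => v e; apply: scalerDr. Qed.
Fact fGC_scaleDl c : {morph fGC_scale^~ c : a b / a + b}.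
Proof. by move=> *; apply: fGCP => v e; apply: scalerDl. Qed.

HB.instance Definition _ := GRing.Zmodule_isLmodule.Build K fGC
  fGC_scaleA fGC_scale1 fGC_scaleDr fGC_scaleDl.

Definition delta c : fGC := fun v e =>
  match v, e with
  | v'.+1, e'.+1 => delta_coinv (c v' e')
  | _, _ => 0
  end.

Definition nabla c : fGC := fun v e =>
  if e is e'.+1 then nabla_coinv (c v e') else 0.

(* A graph with a single vertex is sent to 0: there is no graph without       *)
(* vertices in fGC.                                                           *)
Definition Dop c : fGC := fun v e => D_coinv (c v.+1 e).

Fact delta_linear : linear delta.
Proof.
move=> a c c'; apply: fGCP => -[|v] [|e];
  by [rewrite [LHS]/= -[RHS]/(a *: 0 + 0) scaler0 addr0 | apply: linearP].
Qed.

Fact nabla_linear : linear nabla.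
Proof.
move=> a c c'; apply: fGCP => v [|e];
  by [rewrite [LHS]/= -[RHS]/(a *: 0 + 0) scaler0 addr0 | apply: linearP].
Qed.

Fact Dop_linear : linear Dop.
Proof. by move=> a c c'; apply: fGCP => v e; apply: linearP. Qed.

HB.instance Definition _ := GRing.isLinear.Build K fGC fGC _ delta delta_linear.
HB.instance Definition _ := GRing.isLinear.Build K fGC fGC _ nabla nabla_linear.
HB.instance Definition _ := GRing.isLinear.Build K fGC fGC _ Dop Dop_linear.

Definition tdelta : {linear fGC -> fGC} := delta \+ (Dop \o nabla).

(* c has components only on v vertices and e edges with P v e                 *)
Definition fGC_supp (P : nat -> nat -> bool) : {pred fGC} :=
  [pred c | `[< forall v e, ~~ P v.+1 e -> c v e = 0 >]].

Fact fGC_supp_closed P : subsemimod_closed (fGC_supp P).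
Proof.
split=> [|a c]; first split=> [|c c'].
- by apply/asboolP.
- move=> /asboolP c0 /asboolP c'0; apply/asboolP => v e nP.
  by rewrite -[LHS]/(c v e + c' v e) c0 // c'0 // addr0.
- move=> /asboolP c0; apply/asboolP => v e nP.
  by rewrite -[LHS]/(a *: c v e) c0 // scaler0.
Qed.

HB.instance Definition _ P :=
  GRing.isSubmodClosed.Build K fGC (fGC_supp P) (fGC_supp_closed P).

Definition fGC_ge (i : nat) : {pred fGC} :=
  [pred c | `[< forall v e, c v e \in coinv_ge i >]].

Fact fGC_ge_closed i : subsemimod_closed (fGC_ge i).
Proof.
split=> [|a c]; first split=> [|c c'].
- by apply/asboolP => v e; apply: rpred0.
- move=> /asboolP Cc /asboolP Cc'; apply/asboolP => v e.
  exact: (rpredD (Cc v e) (Cc' v e)).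
- move=> /asboolP Cc; apply/asboolP => v e.
  rewrite -[(a *: c) v e]/(a *: c v e) rpredZ //; exact: (Cc v e).
Qed.

HB.instance Definition _ i :=
  GRing.isSubmodClosed.Build K fGC (fGC_ge i) (fGC_ge_closed i).

Definition fGC_degree (i : nat) (n : int) : submodClosed fGC :=
  cap_sub (fGC_ge i) (fGC_supp (fun v e => e%:Z == n)).

Definition fGC_part (i : nat) (b n : int) : submodClosed fGC :=
  cap_sub (fGC_degree i n) (fGC_supp (fun v e => e%:Z - v%:Z == b)).

Definition fGC_filt (b : int) : submodClosed fGC :=
  fGC_supp (fun v e => b <= e%:Z - v%:Z).

End GraphComplex.

Arguments fGC_ge K i : clear implicits.
Arguments fGC_degree K i n : clear implicits.
Arguments fGC_part K i b n : clear implicits.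
Arguments fGC_filt K b : clear implicits.
Arguments delta {K} c.
Arguments tdelta {K}.

(* Main.v *)
Require Import Defs.
From HB Require Import structures.
From mathcomp Require Import all_boot all_order perm all_algebra.
From mathcomp Require Import boolp ring zify.

Set Implicit Arguments.
Unset Strict Implicit.
Unset Printing Implicit Defensive.

Import Order.TTheory GRing.Theory.
Local Open Scope ring_scope.

(* A graph on [v] vertices is a monomial in the exterior algebra on the edges of
   the complete graph, taken modulo permutations of the vertices; [delta] and [D]
   are then substitutions of edges and [nabla] is a multiplication. This gives
   [delta^2 = nabla^2 = 0] and [D delta - delta D = nabla], hence
   [delta nabla = - nabla delta]; on graphs of valence at least 2 also [D^2 = 0],
   hence [D nabla = - nabla D]. With [eps] the sign of the parity of [v + e], it
   follows that [tdelta (1 - D eps) = (1 - D eps) (delta + nabla eps)], so that it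
   suffices to show that [d' = delta + nabla eps] is acyclic.

   On all graphs with [v] vertices, removing edges contracts [nabla] if [v >= 2].
   Deleting isolated vertices commutes with [nabla], is onto, and its kernel is
   spanned by the graphs without isolated vertices: these are [nabla]-acyclic too,
   and by induction on [v] they are [d']-acyclic in degrees at least 2.

   The graded commutator of [d'] with the removal of leaves commutes with [d'],
   vanishes on graphs of valence at least 2, and on graphs without isolated
   vertices it is triangular for the number of leaves, with non-zero eigenvalues
   on the graphs that have leaves. A polynomial in it therefore moves any
   primitive of a cocycle of valence at least 2 into valence at least 2.

   Finally [delta] and [D nabla] preserve the parity of [e - v]. *)

(** * Graphs as products of linear forms in an exterior algebra *)

Section Wedge.
Variable K : fieldType.

(** The obstacle is a mismatch of valences. The easy homotopy for [nabla], removal of edges,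
    respects no valence condition, while [D] squares to zero only on graphs of valence at least 2;
    so the conjugation by [1 - D eps] is carried out there, where its inverse is [1 + D eps] because
    [(D eps)^2 = - D^2]. Acyclicity thus has to descend from all graphs, past isolated vertices and
    then leaves. The sign [eps] commutes with [delta] and anticommutes with [nabla] and [D], so that
    [- D eps nabla eps] is exactly [D nabla]. The bound on the degree is sharp: a single edge on two
    vertices is a cocycle of degree 1 without a primitive free of isolated vertices. It is harmless,
    since valence at least 2 forces at least two edges. Although [fGC] is an infinite product, all
    inductions stop: without isolated vertices $v \le 2e$, so that each degree contains finitely
    many graphs. With valence at least 2 even $0 \le e - v < e$, so that the filtration is finite in
    each degree and convergence only asks that far pages vanish. *)

Definition eform (v : nat) := 'I_v -> 'I_v -> K.

(* The product of the linear forms [S k] in the exterior algebra on the edges of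
   the complete graph, up to permutation of the vertices. A linear form is given
   by its coefficients, those on the diagonal being irrelevant, so that collapsing
   or omitting vertices acts on forms by pull-back. *)
Definition wedge v e (S : 'I_e -> eform v) : coinv K v e :=
  \sum_(g : lgraph v e)
    (\prod_k S k (g (k, false)) (g (k, true))) *: gclass K g.

Definition efm v (x y : 'I_v) : eform v := fun a b => ((a == x) && (b == y))%:R.

Definition gform v e (g : lgraph v e) : 'I_e -> eform v :=
  fun k => efm (g (k, false)) (g (k, true)).

Lemma ends_neq v e (g : lgraph v e) k : g (k, false) != g (k, true).
Proof. by have /forallP := valP g; apply. Qed.

Lemma prod_natb (I : finType) (b : I -> bool) :
  \prod_i (b i)%:R = [forall i, b i]%:R :> K.
Proof.
case: (boolP [forall i, b i]) => [/forallP ball|/forallPn[i ni]].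
  by rewrite big1 // => i _; rewrite ball.
by rewrite (bigD1 i) //= (negPf ni) mul0r.
Qed.

Lemma lgraphP v e (g g' : lgraph v e) :
  (forall k, g (k, false) = g' (k, false) /\ g (k, true) = g' (k, true)) ->
  g = g'.
Proof.
by move=> eg; apply/val_inj/ffunP=> -[k []]; have [] := eg k.
Qed.

Lemma gform_prod v e (g g' : lgraph v e) :
  \prod_k gform g k (g' (k, false)) (g' (k, true)) = (g' == g)%:R.
Proof.
rewrite prod_natb; congr (nat_of_bool _)%:R.
apply/idP/idP => [/forallP eg|/eqP->].
  by rewrite (@lgraphP _ _ g' g) // => k; have /andP[/eqP-> /eqP->] := eg k.
by apply/forallP=> k; rewrite !eqxx.
Qed.

Lemma wedge_gform v e (g : lgraph v e) : wedge (gform g) = gclass K g.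
Proof.
rewrite /wedge (bigD1 g) //= gform_prod eqxx scale1r big1 ?addr0 // => g' ne.
by rewrite gform_prod (negPf ne) scale0r.
Qed.

Lemma coinv_gclass v e (X : coinv K v e) :
  exists c : lgraph v e -> K, X = \sum_g c g *: gclass K g.
Proof.
rewrite -[X]lproj_repr; set x := repr X; exists x.
have {1}-> : x = \sum_g x g *: gvect K g.
  apply/ffunP=> g; rewrite sum_ffunE (bigD1 g) //= !ffunE eqxx [_ *: _]mulr1.
  rewrite big1 ?addr0 // => g' ne.
  by rewrite !ffunE eq_sym (negPf ne) [_ *: _]mulr0.
by rewrite linear_sum; apply: eq_bigr => g _; rewrite linearZ_LR.
Qed.

(** A graph is itself the product of its edges, so identities of operators may be checked on
    arbitrary products, where the operators have closed formulas. *)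
Lemma coinv_wedge_ind v e (W : lmodType K) (f f' : {linear coinv K v e -> W}) :
  (forall S, f (wedge S) = f' (wedge S)) -> f =1 f'.
Proof.
move=> eq_f X; have [c ->] := coinv_gclass X; rewrite !linear_sum.
by apply: eq_bigr => g _; rewrite !linearZ_LR -wedge_gform eq_f.
Qed.

Lemma eq_wedge v e (S S' : 'I_e -> eform v) :
  (forall k a b, a != b -> S k a b = S' k a b) -> wedge S = wedge S'.
Proof.
move=> eqS; apply: eq_bigr => g _; congr (_ *: _).
by apply: eq_bigr => k _; rewrite eqS // ends_neq.
Qed.

Lemma wedge_perm v e (s : 'S_v) (t : 'S_e) (S : 'I_e -> eform v) :
  wedge (fun k a b => S (t k) (s a) (s b)) = (-1) ^+ odd_perm t *: wedge S.
Proof.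
rewrite {2}/wedge (reindex_inj (@relabel_inj v e s (t^-1)%g [ffun=> false])).
rewrite scaler_sumr; apply: eq_bigr => g _.
rewrite gclass_relabel odd_permV !scalerA [_ * (-1) ^+ _]mulrC mulrA.
rewrite -expr2 sqrr_sign mul1r; congr (_ *: _).
rewrite [RHS](reindex_inj (@perm_inj _ t)); apply: eq_bigr => k _.
by rewrite !relabelE /relabel_half !permK !ffunE.
Qed.

Lemma wedge_vperm v e (s : 'S_v) (S : 'I_e -> eform v) :
  wedge (fun k a b => S k (s a) (s b)) = wedge S.
Proof.
have := wedge_perm s 1 S; rewrite odd_perm1 expr0 scale1r => <-.
by apply: eq_wedge => k a b _; rewrite perm1.
Qed.

Lemma wedge_eperm v e (t : 'S_e) (S : 'I_e -> eform v) :
  wedge (fun k => S (t k)) = (-1) ^+ odd_perm t *: wedge S.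
Proof.
rewrite -(wedge_perm 1).
by apply: eq_wedge => k a b _; rewrite !perm1.
Qed.

Lemma wedge_flip v e (f : {ffun 'I_e -> bool}) (S : 'I_e -> eform v) :
  wedge (fun k a b => if f k then S k b a else S k a b) = wedge S.
Proof.
rewrite /wedge (reindex_inj (@relabel_inj v e 1 1 f)).
apply: eq_bigr => g _; rewrite gclass_relabel odd_perm1 expr0 scale1r.
congr (_ *: _); apply: eq_bigr => k _.
by rewrite !relabelE /relabel_half !perm1 /=; case: (f k).
Qed.

Section Characteristic0.
Hypothesis charK : [pchar K] =i pred0.

Lemma natK_neq0 n : (0 < n)%N -> n%:R != 0 :> K.
Proof. by move=> n0; move: charK => /pcharf0P->; rewrite -lt0n. Qed.

(** Edges are undirected, so only the symmetrization of a form matters: the sum over all $2^e$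
    reversals of edges is the product of the symmetrized forms, and $2^e$ is invertible. *)
Lemma wedge_sym v e (S S' : 'I_e -> eform v) :
  (forall k a b, a != b -> S k a b + S k b a = S' k a b + S' k b a) ->
  wedge S = wedge S'.
Proof.
have sum2 (U : 'I_e -> eform v) :
    (2 ^ e)%:R *: wedge U = wedge (fun k a b => U k a b + U k b a).
  transitivity (\sum_(f : {ffun 'I_e -> bool}) wedge U).
    by rewrite sumr_const card_ffun card_bool card_ord scaler_nat.
  rewrite /wedge.
  transitivity (\sum_(f : {ffun 'I_e -> bool})
      wedge (fun k a b => if f k then U k b a else U k a b)).
    by apply: eq_bigr => f _; rewrite wedge_flip.
  rewrite /wedge exchange_big; apply: eq_bigr => g _; rewrite -scaler_suml.
  congr (_ *: _).
  rewrite -(bigA_distr_bigA (fun k (i : bool) =>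
     if i then U k (g (k, true)) (g (k, false))
          else U k (g (k, false)) (g (k, true)))).
  by apply: eq_bigr => k _; rewrite big_bool addrC.
move=> eqS; apply: (scalerI (natK_neq0 (expn_gt0 2 e))).
rewrite !sum2; apply: eq_wedge => k a b ne; exact: eqS.
Qed.

Lemma wedge_alt v e (S : 'I_e -> eform v) j k :
  j != k -> (forall a b, a != b -> S j a b = S k a b) -> wedge S = 0.
Proof.
move=> ne eqS; have := wedge_eperm (tperm j k) S.
rewrite odd_tperm ne expr1 scaleN1r.
have -> : wedge (fun i => S (tperm j k i)) = wedge S.
  by apply: eq_wedge => i a b nab; case: tpermP => // ->; rewrite eqS.
move/eqP; rewrite -subr_eq0 opprK -mulr2n -scaler_nat scaler_eq0.
by rewrite (negPf (natK_neq0 _)) //= => /eqP.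
Qed.

End Characteristic0.
End Wedge.

(** * Functionals on forms, ignoring tadpoles *)

Section Pullback.
Variable K : fieldType.
Local Notation eform := (eform K).

(** Linearity and independence of the diagonal in one condition: [L] is determined by its values on
    single edges without tadpoles. *)
Definition offlin v (L : eform v -> K) : Prop :=
  forall S, L S = \sum_(p : 'I_v * 'I_v | p.1 != p.2)
                    S p.1 p.2 * L (efm K p.1 p.2).

Lemma offlin_entry v (a b : 'I_v) : a != b -> offlin (fun S => S a b).
Proof.
move=> ne S; rewrite (bigD1 (a, b)) //= /efm !eqxx mulr1 big1 ?addr0 //.
by move=> [x y] /= /andP[_ /negPf ne']; rewrite -xpair_eqE eq_sym ne' mulr0.
Qed.

Lemma offlin0 v : offlin (fun _ : eform v => 0).
Proof. by move=> S; rewrite big1 // => p _; rewrite mulr0. Qed.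

Lemma offlinD v (L L' : eform v -> K) :
  offlin L -> offlin L' -> offlin (fun S => L S + L' S).
Proof.
move=> oL oL' S; rewrite oL oL' -big_split.
by apply: eq_bigr => p _; rewrite mulrDr.
Qed.

Lemma offlinN v (L : eform v -> K) : offlin L -> offlin (fun S => - L S).
Proof.
by move=> oL S; rewrite oL -sumrN; apply: eq_bigr => p _; rewrite mulrN.
Qed.

Lemma offlin_sum v (I : finType) (P : pred I) (L : I -> eform v -> K) :
  (forall i, P i -> offlin (L i)) -> offlin (fun S => \sum_(i | P i) L i S).
Proof.
move=> oL S; rewrite (eq_bigr _ (fun i Pi => oL i Pi S)) exchange_big.
by apply: eq_bigr => p _; rewrite mulr_sumr.
Qed.

(** The product of sums expands into a sum over families of off-diagonal pairs, and such a family is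
    the same thing as a graph without tadpoles. *)
Lemma prod_offlin v e (L : 'I_e -> eform v -> K) (S : 'I_e -> eform v) :
    (forall k, offlin (L k)) ->
  \sum_(g : lgraph v e) (\prod_k S k (g (k, false)) (g (k, true))) *
     (\prod_k L k (gform K g k)) = \prod_k L k (S k).
Proof.
move=> oL; rewrite (eq_bigr _ (fun k _ => oL k (S k))).
rewrite bigA_distr_big.
pose E (g : lgraph v e) : {ffun 'I_e -> 'I_v * 'I_v} :=
  [ffun k => (g (k, false), g (k, true))].
have E_on g : E g \in ffun_on (fun p : 'I_v * 'I_v => p.1 != p.2).
  by apply/ffun_onP => k; rewrite ffunE unfold_in /= ends_neq.
have G_sub (f : {ffun 'I_e -> 'I_v * 'I_v}) :
    f \in ffun_on (fun p : 'I_v * 'I_v => p.1 != p.2) -> exists g, E g = f.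
  move/ffun_onP=> f_on; pose h : {ffun 'I_e * bool -> 'I_v} :=
    [ffun h => if h.2 then (f h.1).2 else (f h.1).1].
  have h_on : [forall k, h (k, false) != h (k, true)].
    by apply/forallP=> k; rewrite !ffunE; exact: f_on.
  exists (LGraph h_on); apply/ffunP=> k; rewrite !ffunE /=.
  by case: (f k).
have E_inj : injective E.
  move=> g g' /ffunP eE; apply: lgraphP => k.
  by have := eE k; rewrite !ffunE => -[-> ->].
rewrite (eq_bigl [in E @: [set: lgraph v e]]) => [|f]; last first.
  apply/idP/imsetP => [/G_sub[g <-]|[g _ ->]]; [by exists g | exact: E_on].
rewrite big_imset /=; last by move=> g g' _ _; apply: E_inj.
apply: eq_big => [g|g _]; first by rewrite inE.
by rewrite -big_split; apply: eq_bigr => k _; rewrite ffunE.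
Qed.

End Pullback.

(** * Multilinear functions of forms, and the substitutions behind the operators *)

Section Operators.
Variable K : fieldType.
Local Notation eform := (eform K).

Definition snoc T e (S : 'I_e -> T) (m : T) : 'I_e.+1 -> T :=
  fun k => oapp S m (unlift ord_max k).

Lemma snoc_lift T e (S : 'I_e -> T) m k : snoc S m (lift ord_max k) = S k.
Proof. by rewrite /snoc liftK. Qed.

Lemma snoc_max T e (S : 'I_e -> T) m : snoc S m ord_max = m.
Proof. by rewrite /snoc unlift_none. Qed.

Lemma big_lift_max (R : Type) (idx : R) (op : Monoid.com_law idx) e
    (F : 'I_e.+1 -> R) :
  \big[op/idx]_k F k = op (\big[op/idx]_k F (lift ord_max k)) (F ord_max).
Proof. by rewrite (bigD1_ord ord_max) //= Monoid.mulmC. Qed.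

Lemma wedge_snocE v e (S : 'I_e -> eform v) (m : eform v) :
  wedge (snoc S m) = \sum_(g : lgraph v e.+1)
    (m (g (ord_max, false)) (g (ord_max, true)) *
     \prod_k S k (g (lift ord_max k, false)) (g (lift ord_max k, true)))
       *: gclass K g.
Proof.
apply: eq_bigr => g _; rewrite big_lift_max snoc_max mulrC; congr ((_ * _) *: _).
by apply: eq_bigr => k _; rewrite snoc_lift.
Qed.

Lemma wedge_snoc_sum v e (I : finType) (P : pred I) (c : I -> K)
    (m : I -> eform v) (S : 'I_e -> eform v) :
  wedge (snoc S (fun a b => \sum_(i | P i) c i * m i a b)) =
  \sum_(i | P i) c i *: wedge (snoc S (m i)).
Proof.
rewrite wedge_snocE.
under [RHS]eq_bigr => i _ do rewrite wedge_snocE scaler_sumr.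
rewrite exchange_big; apply: eq_bigr => g _; rewrite mulr_suml scaler_suml.
by apply: eq_bigr => i _; rewrite scalerA mulrA.
Qed.

Lemma wedge_snocD v e (m m' : eform v) (S : 'I_e -> eform v) :
  wedge (snoc S (fun a b => m a b + m' a b)) =
  wedge (snoc S m) + wedge (snoc S m').
Proof.
rewrite !wedge_snocE -big_split; apply: eq_bigr => g _.
by rewrite mulrDl scalerDl.
Qed.

Lemma wedge_snocN v e (m : eform v) (S : 'I_e -> eform v) :
  wedge (snoc S (fun a b => - m a b)) = - wedge (snoc S m).
Proof.
rewrite !wedge_snocE -sumrN; apply: eq_bigr => g _.
by rewrite mulNr scaleNr.
Qed.

Lemma eq_wedge_snoc v e (m m' : eform v) (S S' : 'I_e -> eform v) :
  (forall k a b, a != b -> S k a b = S' k a b) ->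
  (forall a b, a != b -> m a b = m' a b) ->
  wedge (snoc S m) = wedge (snoc S' m').
Proof.
move=> eS em; apply: eq_wedge => k a b ne.
by case: (unliftP ord_max k) => [j ->|->]; rewrite ?snoc_lift ?snoc_max ?eS ?em.
Qed.

(** Multilinearity is stated as the expansion over graphs, the form in which an operator defined on
    graphs extends to products of forms. *)
Definition multilin v e (W : lmodType K) (F : ('I_e -> eform v) -> W) : Prop :=
  forall S, \sum_(g : lgraph v e)
      (\prod_k S k (g (k, false)) (g (k, true))) *: F (gform K g) = F S.

Section Multilinear.
Variables (v e : nat).

Lemma multilin_op (W : lmodType K) (f : {linear coinv K v e -> W})
    (F : ('I_e -> eform v) -> W) :
  multilin F -> (forall g, f (gclass K g) = F (gform K g)) ->
  forall S, f (wedge S) = F S.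
Proof.
move=> mF fF S; rewrite -mF linear_sum.
by apply: eq_bigr => g _; rewrite linearZ_LR fF.
Qed.

Lemma multilinZ (W : lmodType K) (F : ('I_e -> eform v) -> W) a :
  multilin F -> multilin (fun S => a *: F S).
Proof.
move=> mF S; rewrite -[in RHS]mF scaler_sumr.
by apply: eq_bigr => g _; rewrite !scalerA mulrC.
Qed.

Lemma multilinD (W : lmodType K) (F F' : ('I_e -> eform v) -> W) :
  multilin F -> multilin F' -> multilin (fun S => F S + F' S).
Proof.
move=> mF mF' S; rewrite -[in RHS]mF -[in RHS]mF' -big_split.
by apply: eq_bigr => g _; rewrite scalerDr.
Qed.

Lemma multilinN (W : lmodType K) (F : ('I_e -> eform v) -> W) :
  multilin F -> multilin (fun S => - F S).
Proof.
by move=> mF S; rewrite -[in RHS]mF -sumrN; apply: eq_bigr => g _; rewrite scalerN.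
Qed.

Lemma multilin_sum (W : lmodType K) (I : finType) (P : pred I)
    (F : I -> ('I_e -> eform v) -> W) :
  (forall i, P i -> multilin (F i)) -> multilin (fun S => \sum_(i | P i) F i S).
Proof.
move=> mF S; rewrite -[in RHS](eq_bigr _ (fun i Pi => mF i Pi S)) exchange_big.
by apply: eq_bigr => g _; rewrite scaler_sumr.
Qed.

Lemma multilin_prod v' e' (c : lgraph v' e' -> K)
    (L : lgraph v' e' -> 'I_e -> eform v -> K) :
  (forall g k, offlin (L g k)) ->
  multilin (fun S => \sum_g (c g * \prod_k L g k (S k)) *: gclass K g).
Proof.
move=> oL S; under eq_bigr => g _ do rewrite scaler_sumr.
rewrite exchange_big; apply: eq_bigr => g' _.
rewrite -(prod_offlin S (oL g')) mulr_sumr scaler_suml.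
by apply: eq_bigr => g _; rewrite scalerA mulrCA.
Qed.

Definition pullback v' (phi : eform v -> eform v') : Prop :=
  forall a b, a != b -> offlin (fun S => phi S a b).

Lemma multilin_wedge v' (phi : eform v -> eform v') :
  pullback phi -> multilin (fun S : 'I_e -> eform v => wedge (fun k => phi (S k))).
Proof.
move=> pphi S.
have := @multilin_prod v' e (fun=> 1)
  (fun g k S => phi S (g (k, false)) (g (k, true))) _ S.
rewrite /wedge; under [in RHS]eq_bigr => g _ do rewrite mul1r.
move=> <-; last by move=> g k; apply: pphi; rewrite ends_neq.
apply: eq_bigr => g _; congr (_ *: _); apply: eq_bigr => g' _.
by rewrite mul1r.
Qed.

Lemma multilin_wedge_snoc v' (phi : eform v -> eform v') (m : eform v') :
  pullback phi ->
  multilin (fun S : 'I_e -> eform v => wedge (snoc (fun k => phi (S k)) m)).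
Proof.
move=> pphi S.
have := @multilin_prod v' e.+1 (fun g => m (g (ord_max, false)) (g (ord_max, true)))
  (fun g k S => phi S (g (lift ord_max k, false)) (g (lift ord_max k, true))) _ S.
rewrite wedge_snocE => <-; last by move=> g k; apply: pphi; rewrite ends_neq.
by apply: eq_bigr => g _; rewrite wedge_snocE.
Qed.

End Multilinear.

(** The sum of all edges, each in both directions, just as [nabla] adds every edge twice. *)
Definition onef v : eform v := fun a b => 1.
Definition coll v (p : 'I_v) (a : 'I_v.+1) : 'I_v := odflt p (unlift ord_max a).
(** Pull-back along the contraction of the new vertex onto [p]. It sends an edge at [p] to the sum
    of its two redistributions, so that a product of edges becomes the sum over all
    redistributions. *)
Definition sub v (p : 'I_v) (S : eform v) : eform v.+1 :=
  fun a b => if coll p a == coll p b then 0 else S (coll p a) (coll p b).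
Definition inc v (S : eform v) : eform v.+1 := fun a b =>
  if (unlift ord_max a, unlift ord_max b) is (Some a', Some b') then S a' b'
  else 0.
Definition antef v : eform v.+1 := fun a b => (b == ord_max)%:R.
(** An edge at [x] becomes minus the sum over all reconnections of its end. The sign $(-1)^{v(x)}$
    is thus produced factor by factor, and the tadpoles fall on the irrelevant diagonal. *)
Definition delv v (x : 'I_v.+1) (S : eform v.+1) : eform v := fun a b =>
  S (lift x a) (lift x b) - S x (lift x b) - S (lift x a) x.
Definition res v (x : 'I_v.+1) (S : eform v.+1) : eform v := fun a b =>
  S (lift x a) (lift x b).

Lemma coll_lift v (p : 'I_v) a : coll p (lift ord_max a) = a.
Proof. by rewrite /coll liftK. Qed.

Lemma coll_max v (p : 'I_v) : coll p ord_max = p.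
Proof. by rewrite /coll unlift_none. Qed.

Lemma pullback_id v : pullback (fun S : eform v => S).
Proof. by move=> a b; apply: offlin_entry. Qed.

Lemma pullback_sub v (p : 'I_v) : pullback (sub p).
Proof.
move=> a b ne; rewrite /sub.
by case: eqP => [_|/eqP ne']; [apply: offlin0 | apply: offlin_entry].
Qed.

Lemma pullback_inc v : pullback (@inc v).
Proof.
move=> a b; rewrite /inc.
case: (unliftP ord_max a) => [a' ->|->];
  case: (unliftP ord_max b) => [b' ->|->];
  do ?by move=> _; apply: offlin0.
by rewrite (inj_eq lift_inj); apply: offlin_entry.
Qed.

Lemma pullback_delv v (x : 'I_v.+1) : pullback (delv x).
Proof.
move=> a b ne; rewrite /delv.
by do ![apply: offlinD | apply: offlinN]; apply: offlin_entry;
  rewrite ?(inj_eq lift_inj) ?neq_lift // eq_sym neq_lift.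
Qed.

Lemma pullback_res v (x : 'I_v.+1) : pullback (res x).
Proof. by move=> a b ne; apply: offlin_entry; rewrite (inj_eq lift_inj). Qed.

End Operators.
Arguments onef {K v}.
Arguments antef {K v}.

(** * The operators [nabla], [delta] and [D] on products of forms *)

Section DifferentialsOnWedges.
Variable K : fieldType.
Local Notation eform := (eform K).

Lemma forall_half e (P : pred ('I_e * bool)) :
  [forall h, P h] = [forall k, P (k, false) && P (k, true)].
Proof.
apply/forallP/forallP => [Ph k|Ph [k i]]; first by rewrite !Ph.
by case: i; case/andP: (Ph k).
Qed.

Lemma sum_gclass_wedge v e (P : pred (lgraph v e)) (U : 'I_e -> eform v) :
  (forall g : lgraph v e, \prod_k U k (g (k, false)) (g (k, true)) = (P g)%:R) ->
  \sum_(g | P g) gclass K g = wedge U.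
Proof.
move=> PU; rewrite big_mkcond; apply: eq_bigr => g _; rewrite PU.
by case: (P g); rewrite ?scale1r ?scale0r.
Qed.

Lemma prod_snoc_natb v e (S : 'I_e -> eform v) x y (g' : lgraph v e.+1)
    (P : pred ('I_e * bool)) :
  (forall k, S k (g' (old_half (k, false))) (g' (old_half (k, true))) =
     (P (k, false) && P (k, true))%:R) ->
  \prod_k snoc S (efm K x y) k (g' (k, false)) (g' (k, true)) =
  ([forall h, P h] && new_edge x y g')%:R.
Proof.
move=> SP; rewrite big_lift_max snoc_max.
rewrite (eq_bigr (fun k => (P (k, false) && P (k, true))%:R)); last first.
  by move=> k _; rewrite snoc_lift -SP.
by rewrite prod_natb forall_half /efm /= -natrM mulnb.
Qed.

Lemma joined_wedge v e (x y : 'I_v) (g : lgraph v e) :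
  \sum_(g' | joined x y g g') gclass K g' =
  wedge (snoc (gform K g) (efm K x y)).
Proof.
by apply: sum_gclass_wedge => g'; apply: prod_snoc_natb => k.
Qed.

(** The case distinction in [split_at] is a single condition on contracted ends, which makes it a
    product over the edges. *)
Lemma mem_coll v (x a : 'I_v) (b : 'I_v.+1) :
  (if a == x then b \in [:: lift ord_max x; ord_max] else b == lift ord_max a)
  = (coll x b == a).
Proof.
case: (unliftP ord_max b) => [b' ->|->]; rewrite ?coll_lift ?coll_max !inE.
  rewrite !(inj_eq lift_inj) [_ == ord_max]eq_sym (negPf (neq_lift _ _)) orbF.
  by case: (eqVneq a x) => [->|_].
by rewrite eqxx orbT (negPf (neq_lift _ _)) [in RHS]eq_sym; case: (a == x).
Qed.

Lemma split_wedge v e (x : 'I_v) (g : lgraph v e) :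
  \sum_(g' | split_at x g g') gclass K g' =
  wedge (snoc (fun k => sub x (gform K g k)) (efm K (lift ord_max x) ord_max)).
Proof.
apply: sum_gclass_wedge => g'; apply: prod_snoc_natb => k.
rewrite !mem_coll /sub /gform /efm; case: eqP => // ->.
by case: eqP => // ->; rewrite (negPf (ends_neq g k)).
Qed.

Lemma antenna_wedge v e (x : 'I_v) (g : lgraph v e) :
  \sum_(g' | antenna_at x g g') gclass K g' =
  wedge (snoc (fun k => inc (gform K g k)) (efm K (lift ord_max x) ord_max)).
Proof.
apply: sum_gclass_wedge => g'; apply: prod_snoc_natb => k.
rewrite /inc /gform /efm.
case: (unliftP ord_max (g' (old_half (k, false)))) => [a ->|->]; last first.
  by rewrite (negPf (neq_lift _ _)).
case: (unliftP ord_max (g' (old_half (k, true)))) => [b ->|->]; last first.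
  by rewrite (negPf (neq_lift _ _)) andbF.
by rewrite !(inj_eq lift_inj).
Qed.

Lemma valence_edges v e (g : lgraph v e) x :
  valence g x = (\sum_k ((g (k, false) == x) || (g (k, true) == x)))%N.
Proof.
rewrite /valence -sum1_card (eq_bigl (fun h => g h == x)); last first.
  by move=> h; rewrite inE.
rewrite big_mkcond.
transitivity (\sum_k \sum_i (if g (k, i) == x then 1 else 0))%N.
  by rewrite pair_bigA; apply: eq_bigr => -[].
apply: eq_bigr => k _; rewrite big_bool /=; have := ends_neq g k.
case: (eqVneq (g (k, false)) x) => [->|_]; last by case: (_ == x).
by rewrite eq_sym => /negPf->.
Qed.

Lemma reconnected_wedge v e (x : 'I_v.+1) (g : lgraph v.+1 e) :
  (-1) ^+ valence g x *: \sum_(g' | reconnected x g g') gclass K g' =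
  wedge (fun k => delv x (gform K g k)).
Proof.
rewrite big_mkcond scaler_sumr; apply: eq_bigr => g' _.
rewrite (_ : (if _ then _ else _) = (reconnected x g g')%:R *: gclass K g');
  last by case: ifP; rewrite ?scale1r ?scale0r.
rewrite scalerA; congr (_ *: _); rewrite valence_edges.
rewrite -prodrXr /reconnected forall_half -prod_natb -big_split.
apply: eq_bigr => k _; rewrite /delv /gform /efm /=.
have := ends_neq g k; move: (g (k, false)) (g (k, true)) => a b nab.
have lx u : (x == lift x u) = false by rewrite (negPf (neq_lift _ _)).
have lx' u : (lift x u == x) = false by rewrite eq_sym lx.
case: (eqVneq a x) nab => [->|/negPf nax]; case: (eqVneq b x) => [->|/negPf nbx] nab;
  rewrite ?eqxx ?lx ?lx' ?[x == a]eq_sym ?[x == b]eq_sym ?nax ?nbx ?andbF ?andbT /= in nab *.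
  by [].
all: by rewrite ?expr1 ?expr0 ?mulN1r ?mul1r ?subr0 ?sub0r.
Qed.

Lemma nabla_wedge v e (S : 'I_e -> eform v) :
  nabla_coinv (wedge S) = wedge (snoc S onef).
Proof.
rewrite (multilin_op (F := fun S => wedge (snoc S onef))) //.
  exact: (multilin_wedge_snoc _ (@pullback_id _ _)).
move=> g; rewrite [LHS]nabla_coinv_class /nabla_graph.
under eq_bigr => p _ do rewrite joined_wedge -[wedge _]scale1r.
rewrite -wedge_snoc_sum; apply: eq_wedge_snoc => // a b ne.
rewrite /onef (bigD1 (a, b)) //= /efm !eqxx mul1r big1 ?addr0 //.
by move=> [x y] /= /andP[_ /negPf ne']; rewrite -xpair_eqE eq_sym ne' mulr0.
Qed.

Lemma antef_sum v e (S : 'I_e -> eform v.+1) :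
  \sum_x wedge (snoc S (efm K (lift ord_max x) ord_max)) =
  wedge (snoc S antef).
Proof.
under eq_bigr => x _ do rewrite -[wedge _]scale1r.
rewrite -wedge_snoc_sum; apply: eq_wedge_snoc => // a b ne.
rewrite /antef /efm; case: (eqVneq b ord_max) ne => [->|_] ne; last first.
  by rewrite big1 // => i _; rewrite andbF mulr0.
case: (unliftP ord_max a) ne => [a' ->|->]; last by rewrite eqxx.
rewrite (bigD1 a') //= eqxx mulr1 big1 ?addr0 // => i ne.
by rewrite andbT (inj_eq lift_inj) eq_sym (negPf ne) mulr0.
Qed.

Lemma delta_wedge v e (S : 'I_e -> eform v) :
  delta_coinv (wedge S) =
  2%:R^-1 *: (\sum_p wedge (snoc (fun k => sub p (S k))
                                 (efm K (lift ord_max p) ord_max)))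
  - wedge (snoc (fun k => inc (S k)) antef).
Proof.
pose F (S : 'I_e -> eform v) := 2%:R^-1 *: (\sum_p wedge (snoc (fun k => sub p (S k))
                                 (efm K (lift ord_max p) ord_max)))
  - wedge (snoc (fun k => inc (S k)) antef).
rewrite (multilin_op (F := F)) //.
  apply: multilinD; last first.
    by apply: multilinN; apply: multilin_wedge_snoc; apply: pullback_inc.
  apply: multilinZ; apply: multilin_sum => p _; apply: multilin_wedge_snoc.
  exact: pullback_sub.
move=> g; rewrite [LHS]delta_coinv_class /delta_graph sumrB -scaler_sumr.
congr (_ *: _ - _); first by apply: eq_bigr => p _; rewrite split_wedge.
by rewrite -antef_sum; apply: eq_bigr => p _; rewrite antenna_wedge.
Qed.

Lemma D_wedge v e (S : 'I_e -> eform v.+1) :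
  D_coinv (wedge S) = \sum_x wedge (fun k => delv x (S k)).
Proof.
rewrite (multilin_op (F := fun S => \sum_x wedge (fun k => delv x (S k)))) //.
  by apply: multilin_sum => x _; apply: multilin_wedge; apply: pullback_delv.
move=> g; rewrite [LHS]D_coinv_class /D_graph.
by apply: eq_bigr => x _; rewrite reconnected_wedge.
Qed.

End DifferentialsOnWedges.

(** * The squares of [nabla] and [D] *)

Section Identities.
Variable K : fieldType.
Hypothesis charK : [pchar K] =i pred0.
Local Notation eform := (eform K).

Lemma wedge_zero v e (S : 'I_e -> eform v) k :
  (forall a b, a != b -> S k a b = 0) -> wedge S = 0.
Proof.
move=> S0; rewrite /wedge big1 // => g _.
by rewrite (bigD1 k) //= S0 ?ends_neq // mul0r scale0r.
Qed.

Lemma wedge_snoc0 v e (S : 'I_e -> eform v) m :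
  (forall a b, a != b -> m a b = 0) -> wedge (snoc S m) = 0.
Proof. by move=> m0; apply: (@wedge_zero _ _ _ ord_max) => a b; rewrite snoc_max; apply: m0. Qed.

Lemma wedge_snoc2_alt v e (S : 'I_e -> eform v) m m' :
  (forall a b, a != b -> m a b = m' a b) -> wedge (snoc (snoc S m) m') = 0.
Proof.
move=> eqm; apply: (@wedge_alt _ charK _ _ _ (lift ord_max ord_max) ord_max).
  by rewrite eq_sym neq_lift.
by move=> a b ne; rewrite snoc_lift !snoc_max eqm.
Qed.

Lemma wedge_snoc_swap v e (S : 'I_e -> eform v) m m' :
  wedge (snoc (snoc S m) m') = - wedge (snoc (snoc S m') m).
Proof.
pose j : 'I_e.+2 := lift ord_max ord_max.
have jm : j != ord_max by rewrite eq_sym neq_lift.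
have := wedge_eperm (tperm j ord_max) (snoc (snoc S m') m).
rewrite odd_tperm jm expr1 scaleN1r => <-.
apply: eq_wedge => k a b _; case: tpermP => [->|->|/eqP kj /eqP km].
- by rewrite snoc_lift !snoc_max.
- by rewrite snoc_lift !snoc_max.
case: (unliftP ord_max k) kj km => [k' ->|->]; last by rewrite eqxx.
rewrite (inj_eq lift_inj) !snoc_lift => + _.
by case: (unliftP ord_max k') => [k'' ->|->]; rewrite ?eqxx // !snoc_lift.
Qed.

Lemma wedge_map_snoc v v' e (phi : eform v -> eform v') (S : 'I_e -> eform v) m :
  wedge (fun k => phi (snoc S m k)) = wedge (snoc (fun k => phi (S k)) (phi m)).
Proof. by apply: eq_wedge => k a b _; rewrite /snoc; case: unlift. Qed.

Lemma wedge_sym_snoc v e (S S' : 'I_e -> eform v) m m' :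
  (forall k a b, a != b -> S k a b + S k b a = S' k a b + S' k b a) ->
  (forall a b, a != b -> m a b + m b a = m' a b + m' b a) ->
  wedge (snoc S m) = wedge (snoc S' m').
Proof.
move=> eS em; apply: wedge_sym => // k a b ne.
by case: (unliftP ord_max k) => [j ->|->]; rewrite ?snoc_lift ?snoc_max ?eS ?em.
Qed.

Lemma wedge_vperm_snoc v e (s : 'S_v) (S : 'I_e -> eform v) m :
  wedge (snoc (fun k a b => S k (s a) (s b)) (fun a b => m (s a) (s b))) =
  wedge (snoc S m).
Proof. by rewrite -[RHS](wedge_vperm s) (wedge_map_snoc (fun S a b => S (s a) (s b))). Qed.

(* The factor [m] kills multiples of [m] in the other factors. *)
Lemma wedge_snoc_mod v e (S S' : 'I_e -> eform v) m (c : 'I_e -> K) :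
  (forall k a b, a != b ->
     S k a b + S k b a = S' k a b + S' k b a + c k * (m a b + m b a)) ->
  wedge (snoc S m) = wedge (snoc S' m).
Proof.
move=> eS.
transitivity (wedge (snoc (fun k a b => S' k a b + c k * m a b) m)).
  apply: wedge_sym_snoc => // k a b ne; rewrite eS //.
  by rewrite mulrDr addrACA.
have distr (F G : 'I_e -> K) : \prod_k (F k + G k) =
    \sum_(J in {set 'I_e}) \prod_k (if k \in J then F k else G k).
  exact: bigA_distr.
rewrite [LHS]wedge_snocE.
under eq_bigr => g _ do rewrite distr mulr_sumr scaler_suml.
rewrite exchange_big (bigD1 setT) //= [X in _ + X]big1 ?addr0 => [|J].
  rewrite wedge_snocE; apply: eq_bigr => g _; congr ((_ * _) *: _).
  by apply: eq_bigr => k _; rewrite inE.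
(* If the set [J] of factors taken from [S'] omits [k], the factor [k] is [c k * m], proportional to
   the last one. *)
rewrite -subTset => /subsetPn[k _ Jk].
pose U i : eform v := if i \in J then S' i else fun a b => c i * m a b.
transitivity (wedge (snoc U m)).
  rewrite wedge_snocE; apply: eq_bigr => g _; congr ((_ * _) *: _).
  by apply: eq_bigr => i _; rewrite /U; case: ifP.
have Uk : U k = fun a b => c k * m a b by rewrite /U (negPf Jk).
have [ck0|ck0] := eqVneq (c k) 0.
  apply: (@wedge_zero _ _ _ (lift ord_max k)) => a b _.
  by rewrite snoc_lift Uk ck0 mul0r.
apply: (scalerI ck0); rewrite scaler0.
transitivity (wedge (snoc U (fun a b => \sum_(i < 1) c k * m a b))).
  by rewrite (wedge_snoc_sum xpredT (fun=> c k) (fun=> m)) big_ord1.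
apply: (@wedge_alt _ charK _ _ _ (lift ord_max k) ord_max).
  by rewrite eq_sym neq_lift.
by move=> a b _; rewrite snoc_lift snoc_max Uk big_ord1.
Qed.

Lemma nabla_nabla v e (X : coinv K v e) : nabla_coinv (nabla_coinv X) = 0.
Proof.
apply: (@coinv_wedge_ind _ _ _ _ (@nabla_coinv K v e.+1 \o @nabla_coinv K v e) \0)
  => S /=.
by rewrite !nabla_wedge wedge_snoc2_alt.
Qed.

Lemma delv_delv v (x : 'I_v.+2) (y : 'I_v.+1) (S : eform v.+2) a b :
  let l c := lift x (lift y c) in let y' := lift x y in
  delv y (delv x S) a b =
  S (l a) (l b) - S y' (l b) - S (l a) y' + S x y' + S y' x.
Proof. by rewrite /delv /=; ring. Qed.

(** Deleting [x] and then [y] kills every edge from [x] to a third vertex and turns an edge from [x]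
    to [y] into the sum of all edges. Hence, of two edges at [x], either one is killed or both
    become the same factor. *)
Lemma D_D v e (g : lgraph v.+2 e) :
  min_valence 2 g -> D_coinv (D_coinv (gclass K g)) = 0.
Proof.
move=> /forallP min2; rewrite -wedge_gform [D_coinv (wedge _)]D_wedge linear_sum.
rewrite big1 // => x _; rewrite [LHS]D_wedge big1 // => y _.
have /card_gt1P[h1 [h2 [+ + ne12]]] := min2 x; rewrite !inE => /eqP h1x /eqP h2x.
have ne1 : h1.1 != h2.1.
  apply: contraNneq ne12 => e12; case: h1 h2 h1x h2x e12 => [k i] [k' i'] /= + + e12.
  rewrite e12; have := ends_neq g k'.
  by case: i; case: i' => // ne gx gx'; rewrite gx gx' eqxx in ne.
pose F (h : 'I_e * bool) (a b : 'I_v) := delv y (delv x (gform K g h.1)) a b.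
have FE (h : 'I_e * bool) (a b : 'I_v) : g h = x ->
    F h a b = (g (h.1, ~~ h.2) == lift x y)%:R.
  case: h => k i gx; rewrite /F delv_delv /= /gform /efm.
  have lx u : (x == lift x u) = false by rewrite (negPf (neq_lift _ _)).
  have lx' u : (lift x u == x) = false by rewrite eq_sym lx.
  rewrite [in RHS]eq_sym.
  by case: i gx => /= ->; rewrite ?lx' ?lx ?eqxx ?andbF ?andbT /= ?subr0 ?add0r ?addr0.
have FE1 a b := FE h1 a b h1x; have FE2 a b := FE h2 a b h2x.
case: (boolP (g (h1.1, ~~ h1.2) == lift x y)) => n1; last first.
  by apply: (@wedge_zero _ _ _ h1.1) => a b _; rewrite -/(F h1 a b) FE1 (negPf n1).
case: (boolP (g (h2.1, ~~ h2.2) == lift x y)) => n2; last first.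
  by apply: (@wedge_zero _ _ _ h2.1) => a b _; rewrite -/(F h2 a b) FE2 (negPf n2).
apply: (@wedge_alt _ charK _ _ _ h1.1 h2.1) => // a b _.
by rewrite -/(F h1 a b) -/(F h2 a b) FE1 FE2 n1 n2.
Qed.

End Identities.

(** * The commutator of [D] and [delta] *)

Section VertexDeletionSplitting.
Variable K : fieldType.
Hypothesis charK : [pchar K] =i pred0.
Local Notation eform := (eform K).

Lemma lift_lift_max v (q : 'I_v.+1) (a : 'I_v) :
  lift (lift ord_max q) (lift ord_max a) = lift ord_max (lift q a).
Proof.
by apply: ord_inj; rewrite -[LHS]/(bump _ _) !lift_max.
Qed.

Lemma lift_max_max v (q : 'I_v.+1) :
  lift (lift ord_max q) ord_max = ord_max :> 'I_v.+2.
Proof.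
apply: ord_inj; rewrite -[LHS]/(bump _ _) lift_max /bump /=.
by rewrite -ltnS ltn_ord.
Qed.

Lemma neq_liftl n (x : 'I_n.+1) u : (lift x u == x) = false.
Proof. by rewrite eq_sym (negPf (neq_lift _ _)). Qed.

Lemma neq_liftr n (x : 'I_n.+1) u : (x == lift x u) = false.
Proof. by rewrite (negPf (neq_lift _ _)). Qed.

Lemma eq_lift n (x : 'I_n.+1) u w : (lift x u == lift x w) = (u == w).
Proof. by rewrite (inj_eq lift_inj). Qed.

Lemma inc_lift v (S : eform v) a b :
  inc S (lift ord_max a) (lift ord_max b) = S a b.
Proof. by rewrite /inc !liftK. Qed.

Lemma inc_maxl v (S : eform v) b : inc S ord_max b = 0.
Proof. by rewrite /inc unlift_none. Qed.

Lemma inc_maxr v (S : eform v) a : inc S a ord_max = 0.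
Proof. by rewrite /inc unlift_none; case: unlift. Qed.

Lemma sub_lift v p (S : eform v) a b :
  sub p S (lift ord_max a) (lift ord_max b) = if a == b then 0 else S a b.
Proof. by rewrite /sub !coll_lift. Qed.

Lemma sub_maxl v p (S : eform v) b :
  sub p S ord_max (lift ord_max b) = if p == b then 0 else S p b.
Proof. by rewrite /sub coll_lift coll_max. Qed.

Lemma sub_maxr v p (S : eform v) a :
  sub p S (lift ord_max a) ord_max = if a == p then 0 else S a p.
Proof. by rewrite /sub coll_lift coll_max. Qed.

Lemma sub_max v p (S : eform v) : sub p S ord_max ord_max = 0.
Proof. by rewrite /sub eqxx. Qed.

Definition vertexE := (@lift_lift_max, @lift_max_max, @neq_liftl, @neq_liftr,
  @eq_lift, @eqxx, inc_lift, inc_maxl, inc_maxr, sub_lift, sub_maxl, sub_maxr,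
  sub_max, @lift_perm_id, @lift_perm_lift, @perm1, @andbT, @andbF).

Section DeltaTerms.
Variables (v e : nat) (S : 'I_e -> eform v.+1).

Let split_term (p : 'I_v.+1) (x : 'I_v.+2) := wedge (snoc
  (fun k => delv x (sub p (S k))) (delv x (efm K (lift ord_max p) ord_max))).
Let antenna_term (p : 'I_v.+1) :=
  wedge (snoc (fun k => inc (delv p (S k))) antef).

(** An edge at [p] is attached to both halves; when one half is deleted, the reconnection to the
    other half cancels the edge already there. What remains is the deletion of [p], with a new
    vertex that carries only minus the sum of all antennas. *)
Lemma split_term_old (p : 'I_v.+1) : split_term p (lift ord_max p) = - antenna_term p.
Proof.
rewrite -wedge_snocN; apply: eq_wedge_snoc => [k a b|a b].
  case: (unliftP ord_max a) => [a' ->|->]; case: (unliftP ord_max b) => [b' ->|->];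
  rewrite /delv !vertexE //=.
  - by move/negPf->; ring.
  - by move=> _; ring.
  - by move=> _; ring.
rewrite /delv /efm /antef.
case: (unliftP ord_max a) => [a' ->|->]; case: (unliftP ord_max b) => [b' ->|->];
  rewrite !vertexE //= => ?; ring.
Qed.

Lemma split_term_new (p : 'I_v.+1) : split_term p ord_max = - antenna_term p.
Proof.
rewrite -wedge_snocN.
rewrite /split_term -(wedge_vperm_snoc (lift_perm ord_max p 1)).
apply: wedge_sym_snoc => // [k a b|a b].
  case: (unliftP ord_max a) => [a' ->|->]; case: (unliftP ord_max b) => [b' ->|->];
  rewrite /delv !vertexE //=.
  - by move=> ne; rewrite [b' == a']eq_sym (negPf ne); ring.
  - by move=> _; ring.
  - by move=> _; ring.
rewrite /delv /efm /antef.
case: (unliftP ord_max a) => [a' ->|->]; case: (unliftP ord_max b) => [b' ->|->];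
  rewrite !vertexE //= => ?; ring.
Qed.

(** The two orders of splitting [p] and deleting [q] differ by multiples of the new edge, which is
    already a factor: an edge from [q] to [p], once attached to a half, is reconnected to the other
    half. There are two such halves, whence the 2 in [c]. *)
Lemma split_term_other (q : 'I_v.+1) (p : 'I_v) :
  split_term (lift q p) (lift ord_max q) =
  wedge (snoc (fun k => sub p (delv q (S k))) (efm K (lift ord_max p) ord_max)).
Proof.
pose c k := - (S k (lift q p) q + S k q (lift q p)) *+ 2.
transitivity (wedge (snoc (fun k => delv (lift ord_max q) (sub (lift q p) (S k)))
                          (efm K (lift ord_max p) ord_max))).
  apply: eq_wedge_snoc => // a b ne; rewrite /delv /efm.
  case: (unliftP ord_max a) ne => [a' ->|->]; case: (unliftP ord_max b) => [b' ->|->];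
    rewrite !vertexE //= => ?; ring.
apply: (wedge_snoc_mod charK (c := c)) => k a b; rewrite /c /delv /efm.
case: (unliftP ord_max a) => [a' ->|->]; case: (unliftP ord_max b) => [b' ->|->];
    rewrite !vertexE //= => ne.
- move/negPf: ne => ne; by rewrite [b' == a']eq_sym ne; ring.
- by rewrite ![p == a']eq_sym; case: (eqVneq a' p) => [->|_]; rewrite ?eqxx /=; ring.
- by rewrite ![p == b']eq_sym; case: (eqVneq b' p) => [->|_]; rewrite ?eqxx /=; ring.
Qed.

(** [nabla] arises from deleting the new end of an antenna, which reconnects the new edge
    everywhere; deleting an old vertex kills the sum of all antennas. In the split terms, deleting
    either half gives [- antenna_term], and the coefficient 1/2 matches these two copies with the
    antennas of [delta D]. *)
Lemma D_delta_wedge :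
  D_coinv (delta_coinv (wedge S)) - delta_coinv (D_coinv (wedge S)) =
  nabla_coinv (wedge S).
Proof.
have Dsplit p : D_coinv (wedge (snoc (fun k => sub p (S k))
    (efm K (lift ord_max p) ord_max))) = \sum_x split_term p x.
  by rewrite D_wedge; apply: eq_bigr => x _; rewrite wedge_map_snoc.
have DT : D_coinv (wedge (snoc (fun k => inc (S k)) antef)) =
    - nabla_coinv (wedge S).
  rewrite D_wedge big_lift_max big1 /= ?add0r => [|q _].
    rewrite wedge_map_snoc nabla_wedge -wedge_snocN.
    apply: eq_wedge_snoc => [k a b|a b] ne; rewrite /delv ?vertexE ?subr0 //.
    by rewrite /antef !vertexE /= /onef; ring.
  rewrite wedge_map_snoc wedge_snoc0 // => a b ne.
  rewrite /delv /antef !vertexE; case: (unliftP ord_max b) => [b' ->|->];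
    rewrite !vertexE //=; ring.
rewrite [delta_coinv (wedge S)]delta_wedge linearB linearZ_LR linear_sum.
rewrite [X in _ - X - _]DT opprK.
rewrite D_wedge [X in _ - X]linear_sum.
rewrite [X in _ - X](eq_bigr _ (fun q _ => delta_wedge (fun k => delv q (S k)))).
rewrite sumrB -scaler_sumr.
have -> : \sum_p D_coinv (wedge (snoc (fun k => sub p (S k))
    (efm K (lift ord_max p) ord_max))) =
  \sum_q \sum_p wedge (snoc (fun k => sub p (delv q (S k)))
     (efm K (lift ord_max p) ord_max)) - 2%:R *: \sum_q antenna_term q.
  under eq_bigr => p _ do rewrite Dsplit big_lift_max split_term_new /=.
  rewrite big_split exchange_big sumrN /=.
  under eq_bigr => q _ do rewrite (bigD1_ord q) //= split_term_old.
  rewrite big_split sumrN /=.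
  under [X in _ + X - _]eq_bigr => q _ do under eq_bigr => p _ do
    rewrite split_term_other.
  by rewrite scaler_nat mulr2n opprD addrA; congr (_ - _); rewrite addrC.
set U := \sum_q _; set A := \sum_q _.
rewrite [X in X + _ - _](_ : _ = 2%:R^-1 *: U - A).
  by rewrite addrAC subrr add0r.
by rewrite [LHS]scalerBr scalerA mulVf ?natK_neq0 // scale1r.
Qed.

End DeltaTerms.

Lemma D_delta v e (X : coinv K v.+1 e) :
  D_coinv (delta_coinv X) - delta_coinv (D_coinv X) = nabla_coinv X.
Proof.
pose f : {linear coinv K v.+1 e -> coinv K v.+1 e.+1} :=
  (@D_coinv K v.+1 e.+1 \o @delta_coinv K v.+1 e) \-
  (@delta_coinv K v e \o @D_coinv K v e).
rewrite -[LHS]/(f X); apply: coinv_wedge_ind => S.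
exact: D_delta_wedge.
Qed.

End VertexDeletionSplitting.

(** * The square of [delta] *)

Section SplittingSquare.
Variable K : fieldType.
Hypothesis charK : [pchar K] =i pred0.
Local Notation eform := (eform K).

Lemma wedge_map_snoc2 v v' e (phi : eform v -> eform v') (S : 'I_e -> eform v) m m' :
  wedge (snoc (fun k => phi (snoc S m k)) m') =
  wedge (snoc (snoc (fun k => phi (S k)) (phi m)) m').
Proof.
by apply: eq_wedge_snoc => // k a b _; rewrite /snoc; case: unlift.
Qed.

Lemma wedge_sym_snoc2 v e (S S' : 'I_e -> eform v) m m' n n' :
  (forall k a b, a != b -> S k a b + S k b a = S' k a b + S' k b a) ->
  (forall a b, a != b -> m a b + m b a = m' a b + m' b a) ->
  (forall a b, a != b -> n a b + n b a = n' a b + n' b a) ->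
  wedge (snoc (snoc S m) n) = wedge (snoc (snoc S' m') n').
Proof.
move=> eS em en; apply: wedge_sym_snoc => // k a b ne.
by case: (unliftP ord_max k) => [j ->|->]; rewrite ?snoc_lift ?snoc_max ?eS ?em.
Qed.

Lemma eq_wedge_snoc2 v e (S S' : 'I_e -> eform v) m m' n n' :
  (forall k a b, a != b -> S k a b = S' k a b) ->
  (forall a b, a != b -> m a b = m' a b) ->
  (forall a b, a != b -> n a b = n' a b) ->
  wedge (snoc (snoc S m) n) = wedge (snoc (snoc S' m') n').
Proof.
move=> eS em en.
by apply: wedge_sym_snoc2 => // *; congr (_ + _); auto; [apply: eS|apply: em|apply: en];
 rewrite eq_sym.
Qed.

Lemma wedge_vperm_snoc2 v e (s : 'S_v) (S : 'I_e -> eform v) m n :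
  wedge (snoc (snoc (fun k a b => S k (s a) (s b)) (fun a b => m (s a) (s b)))
    (fun a b => n (s a) (s b))) = wedge (snoc (snoc S m) n).
Proof.
by rewrite -[RHS](wedge_vperm_snoc s) (wedge_map_snoc2 (fun S a b => S (s a) (s b))).
Qed.

Lemma wedge_snoc2D v e (S : 'I_e -> eform v) m m' n :
  wedge (snoc (snoc S (fun a b => m a b + m' a b)) n) =
  wedge (snoc (snoc S m) n) + wedge (snoc (snoc S m') n).
Proof.
by rewrite ![wedge (snoc _ n)]wedge_snoc_swap wedge_snocD opprD.
Qed.

Lemma wedge_antisym v e (s : 'S_v) (S S' : 'I_e -> eform v) m m' n n' :
  (forall k a b, a != b -> S k (s a) (s b) = S' k a b) ->
  (forall a b, a != b -> m (s a) (s b) + m (s b) (s a) = n' a b + n' b a) ->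
  (forall a b, a != b -> n (s a) (s b) + n (s b) (s a) = m' a b + m' b a) ->
  wedge (snoc (snoc S m) n) = - wedge (snoc (snoc S' m') n').
Proof.
move=> eS em en; rewrite -wedge_snoc_swap -(wedge_vperm_snoc2 s).
apply: wedge_sym_snoc2 => // k a b ne; rewrite !eS // eq_sym //.
Qed.

Lemma eqNself (V : lmodType K) (x : V) : x = - x -> x = 0.
Proof.
move/eqP; rewrite -subr_eq0 opprK -mulr2n -scaler_nat scaler_eq0.
by rewrite (negPf (natK_neq0 charK _)) //= => /eqP.
Qed.

Lemma wedge_path v v' e (c : 'I_v -> 'I_v') (S : 'I_e -> eform v') x y w m n :
  x != y -> y != w -> x != w -> c x = c w ->
  (forall a b, m a b + m b a = efm K x y a b + efm K x y b a) ->
  (forall a b, n a b + n b a = efm K y w a b + efm K y w b a) ->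
  wedge (snoc (snoc (fun k a b => if c a == c b then 0 else S k (c a) (c b)) m) n)
  = 0.
Proof.
move=> xy yw xw cxw em en; apply: eqNself.
have cs a : c (tperm x w a) = c a by case: tpermP => [->|->|//].
have sE a u : (tperm x w a == u) = (a == tperm x w u).
  by rewrite -[in RHS](inj_eq (@perm_inj _ (tperm x w))) tpermK.
have ty : tperm x w y = y by rewrite tpermD // eq_sym.
apply: (wedge_antisym (s := tperm x w)) => [k a b _|a b _|a b _].
- by rewrite !cs.
- by rewrite em en /efm !sE tpermL ty addrC ![_ && (_ == y)]andbC.
- by rewrite em en /efm !sE tpermR ty addrC ![_ && (_ == y)]andbC.
Qed.

Lemma sub_sub v (p : 'I_v) q (S : eform v) a b :
  sub q (sub p S) a b = if coll p (coll q a) == coll p (coll q b) then 0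
                        else S (coll p (coll q a)) (coll p (coll q b)).
Proof. by rewrite /sub; case: (eqVneq (coll q a) (coll q b)) => [->|//]; rewrite eqxx. Qed.

Section Terms.
Variables (v e : nat) (S : 'I_e -> eform v).
Local Notation old := (lift ord_max).
Local Notation z1 := (old (ord_max : 'I_v.+1)).
Local Notation z2 := (ord_max : 'I_v.+2).
Local Notation E := (efm K).

Let tau : 'S_v.+2 := tperm z1 z2.

Let tau_old (a : 'I_v) : tau (old (old a)) = old (old a).
Proof. by rewrite tpermD // eq_sym ?(inj_eq lift_inj) ?neq_liftl // eq_lift neq_liftl. Qed.

Let tau1 : tau z1 = z2. Proof. exact: tpermL. Qed.
Let tau2 : tau z2 = z1. Proof. exact: tpermR. Qed.

Let vertex2 (a : 'I_v.+2) : [\/ exists b, a = old (old b), a = z1 | a = z2].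
Proof.
case: (unliftP ord_max a) => [b ->|->]; last by constructor 3.
case: (unliftP ord_max b) => [c ->|->]; last by constructor 2.
by constructor 1; exists c.
Qed.

Let vE := (tau_old, tau1, tau2, @coll_lift, @coll_max, @neq_liftl, @neq_liftr,
  @eq_lift, @eqxx, @if_same, inc_lift, inc_maxl, inc_maxr, @andbT, @andbF).

Let split_split (p : 'I_v) (q : 'I_v.+1) :=
  wedge (snoc (snoc (fun k => sub q (sub p (S k))) (sub q (E (old p) ord_max)))
    (E (old q) ord_max)).

(** Splittings at different vertices commute up to exchanging the two new vertices, which costs
    nothing, and the two new edges, which costs a sign. *)
Let split_split_neq p q : p != q -> split_split p (old q) = - split_split q (old p).
Proof.
move=> pq; apply: (wedge_antisym (s := tau)) => [k a b ne|a b|a b].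
- rewrite !sub_sub.
  have c_tau a' : coll p (coll (old q) (tau a')) = coll q (coll (old p) a').
    by case: (vertex2 a') => [[c ->]|->|->]; rewrite !vE.
  by rewrite !c_tau.
- case: (vertex2 a) => [[{}a ->]|->|->]; case: (vertex2 b) => [[{}b ->]|->|->];
  rewrite /sub /efm !vE //= ?[q == p]eq_sym ?(negPf pq) ?if_same ?addr0 ?add0r //=.
- case: (vertex2 a) => [[{}a ->]|->|->]; case: (vertex2 b) => [[{}b ->]|->|->];
  rewrite /sub /efm !vE //= ?[q == p]eq_sym ?(negPf pq) ?if_same ?addr0 ?add0r //=.
Qed.

(** The second splitting also redistributes the first new edge. Each of the two outcomes is a path
    of two new edges on the three vertices lying over [p]. *)
Let split_split_eq p : split_split p (old p) = 0.
Proof.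
pose c a := coll p (coll (old p) a).
transitivity (wedge (snoc (snoc (fun k a b => if c a == c b then 0 else S k (c a) (c b))
  (fun a b => E (old (old p)) z1 a b + E z2 z1 a b)) (E (old (old p)) z2))).
  apply: eq_wedge_snoc2 => // [k a b _|a b]; first by rewrite sub_sub.
  case: (vertex2 a) => [[{}a ->]|->|->]; case: (vertex2 b) => [[{}b ->]|->|->];
  rewrite /sub /efm !vE //= ?addr0 ?add0r //=.
rewrite wedge_snoc2D (@wedge_path _ _ _ _ _ z1 (old (old p)) z2) ?vE //; last first.
- by move=> a b; rewrite /efm addrC ![_ && (_ == z1)]andbC.
- by rewrite /c !vE.
rewrite (@wedge_path _ _ _ _ _ z1 z2 (old (old p))) ?vE // ?addr0 //.
- by rewrite /c !vE.
- by move=> a b; rewrite /efm addrC ![_ && (_ == z1)]andbC.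
- by move=> a b; rewrite /efm addrC ![_ && (_ == z2)]andbC.
Qed.

Let split_split_new p : split_split p ord_max = 0.
Proof.
pose c a := coll p (coll (ord_max : 'I_v.+1) a).
transitivity (wedge (snoc (snoc (fun k a b => if c a == c b then 0 else S k (c a) (c b))
  (fun a b => E (old (old p)) z1 a b + E (old (old p)) z2 a b)) (E z1 z2))).
  apply: eq_wedge_snoc2 => // [k a b _|a b]; first by rewrite sub_sub.
  case: (vertex2 a) => [[{}a ->]|->|->]; case: (vertex2 b) => [[{}b ->]|->|->];
  rewrite /sub /efm !vE //= ?addr0 ?add0r //=.
rewrite wedge_snoc2D (@wedge_path _ _ _ _ _ (old (old p)) z1 z2) ?vE //; last first.
  by rewrite /c !vE.
rewrite (@wedge_path _ _ _ _ _ (old (old p)) z2 z1) ?vE // ?addr0 //.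
- by rewrite /c !vE.
- by move=> a b; rewrite /efm addrC ![_ && (_ == z2)]andbC.
Qed.

Lemma split_split_sum : \sum_p \sum_q split_split p q = 0.
Proof.
rewrite [LHS](_ : _ = \sum_p \sum_q split_split p (old q)); last first.
  by apply: eq_bigr => p _; rewrite big_lift_max split_split_new /= addr0.
apply: eqNself; rewrite {1}exchange_big -sumrN; apply: eq_bigr => p _.
rewrite -sumrN; apply: eq_bigr => q _.
have [->|ne] := eqVneq q p; first by rewrite split_split_eq oppr0.
exact: split_split_neq.
Qed.

Let split_antenna (q : 'I_v.+1) := wedge (snoc (snoc (fun k => sub q (inc (S k)))
  (sub q antef)) (E (old q) ord_max)).
Let antenna_split (p : 'I_v) := wedge (snoc (snoc (fun k => inc (sub p (S k)))
  (inc (E (old p) ord_max))) antef).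
Let antenna_antenna :=
  wedge (snoc (snoc (fun k => inc (inc (S k))) (inc antef)) antef).

Let split_antenna_old p : split_antenna (old p) = - antenna_split p.
Proof.
apply: (wedge_antisym (s := tau)) => [k a b|a b|a b];
  case: (vertex2 a) => [[{}a ->]|->|->]; case: (vertex2 b) => [[{}b ->]|->|->];
  rewrite /sub /inc /antef /efm ?tau_old ?tau1 ?tau2 ?coll_lift ?coll_max ?liftK
    ?unlift_none //= ?vE ?coll_lift ?coll_max //= ?if_same //.
Qed.

(** In a double antenna, the terms where both new vertices hang from old ones cancel when the new
    vertices are exchanged; in the others, the second new vertex hangs from the first. Splitting the
    end of an antenna gives these twice, since the old edge may stay at either half. *)
Let split_antenna_max : split_antenna ord_max = 2%:R *: antenna_antenna.
Proof.
pose I k := inc (inc (S k)); pose T1 := inc (@antef K v).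
pose T2 : eform v.+2 := fun a b => ((a != z1) && (b == z2))%:R.
have T12 : wedge (snoc (snoc I T1) T2) = 0.
  apply: eqNself; apply: (wedge_antisym (s := tau)) => [k a b|a b|a b];
  case: (vertex2 a) => [[{}a ->]|->|->]; case: (vertex2 b) => [[{}b ->]|->|->];
  rewrite /I /T1 /T2 /inc /antef ?tau_old ?tau1 ?tau2 ?liftK ?unlift_none //= ?vE //=.
have T2E : wedge (snoc (snoc I T2) (E z1 z2)) = wedge (snoc (snoc I T1) (E z1 z2)).
  rewrite -(wedge_vperm_snoc2 tau); apply: wedge_sym_snoc2 => [k a b|a b|a b];
  case: (vertex2 a) => [[{}a ->]|->|->]; case: (vertex2 b) => [[{}b ->]|->|->];
  rewrite /I /T1 /T2 /inc /antef /efm ?tau_old ?tau1 ?tau2 ?liftK ?unlift_none //=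
    ?vE //= ?addr0 ?add0r //.
rewrite scaler_nat mulr2n.
have -> : antenna_antenna = wedge (snoc (snoc I T1) (E z1 z2)).
  transitivity (wedge (snoc (snoc I T1) (fun a b => T2 a b + E z1 z2 a b))).
    apply: eq_wedge_snoc2 => // a b; 
    case: (vertex2 a) => [[{}a ->]|->|->]; case: (vertex2 b) => [[{}b ->]|->|->];
    rewrite /T2 /antef /efm ?vE //= ?addr0 ?add0r //.
  by rewrite wedge_snocD T12 add0r.
rewrite -{2}T2E -wedge_snoc2D; apply: eq_wedge_snoc2 => // [k a b|a b];
case: (vertex2 a) => [[{}a ->]|->|->]; case: (vertex2 b) => [[{}b ->]|->|->];
rewrite /sub /I /T1 /T2 /inc /antef ?coll_lift ?coll_max ?liftK ?unlift_none //=
  ?vE //= ?if_same ?addr0 ?add0r //.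
by case: eqP => // ->.
Qed.

Lemma delta_delta_wedge : delta_coinv (delta_coinv (wedge S)) = 0.
Proof.
have d_split p : delta_coinv (wedge (snoc (fun k => sub p (S k)) (E (old p) ord_max)))
    = 2%:R^-1 *: (\sum_q split_split p q) - antenna_split p.
  rewrite delta_wedge; congr (_ *: _ - _); last by rewrite wedge_map_snoc2.
  by apply: eq_bigr => q _; rewrite wedge_map_snoc2.
have d_antenna : delta_coinv (wedge (snoc (fun k => inc (S k)) antef))
    = 2%:R^-1 *: (\sum_q split_antenna q) - antenna_antenna.
  rewrite delta_wedge; congr (_ *: _ - _); last by rewrite wedge_map_snoc2.
  by apply: eq_bigr => q _; rewrite wedge_map_snoc2.
rewrite [delta_coinv (wedge S)]delta_wedge linearB linearZ_LR linear_sum.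
rewrite [X in _ - X]d_antenna (eq_bigr _ (fun p _ => d_split p)).
rewrite sumrB -scaler_sumr split_split_sum scaler0 sub0r.
rewrite big_lift_max split_antenna_max /= (eq_bigr _ (fun p _ => split_antenna_old p)).
rewrite scalerDr scalerA mulVf ?natK_neq0 // scale1r addrK sumrN.
by rewrite [LHS]addrC addNr.
Qed.

End Terms.

Lemma delta_delta v e (X : coinv K v e) : delta_coinv (delta_coinv X) = 0.
Proof.
apply: (@coinv_wedge_ind _ _ _ _ (@delta_coinv K v.+1 e.+1 \o @delta_coinv K v e) \0)
  => S.
exact: delta_delta_wedge.
Qed.

End SplittingSquare.

(** * Removal of isolated vertices, edges and leaves *)

Section NaturalOperators.
Variable K : fieldType.
Hypothesis charK : [pchar K] =i pred0.
Local Notation eform := (eform K).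

Definition same_sym v (S S' : eform v) : Prop :=
  forall a b, a != b -> S a b + S b a = S' a b + S' b a.

Record natural v e (W : lmodType K) (F : ('I_e -> eform v) -> W) : Prop := Natural {
  natural_multilin : multilin F;
  natural_sym : forall S S', (forall k, same_sym (S k) (S' k)) -> F S = F S';
  natural_eperm : forall (t : 'S_e) S,
    F (fun k => S (t k)) = (-1) ^+ odd_perm t *: F S;
  natural_vperm : forall (s : 'S_v) S, F (fun k a b => S k (s a) (s b)) = F S
}.

(* The value 0 on a map that is not natural makes linearity unconditional. *)
Definition graph_op v e (W : lmodType K) (F : ('I_e -> eform v) -> W)
    (X : coinv K v e) : W :=
  if `[< natural F >] then coinv_map (fun g => F (gform K g)) X else 0.

Section GraphOperator.
Variables (v e : nat) (W : lmodType K) (F : ('I_e -> eform v) -> W).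

Lemma graph_op_relabel s t f g : natural F ->
  F (gform K (relabel s t f g)) = (-1) ^+ odd_perm t *: F (gform K g).
Proof.
move=> natF; rewrite -(natural_eperm natF) -(natural_vperm natF s).
apply: (natural_sym natF) => k a b ne; rewrite /gform !relabelE /relabel_half /efm.
have sE c u : (c == s u) = (s^-1%g c == u).
  by rewrite -[in RHS](inj_eq (@perm_inj _ s)) permKV.
by rewrite !sE !permK /=; case: (f k) => //=; rewrite addrC ![(_ == g (t k, true)) && _]andbC.
Qed.

Fact graph_op_linear : linear (graph_op F).
Proof.
rewrite /graph_op; case: asboolP => [natF|_] a x y; last by rewrite scaler0 addr0.
by apply: coinv_map_linear => *; apply: graph_op_relabel.
Qed.

HB.instance Definition _ := GRing.isLinear.Build K _ _ _ (graph_op F) graph_op_linear.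

Lemma graph_op_wedge S : natural F -> graph_op F (wedge S) = F S.
Proof.
move=> natF; apply: multilin_op (natural_multilin natF) _ _ => g.
transitivity (coinv_map (fun g => F (gform K g)) (gclass K g)).
  by rewrite /= /graph_op asboolT.
by apply: coinv_map_class => *; apply: graph_op_relabel.
Qed.

End GraphOperator.

Lemma perm_lift v (s : 'S_v.+1) x : exists r : 'S_v, forall a, s (lift x a) = lift (s x) (r a).
Proof.
have lift_ex a : {c | s (lift x a) = lift (s x) c}.
  have : s x != s (lift x a) by rewrite (inj_eq perm_inj) neq_lift.
  by case/unlift_some=> c -> _; exists c.
pose r a := sval (lift_ex a).
have rE a : s (lift x a) = lift (s x) (r a) by exact: svalP (lift_ex a).
have r_inj : injective r.
  by move=> a b /(congr1 (lift (s x))); rewrite -!rE => /perm_inj/lift_inj.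
by exists (perm r_inj) => a; rewrite permE.
Qed.

Lemma same_sym_res v (x : 'I_v.+1) (S S' : eform v.+1) :
  same_sym S S' -> same_sym (res x S) (res x S').
Proof. by move=> eS a b ne; apply: eS; rewrite eq_lift. Qed.

Lemma natural_res v e :
  natural (fun S : 'I_e -> eform v.+1 => \sum_x wedge (fun k => res x (S k))).
Proof.
split=> [|S S' eS|t S|s S].
- by apply: multilin_sum => x _; apply/multilin_wedge/pullback_res.
- by apply: eq_bigr => x _; apply: wedge_sym => // k; apply: same_sym_res.
- rewrite scaler_sumr; apply: eq_bigr => x _.
  exact: (wedge_eperm t (fun k => res x (S k))).
rewrite [RHS](reindex_inj (@perm_inj _ s)); apply: eq_bigr => x _.
have [r rE] := perm_lift s x; rewrite -[RHS](wedge_vperm r).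
by apply: eq_wedge => k a b _; rewrite /res !rE.
Qed.

Lemma natural_inc v e :
  natural (fun S : 'I_e -> eform v => wedge (fun k => inc (S k))).
Proof.
split=> [|S S' eS|t S|s S].
- exact/multilin_wedge/pullback_inc.
- apply: wedge_sym => // k a b; rewrite /inc.
  case: (unliftP ord_max a) => [a' ->|->]; case: (unliftP ord_max b) => [b' ->|->] //.
  by rewrite eq_lift; apply: eS.
- exact: (wedge_eperm t (fun k => inc (S k))).
rewrite -[RHS](wedge_vperm (lift_perm ord_max ord_max s)).
apply: eq_wedge => k a b _; rewrite /inc.
case: (unliftP ord_max a) => [a' ->|->]; case: (unliftP ord_max b) => [b' ->|->];
  by rewrite ?lift_perm_lift ?lift_perm_id ?liftK ?unlift_none.
Qed.

(* The contraction with the linear form [alpha], composed with the substitution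
   [phi]; the sign moves the removed edge to the last place. *)
Definition cut v v' e (alpha : eform v -> K) (phi : eform v -> eform v')
    (S : 'I_e.+1 -> eform v) : coinv K v' e :=
  \sum_(k < e.+1) ((-1) ^+ (e + k) * alpha (S k)) *: wedge (fun j => phi (S (lift k j))).

Lemma multilin_cut v v' e (alpha : eform v -> K) (phi : eform v -> eform v') :
  offlin alpha -> pullback phi -> multilin (@cut v v' e alpha phi).
Proof.
move=> oa pphi; apply: multilin_sum => k _.
pose L (g : lgraph v' e) (i : 'I_e.+1) (S : eform v) :=
  if unlift k i is Some j then phi S (g (j, false)) (g (j, true)) else alpha S.
have E (S : 'I_e.+1 -> eform v) :
    ((-1) ^+ (e + k) * alpha (S k)) *: wedge (fun j => phi (S (lift k j))) =
    \sum_g ((-1) ^+ (e + k) * \prod_i L g i (S i)) *: gclass K g.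
  rewrite scaler_sumr; apply: eq_bigr => g _; rewrite scalerA -mulrA.
  congr ((_ * _) *: _); rewrite [RHS](bigD1_ord k) //= /L unlift_none.
  by congr (_ * _); apply: eq_bigr => j _; rewrite liftK.
move=> S; rewrite E; have := @multilin_prod K v e.+1 v' e
  (fun=> (-1) ^+ (e + k)) L _ S.
move=> <-; first by apply: eq_bigr => g _; rewrite -E.
by move=> g i; rewrite /L; case: unlift => [j|//]; apply: pphi; rewrite ends_neq.
Qed.

Lemma cut_eperm v v' e (alpha : eform v -> K) (phi : eform v -> eform v')
    (t : 'S_e.+1) S :
  cut alpha phi (fun k => S (t k)) = (-1) ^+ odd_perm t *: @cut v v' e alpha phi S.
Proof.
rewrite /cut scaler_sumr [RHS](reindex_inj (@perm_inj _ t)).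
apply: eq_bigr => k _; have [r rE] := perm_lift t k.
have -> : wedge (fun j => phi (S (t (lift k j)))) =
    (-1) ^+ odd_perm r *: wedge (fun j => phi (S (lift (t k) j))).
  rewrite -(wedge_eperm r (fun j => phi (S (lift (t k) j)))).
  by apply: eq_wedge => j a b _; rewrite rE.
have -> : t = lift_perm k (t k) r.
  apply/permP=> i; case: (unliftP k i) => [j ->|->].
    by rewrite lift_perm_lift rE.
  by rewrite lift_perm_id.
rewrite lift_perm_id odd_lift_perm !scalerA mulrAC mulrA; congr (_ * _ *: _).
rewrite -[(-1) ^+ (e + k)]signr_odd -[(-1) ^+ (e + t k)]signr_odd !oddD -!signr_addb.
congr (_ ^+ nat_of_bool _); move: (odd_perm r) => i.
by case: (odd e); case: (odd k); case: (odd (t k)); case: i.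
Qed.

(** The antiderivation rule of a contraction; the last factor contributes without sign because of
    the convention in [cut]. *)
Lemma cut_snoc v v' e (alpha : eform v -> K) (phi : eform v -> eform v')
    (S : 'I_e.+1 -> eform v) m :
  cut alpha phi (snoc S m) = alpha m *: wedge (fun k => phi (S k)) -
    \sum_(k < e.+1) ((-1) ^+ (e + k) * alpha (S k)) *:
      wedge (snoc (fun j => phi (S (lift k j))) (phi m)).
Proof.
rewrite /cut big_lift_max /= addrC; congr (_ + _).
  rewrite snoc_max -signr_odd oddD addbb mul1r; congr (_ *: _).
  by apply: eq_wedge => k a b _; rewrite snoc_lift.
rewrite -sumrN; apply: eq_bigr => k _; rewrite snoc_lift.
rewrite -[bump _ _]/(nat_of_ord (lift (@ord_max e.+1) k)) lift_max addSn exprS.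
rewrite mulN1r mulNr scaleNr; congr (- (_ *: _)).
apply: eq_wedge => j a b _.
case: (unliftP ord_max j) => [i ->|->].
  by rewrite lift_lift_max !snoc_lift.
by rewrite lift_max_max !snoc_max.
Qed.

(** On an edge this is 1 if the edge ends at [x], and 0 otherwise. Contraction with it removes one
    edge at [x]; combined with [res x], which kills all other edges at [x], it removes [x] if [x] is
    a leaf. *)
Definition degf v (x : 'I_v) (S : eform v) : K := \sum_(y | y != x) (S x y + S y x).

Lemma degf_offlin v (x : 'I_v) : offlin (degf x).
Proof.
apply: offlin_sum => y ne; apply: offlinD; apply: offlin_entry => //.
by rewrite eq_sym.
Qed.

Lemma degf_sym v (x : 'I_v) (S S' : eform v) : same_sym S S' -> degf x S = degf x S'.
Proof. by move=> eS; apply: eq_bigr => y ne; apply: eS; rewrite eq_sym. Qed.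

Lemma degf_perm v (s : 'S_v) (x : 'I_v) (S : eform v) :
  degf x (fun a b => S (s a) (s b)) = degf (s x) S.
Proof.
rewrite /degf [RHS](reindex_inj (@perm_inj _ s)).
by apply: eq_bigl => y; rewrite (inj_eq perm_inj).
Qed.

Lemma natural_cut v v' e (phi : 'I_v -> eform v -> eform v') :
  (forall x, pullback (phi x)) ->
  (forall x S S', same_sym S S' -> same_sym (phi x S) (phi x S')) ->
  (forall (s : 'S_v) x, exists r : 'S_v', forall S a b, a != b ->
     phi x (fun c d => S (s c) (s d)) a b = phi (s x) S (r a) (r b)) ->
  natural (fun S : 'I_e.+1 -> eform v => \sum_x cut (degf x) (phi x) S).
Proof.
move=> pphi sphi rphi; split=> [|S S' eS|t S|s S].
- by apply: multilin_sum => x _; apply: multilin_cut => //; apply: degf_offlin.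
- apply: eq_bigr => x _; apply: eq_bigr => k _; rewrite (degf_sym _ (eS k)).
  by congr (_ *: _); apply: wedge_sym => // j; apply/sphi/eS.
- by rewrite scaler_sumr; apply: eq_bigr => x _; rewrite cut_eperm.
rewrite [RHS](reindex_inj (@perm_inj _ s)); apply: eq_bigr => x _.
have [r rE] := rphi s x; apply: eq_bigr => k _; rewrite degf_perm; congr (_ *: _).
by rewrite -[RHS](wedge_vperm r); apply: eq_wedge => j a b ne; rewrite rE.
Qed.

Lemma natural_cut_id v e :
  natural (fun S : 'I_e.+1 -> eform v => \sum_x cut (degf x) id S).
Proof.
apply: (@natural_cut _ _ _ (fun _ => id)) => // [x|s x].
  exact: pullback_id.
by exists s.
Qed.

Lemma natural_cut_res v e :
  natural (fun S : 'I_e.+1 -> eform v.+1 => \sum_x cut (degf x) (res x) S).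
Proof.
apply: natural_cut => [x|x S S'|s x].
- exact: pullback_res.
- exact: same_sym_res.
by have [r rE] := perm_lift s x; exists r => S a b _; rewrite /res !rE.
Qed.

Definition rm_isolated v e : coinv K v.+1 e -> coinv K v e :=
  graph_op (fun S => \sum_x wedge (fun k => res x (S k))).
Definition add_isolated v e : coinv K v e -> coinv K v.+1 e :=
  graph_op (fun S => wedge (fun k => inc (S k))).
Definition rm_edge v e : coinv K v e.+1 -> coinv K v e :=
  graph_op (fun S => \sum_x cut (degf x) id S).
Definition rm_leaf v e : coinv K v.+1 e.+1 -> coinv K v e :=
  graph_op (fun S => \sum_x cut (degf x) (res x) S).

HB.instance Definition _ v e := GRing.isLinear.Build K _ _ _ (@rm_isolated v e)
  (graph_op_linear _).
HB.instance Definition _ v e := GRing.isLinear.Build K _ _ _ (@add_isolated v e)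
  (graph_op_linear _).
HB.instance Definition _ v e := GRing.isLinear.Build K _ _ _ (@rm_edge v e)
  (graph_op_linear _).
HB.instance Definition _ v e := GRing.isLinear.Build K _ _ _ (@rm_leaf v e)
  (graph_op_linear _).

End NaturalOperators.

(** * Homotopy identities *)

Section OperatorIdentities.
Variable K : fieldType.
Hypothesis charK : [pchar K] =i pred0.
Local Notation eform := (eform K).
Local Notation E := (efm K).

Lemma rm_isolated_wedge v e (S : 'I_e -> eform v.+1) :
  rm_isolated (wedge S) = \sum_x wedge (fun k => res x (S k)).
Proof. exact: (graph_op_wedge S (natural_res charK v e)). Qed.

Lemma add_isolated_wedge v e (S : 'I_e -> eform v) :
  add_isolated (wedge S) = wedge (fun k => inc (S k)).
Proof. exact: (graph_op_wedge S (natural_inc charK v e)). Qed.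

Lemma rm_edge_wedge v e (S : 'I_e.+1 -> eform v) :
  rm_edge (wedge S) = \sum_x cut (degf x) id S.
Proof. exact: (graph_op_wedge S (natural_cut_id charK v e)). Qed.

Lemma rm_leaf_wedge v e (S : 'I_e.+1 -> eform v.+1) :
  rm_leaf (wedge S) = \sum_x cut (degf x) (res x) S.
Proof. exact: (graph_op_wedge S (natural_cut_res charK v e)). Qed.

Lemma degfE v (x : 'I_v.+1) (S : eform v.+1) :
  degf x S = \sum_(y < v) (S x (lift x y) + S (lift x y) x).
Proof.
rewrite /degf big_mkcond (bigD1_ord x) //= eqxx add0r.
by apply: eq_bigr => y _; rewrite neq_liftl.
Qed.

Lemma degf_onef v (x : 'I_v) : degf x (onef : eform v) = (2 * v.-1)%:R.
Proof.
case: v x => [[]//|v] x; rewrite degfE /onef sumr_const card_ord -mulr2n.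
by rewrite -mulrnA.
Qed.

Lemma nabla_cut v v' e (alpha : eform v -> K) (phi : eform v -> eform v')
    (S : 'I_e.+1 -> eform v) :
  nabla_coinv (cut alpha phi S) = \sum_(k < e.+1) ((-1) ^+ (e + k) * alpha (S k)) *:
    wedge (snoc (fun j => phi (S (lift k j))) onef).
Proof.
rewrite linear_sum; apply: eq_bigr => k _.
by rewrite linearZ_LR; congr (_ *: _); apply: nabla_wedge.
Qed.

(** A contraction is an antiderivation and [nabla] multiplies by [onef], so their anticommutator is
    multiplication by the value of the contraction on [onef]: $2(v-1)$ for each vertex. It is
    invertible as soon as $v \ge 2$. *)
Lemma rm_edge_nabla v e (X : coinv K v e.+1) :
  rm_edge (nabla_coinv X) + nabla_coinv (rm_edge X) = (v * (2 * v.-1))%:R *: X.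
Proof.
apply: (@coinv_wedge_ind _ _ _ _ 
  ((@rm_edge K v e.+1 \o @nabla_coinv K v e.+1) \+
   (@nabla_coinv K v e \o @rm_edge K v e))
  (_ \*: idfun)) X => S /=.
rewrite nabla_wedge !rm_edge_wedge linear_sum -big_split /=.
under eq_bigr => x _ do rewrite cut_snoc degf_onef nabla_cut subrK.
by rewrite sumr_const card_ord -scaler_nat scalerA -natrM.
Qed.

Lemma rm_leaf_nabla v e (X : coinv K v.+1 e.+1) :
  rm_leaf (nabla_coinv X) + nabla_coinv (rm_leaf X) =
  (2 * v)%:R *: rm_isolated X.
Proof.
apply: (@coinv_wedge_ind _ _ _ _ 
  ((@rm_leaf K v e.+1 \o @nabla_coinv K v.+1 e.+1) \+
   (@nabla_coinv K v e \o @rm_leaf K v e))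
  (_ \*: @rm_isolated K v e.+1)) X => S /=.
rewrite nabla_wedge !rm_leaf_wedge linear_sum -big_split /=.
rewrite rm_isolated_wedge scaler_sumr; apply: eq_bigr => x _.
by rewrite cut_snoc degf_onef nabla_cut subrK.
Qed.

Lemma rm_isolated_nabla v e (X : coinv K v.+1 e) :
  rm_isolated (nabla_coinv X) = nabla_coinv (rm_isolated X).
Proof.
apply: (@coinv_wedge_ind _ _ _ _ 
  (@rm_isolated K v e.+1 \o @nabla_coinv K v.+1 e)
  (@nabla_coinv K v e \o @rm_isolated K v e)) X => S /=.
rewrite nabla_wedge !rm_isolated_wedge linear_sum; apply: eq_bigr => x _.
by rewrite wedge_map_snoc /= nabla_wedge.
Qed.

(** Creation and annihilation: the vertex removed is the one just added or an old one. *)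
Lemma rm_add_isolated v e (X : coinv K v.+1 e) :
  rm_isolated (add_isolated X) = X + add_isolated (rm_isolated X).
Proof.
apply: (@coinv_wedge_ind _ _ _ _ 
  (@rm_isolated K v.+1 e \o @add_isolated K v.+1 e)
  (idfun \+ (@add_isolated K v e \o @rm_isolated K v e))) X => S /=.
rewrite add_isolated_wedge !rm_isolated_wedge big_lift_max linear_sum /= addrC.
congr (_ + _).
  by apply: eq_wedge => k a b _; rewrite /res inc_lift.
apply: eq_bigr => q _; rewrite add_isolated_wedge; apply: eq_wedge => k a b _.
rewrite /res.
by case: (unliftP ord_max a) => [a' ->|->]; case: (unliftP ord_max b) => [b' ->|->];
  rewrite !vertexE.
Qed.

Definition leaf_term v e (S : 'I_e.+1 -> eform v.+1) (q : 'I_v.+1) (p : 'I_v) k :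
    coinv K v.+1 e.+1 :=
  wedge (snoc (fun j => sub p (res q (S (lift k j)))) (E (lift ord_max p) ord_max)).

(** A leaf [q] is removed and its neighbour [p] is split. On graphs without isolated vertices this
    is, up to sign, the anticommutator of [delta] with the removal of leaves. *)
Definition leaf_split v e (S : 'I_e.+1 -> eform v.+1) : coinv K v.+1 e.+1 :=
  2%:R^-1 *: \sum_q \sum_p \sum_(k < e.+1)
   ((-1) ^+ (e + k) * (S k q (lift q p) + S k (lift q p) q)) *: leaf_term S q p k.

Section LeafSplit.
Variables (v e : nat) (S : 'I_e.+1 -> eform v.+1).

Let split_cut p x := cut (degf x) (res x)
  (snoc (fun k => sub p (S k)) (E (lift ord_max p) ord_max)).

Let split_cut_new p : split_cut p ord_max = wedge S.
Proof.
rewrite /split_cut cut_snoc big1 => [|k _]; last first.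
  rewrite wedge_snoc0 ?scaler0 // => a b _.
  by rewrite /res /efm neq_liftl andbF.
rewrite subr0 degfE (bigD1 p) //= big1 => [|y /negPf ne]; last first.
  by rewrite /efm !vertexE ne /= addr0.
rewrite /efm !vertexE /= add0r addr0 scale1r.
by apply: eq_wedge => k a b /negPf ne; rewrite /res sub_lift ne.
Qed.

Let split_cut_old p : split_cut p (lift ord_max p) = wedge S.
Proof.
rewrite /split_cut cut_snoc big1 => [|k _]; last first.
  rewrite wedge_snoc0 ?scaler0 // => a b _.
  by rewrite /res /efm neq_liftl.
rewrite subr0 degfE big_lift_max /= big1 => [|y _]; last first.
  by rewrite /efm !vertexE /= addr0.
rewrite /efm !vertexE /= add0r addr0 scale1r.
rewrite -[RHS](wedge_vperm (lift_perm ord_max p 1)); apply: eq_wedge => k a b.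
case: (unliftP ord_max a) => [a' ->|->]; case: (unliftP ord_max b) => [b' ->|->];
  rewrite /res !vertexE //.
by move/negPf->.
Qed.

Let split_cut_other q p : split_cut (lift q p) (lift ord_max q) =
  - \sum_(k < e.+1) ((-1) ^+ (e + k) *
      (degf q (S k) + (S k q (lift q p) + S k (lift q p) q))) *: leaf_term S q p k.
Proof.
rewrite /split_cut cut_snoc degfE big1 => [|y _]; last first.
  by rewrite /efm !vertexE /= addr0.
rewrite scale0r add0r; congr (- _); apply: eq_bigr => k _; congr ((_ * _) *: _).
  rewrite !degfE big_lift_max /= !vertexE /=; congr (_ + _).
  by apply: eq_bigr => y _; rewrite !vertexE.
apply: eq_wedge_snoc => [j a b|a b];
  case: (unliftP ord_max a) => [a' ->|->]; case: (unliftP ord_max b) => [b' ->|->];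
  by rewrite /res /efm !vertexE.
Qed.

Let antenna_cut x := cut (degf x) (res x) (snoc (fun k => inc (S k)) antef).

Let antenna_cut_new : antenna_cut ord_max = v.+1%:R *: wedge S.
Proof.
rewrite /antenna_cut cut_snoc big1 => [|k _]; last first.
  rewrite wedge_snoc0 ?scaler0 // => a b _.
  by rewrite /res /antef neq_liftl.
rewrite subr0 degfE /antef (eq_bigr (fun=> 1)) => [|y _]; last first.
  by rewrite !vertexE add0r.
rewrite sumr_const card_ord; congr (_ *: _).
by apply: eq_wedge => k a b _; rewrite /res inc_lift.
Qed.

Let antenna_cut_old q : antenna_cut (lift ord_max q) =
  wedge (fun k => inc (res q (S k))) -
  \sum_(k < e.+1) ((-1) ^+ (e + k) * degf q (S k)) *:
    wedge (snoc (fun j => inc (res q (S (lift k j)))) antef).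
Proof.
rewrite /antenna_cut cut_snoc; congr (_ - _).
  rewrite degfE /antef big_lift_max /= big1 => [|y _]; last first.
    by rewrite !vertexE addr0.
  rewrite !vertexE /= add0r addr0 scale1r; apply: eq_wedge => k a b _.
  by case: (unliftP ord_max a) => [a' ->|->]; case: (unliftP ord_max b) => [b' ->|->];
    rewrite /res !vertexE.
apply: eq_bigr => k _; congr ((_ * _) *: _).
  rewrite !degfE big_lift_max /= !vertexE !addr0.
  by apply: eq_bigr => y _; rewrite !vertexE.
apply: eq_wedge_snoc => [j a b _|a b _];
  by case: (unliftP ord_max a) => [a' ->|->]; case: (unliftP ord_max b) => [b' ->|->];
    rewrite /res /antef !vertexE.
Qed.

(** Removing a half of the split vertex returns the graph $2(v+1)$ times, and 1/2 of this cancels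
    the $v+1$ copies from new ends of antennas. Removing an old leaf [q] anticommutes with splitting
    [p], except that an edge from [q] to [p] may go to either half and is counted twice: this
    surplus is [leaf_split]. Finally, an antenna turns an isolated vertex into a leaf, which gives
    the other term. *)
Lemma rm_leaf_delta :
  rm_leaf (delta_coinv (wedge S)) + delta_coinv (rm_leaf (wedge S)) =
  - add_isolated (rm_isolated (wedge S)) - leaf_split S.
Proof.
pose c (k : 'I_e.+1) : K := (-1) ^+ (e + k).
pose A := \sum_q wedge (fun k => inc (res q (S k))).
pose V q k : coinv K v.+1 e.+1 :=
  wedge (snoc (fun j => inc (res q (S (lift k j)))) antef).
pose DW := \sum_(q < v.+1) \sum_(p < v) \sum_(k < e.+1) (c k * degf q (S k)) *: leaf_term S q p k.
pose DV := \sum_(q < v.+1) \sum_(k < e.+1) (c k * degf q (S k)) *: V q k.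
pose L := \sum_(q < v.+1) \sum_(p < v) \sum_(k < e.+1)
  (c k * (S k q (lift q p) + S k (lift q p) q)) *: leaf_term S q p k.
have Hsplit : \sum_p rm_leaf (wedge (snoc (fun k => sub p (S k))
    (E (lift ord_max p) ord_max))) = (2 * v.+1)%:R *: wedge S - (DW + L).
  under eq_bigr => p _ do
    rewrite rm_leaf_wedge big_lift_max /= -/(split_cut _ _) split_cut_new.
  rewrite big_split exchange_big /=.
  under eq_bigr => q _ do rewrite (bigD1_ord q) //= -/(split_cut _ _) split_cut_old.
  rewrite big_split /= !sumr_const !card_ord addrAC -mulrnDr addnn.
  rewrite -mul2n -scaler_nat /=; congr (_ + _).
  rewrite /DW /L -big_split -sumrN; apply: eq_bigr => q _.
  rewrite -big_split -sumrN; apply: eq_bigr => p _.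
  rewrite -/(split_cut _ _) split_cut_other -big_split; congr (- _).
  by apply: eq_bigr => k _ /=; rewrite -scalerDl -mulrDr.
have Hant : rm_leaf (wedge (snoc (fun k => inc (S k)) antef)) =
    v.+1%:R *: wedge S + (A - DV).
  rewrite rm_leaf_wedge big_lift_max /= -/(antenna_cut _) antenna_cut_new addrC.
  congr (_ + _); rewrite /A /DV -sumrB; apply: eq_bigr => q _.
  exact: antenna_cut_old.
have Hleaf : delta_coinv (rm_leaf (wedge S)) = 2%:R^-1 *: DW - DV.
  have Hterm q k : delta_coinv ((c k * degf q (S k)) *:
      wedge (fun j => res q (S (lift k j)))) =
      2%:R^-1 *: (\sum_p (c k * degf q (S k)) *: leaf_term S q p k)
      - (c k * degf q (S k)) *: V q k.
    transitivity ((c k * degf q (S k)) *: (2%:R^-1 *: (\sum_p leaf_term S q p k)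
      - V q k)); first by rewrite -[_ - _]delta_wedge -[RHS]linearZ_LR.
    rewrite scalerBr; congr (_ - _).
    by rewrite !scalerA mulrC -scalerA; congr (_ *: _); rewrite scaler_sumr.
  rewrite rm_leaf_wedge linear_sum /cut.
  under eq_bigr => q _.
    rewrite linear_sum (eq_bigr _ (fun k _ => Hterm q k)) sumrB -scaler_sumr.
    rewrite exchange_big; over.
  by rewrite sumrB -scaler_sumr.
have Hadd : add_isolated (rm_isolated (wedge S)) = A.
  rewrite rm_isolated_wedge linear_sum; apply: eq_bigr => q _.
  by rewrite /= add_isolated_wedge.
rewrite [delta_coinv (wedge S)]delta_wedge linearB linearZ_LR linear_sum /=.
rewrite Hsplit Hant Hleaf Hadd /leaf_split -/L.
rewrite scalerBr scalerA natrM mulKf ?natK_neq0 // scalerDr.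
move: (_ *: wedge S) (_ *: DW) (_ *: L) => X Y Z.
rewrite !opprD !opprK [X + _ + _]addrACA subrr add0r.
have YDV : - Y + DV + (Y - DV) = 0 by rewrite addrACA addNr subrr addr0.
rewrite [- Y - Z]addrC [- Z + _ + _]addrACA -[_ + (Y - DV)]addrA YDV.
by rewrite addr0 addrC.
Qed.

End LeafSplit.
End OperatorIdentities.

(** * Valences and their preservation by the operators *)

Section GraphSpans.
Variable K : fieldType.
Hypothesis charK : [pchar K] =i pred0.

Definition gspan v e (P : pred (lgraph v e)) (X : coinv K v e) : Prop :=
  exists c : lgraph v e -> K, X = \sum_(g | P g) c g *: gclass K g.

Lemma gspan0 v e (P : pred (lgraph v e)) : gspan P 0.
Proof. by exists (fun=> 0); rewrite big1 // => g _; rewrite scale0r. Qed.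

Lemma gspanD v e (P : pred (lgraph v e)) X Y :
  gspan P X -> gspan P Y -> gspan P (X + Y).
Proof.
move=> [c ->] [c' ->]; exists (fun g => c g + c' g); rewrite -big_split.
by apply: eq_bigr => g _; rewrite scalerDl.
Qed.

Lemma gspanZ v e (P : pred (lgraph v e)) a X : gspan P X -> gspan P (a *: X).
Proof.
move=> [c ->]; exists (fun g => a * c g).
by rewrite scaler_sumr; apply: eq_bigr => g _; rewrite scalerA.
Qed.

Lemma gspan_sum v e (P : pred (lgraph v e)) (I : finType) (Q : pred I)
    (X : I -> coinv K v e) :
  (forall i, Q i -> gspan P (X i)) -> gspan P (\sum_(i | Q i) X i).
Proof. by move=> PX; elim/big_ind: _ => //; [apply: gspan0 | apply: gspanD]. Qed.

Lemma gspan_gclass v e (P : pred (lgraph v e)) g : P g -> gspan P (gclass K g).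
Proof.
move=> Pg; exists (fun g' => (g' == g)%:R); rewrite (bigD1 g) //= eqxx scale1r.
by rewrite big1 ?addr0 // => g' /andP[_ /negPf->]; rewrite scale0r.
Qed.

Lemma gspan_sub v e (P Q : pred (lgraph v e)) X :
  (forall g, P g -> Q g) -> gspan P X -> gspan Q X.
Proof.
move=> PQ [c ->]; apply: gspan_sum => g /PQ Qg.
exact/gspanZ/gspan_gclass.
Qed.

Lemma gspan_pred0 v e (P : pred (lgraph v e)) X : P =1 xpred0 -> gspan P X -> X = 0.
Proof. by move=> P0 [c ->]; rewrite big_pred0. Qed.

Lemma gspan_map v e v' e' (P : pred (lgraph v e)) (Q : pred (lgraph v' e'))
    (f : {linear coinv K v e -> coinv K v' e'}) X :
  (forall g, P g -> gspan Q (f (gclass K g))) -> gspan P X -> gspan Q (f X).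
Proof.
move=> fP [c ->]; rewrite linear_sum; apply: gspan_sum => g Pg.
by rewrite linearZ_LR; apply/gspanZ/fP.
Qed.

Lemma coinv_geP v e i (X : coinv K v e) :
  reflect (gspan (min_valence i) X) (X \in coinv_ge i).
Proof. exact: asboolP. Qed.

Lemma valence_half v e (g : lgraph v e) x :
  valence g x = (\sum_h (g h == x))%N.
Proof.
rewrite /valence -sum1_card (eq_bigl (fun h => g h == x)); last first.
  by move=> h; rewrite inE.
by rewrite big_mkcond; apply: eq_bigr => h _; case: (g h == x).
Qed.

Lemma valence_gt0P v e (g : lgraph v e) x :
  reflect (exists h, g h = x) (0 < valence g x)%N.
Proof.
apply: (iffP card_gt0P) => [[h]|[h gh]]; first by rewrite inE => /eqP; exists h.
by exists h; rewrite inE gh.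
Qed.

Lemma sum_half e (F : 'I_e * bool -> nat) :
  (\sum_h F h = \sum_k (F (k, true) + F (k, false)))%N.
Proof.
transitivity (\sum_k \sum_i F (k, i))%N.
  by rewrite pair_bigA; apply: eq_bigr => -[].
by apply: eq_bigr => k _; rewrite big_bool.
Qed.

Lemma big_old_half e (F : 'I_e.+1 * bool -> nat) :
  (\sum_h F h = \sum_h F (old_half h) + F (ord_max, true) + F (ord_max, false))%N.
Proof. by rewrite !sum_half big_lift_max /= addnA. Qed.

Lemma valence_new v e (g : lgraph v e.+1) a b x : new_edge a b g ->
  valence g x = ((\sum_h (g (old_half h) == x)) + (b == x) + (a == x))%N.
Proof. by case/andP=> /eqP ga /eqP gb; rewrite valence_half big_old_half ga gb. Qed.

Section Split.
Variables (v e : nat) (p : 'I_v) (g : lgraph v e) (g' : lgraph v.+1 e.+1).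
Hypothesis split_g : split_at p g g'.

Lemma split_new : new_edge (lift ord_max p) ord_max g'.
Proof. by case/andP: split_g. Qed.

Lemma split_coll h : coll p (g' (old_half h)) = g h.
Proof.
by case/andP: split_g => /forallP/(_ h); rewrite mem_coll => /eqP.
Qed.

Lemma split_valence_other u : u != p -> valence g' (lift ord_max u) = valence g u.
Proof.
move=> ne; rewrite (valence_new _ split_new) !vertexE [p == u]eq_sym (negPf ne).
rewrite !addn0 valence_half; apply: eq_bigr => h _; rewrite -(split_coll h).
case: (unliftP ord_max (g' (old_half h))) => [a ->|->].
  by rewrite coll_lift eq_lift.
by rewrite coll_max neq_liftr [p == u]eq_sym (negPf ne).
Qed.

Lemma split_valence_sum :
  (valence g' (lift ord_max p) + valence g' ord_max = valence g p + 2)%N.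
Proof.
rewrite !(valence_new _ split_new) !vertexE /= !addn0 addnACA.
congr (_ + _)%N; rewrite valence_half -big_split /=; apply: eq_bigr => h _.
rewrite -split_coll; case: (unliftP ord_max (g' (old_half h))) => [a ->|->].
  by rewrite coll_lift !vertexE addn0.
by rewrite coll_max !vertexE.
Qed.

Lemma split_valence_max_le1 : (valence g' ord_max <= 1)%N = antenna_at p g g'.
Proof.
rewrite (valence_new _ split_new) !vertexE /= addn0 addn1 ltnS leqn0 sum_nat_eq0.
rewrite /antenna_at split_new andbT; apply: eq_forallb => h.
rewrite -split_coll eqb0.
by case: (unliftP ord_max (g' (old_half h))) => [a ->|->]; rewrite ?coll_lift !vertexE.
Qed.

End Split.

Lemma antenna_split v e (p : 'I_v) (g : lgraph v e) g' :
  antenna_at p g g' -> split_at p g g'.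
Proof.
rewrite /antenna_at /split_at => /andP[/forallP ag ->]; rewrite andbT.
by apply/forallP=> h; rewrite mem_coll (eqP (ag h)) coll_lift.
Qed.

Definition proper_split v e (p : 'I_v) (g : lgraph v e) (g' : lgraph v.+1 e.+1) :=
  [&& split_at p g g', (1 < valence g' (lift ord_max p))%N &
      (1 < valence g' ord_max)%N].

(* Exchanging the two halves of [p] and reversing the new edge turns the
   splittings that leave [p] univalent into those with a univalent new vertex. *)
Lemma split_old_le1 v e (p : 'I_v) (g : lgraph v e) :
  \sum_(g' | split_at p g g' && (valence g' (lift ord_max p) <= 1)%N) gclass K g' =
  \sum_(g' | antenna_at p g g') gclass K g'.
Proof.
pose s := tperm (lift ord_max p) ord_max.
pose f : {ffun 'I_e.+1 -> bool} := [ffun k => k == ord_max].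
rewrite (@sum_gclass_relabel _ _ _ s 1 f (antenna_at p g)).
  by rewrite odd_perm1 expr0 scale1r.
move=> g'; have s_old h : relabel s 1 f g' (old_half h) = s (g' (old_half h)).
  by rewrite relabelE /relabel_half /old_half perm1 /= ffunE neq_liftl; case: h.
have s_new i : relabel s 1 f g' (ord_max, i) = s (g' (ord_max, ~~ i)).
  by rewrite relabelE /relabel_half perm1 /= ffunE eqxx.
have c_s a : coll p (s a) = coll p a.
  by rewrite /s; case: tpermP => [->|->|//]; rewrite coll_lift coll_max.
have new_s : new_edge (lift ord_max p) ord_max (relabel s 1 f g') =
    new_edge (lift ord_max p) ord_max g'.
  have sE a u : (s a == u) = (a == s u).
    by rewrite -[in RHS](inj_eq (@perm_inj _ s)) tpermK.
  by rewrite /new_edge !s_new !sE tpermL tpermR andbC.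
have split_s : split_at p g (relabel s 1 f g') = split_at p g g'.
  rewrite /split_at new_s; congr (_ && _); apply: eq_forallb => h.
  by rewrite !mem_coll s_old c_s.
rewrite split_s -[X in (valence _ X <= 1)%N](tpermR (lift ord_max p) ord_max).
rewrite -/s valence_relabel; case: (boolP (split_at p g g')) => [sg|nsg] /=.
  exact: split_valence_max_le1.
by apply/esym/negbTE; apply: contra nsg; apply: antenna_split.
Qed.

(** The valences of the halves add up to [valence g p + 2], so at most one half is univalent and the
    univalent cases give the antennas twice. In [delta] the coefficient 1/2 makes them cancel the
    antennas subtracted: no leaf is created. *)
Lemma split_decomp v e (p : 'I_v) (g : lgraph v e) : (0 < valence g p)%N ->
  \sum_(g' | split_at p g g') gclass K g' =
  2%:R *: \sum_(g' | antenna_at p g g') gclass K g' +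
  \sum_(g' | proper_split p g g') gclass K g'.
Proof.
move=> gp; rewrite (bigID (fun g' => valence g' (lift ord_max p) <= 1)%N) /=.
rewrite split_old_le1 [X in _ + X = _](bigID (fun g' : lgraph v.+1 e.+1 => valence g' ord_max <= 1)%N) /=.
rewrite addrA scaler_nat mulr2n; congr (_ + _ + _); apply: eq_bigl => g'; last first.
  by rewrite /proper_split -!ltnNge andbA.
apply/idP/idP => [/andP[/andP[sg _] g1]|ag].
  by rewrite -(split_valence_max_le1 sg).
have sg := antenna_split ag; rewrite sg (split_valence_max_le1 sg) ag andbT /=.
have := split_valence_sum sg; have := split_valence_max_le1 sg; rewrite ag.
by move: (valence g' _) (valence g' _) => a b; lia.
Qed.

Lemma split_isolated v e (p : 'I_v) (g : lgraph v e) : valence g p = 0%N ->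
  \sum_(g' | split_at p g g') gclass K g' =
  \sum_(g' | antenna_at p g g') gclass K g'.
Proof.
move=> gp; apply: eq_bigl => g'; apply/idP/idP; last exact: antenna_split.
move=> sg; rewrite -(split_valence_max_le1 sg).
have := split_valence_sum sg; rewrite gp (valence_new _ (split_new sg)) !vertexE /=.
by move: (valence g' _) (\sum__ _)%N => a b; lia.
Qed.

Lemma proper_split_ge v e (p : 'I_v) (g : lgraph v e) g' i : (i <= 2)%N ->
  min_valence i g -> proper_split p g g' -> min_valence i g'.
Proof.
move=> i2 /forallP gi /and3P[sg p1 m1]; apply/forallP=> x.
case: (unliftP ord_max x) => [u ->|->]; last exact: leq_trans m1.
have [->|ne] := eqVneq u p; first exact: leq_trans p1.
by rewrite (split_valence_other sg).
Qed.

Lemma delta_ge v e i (X : coinv K v e) : (0 < i <= 2)%N ->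
  X \in coinv_ge i -> delta_coinv X \in coinv_ge i.
Proof.
case/andP=> i0 i2 /coinv_geP gX; apply/coinv_geP; move: gX.
apply: gspan_map => g gi; rewrite [X in gspan _ X]delta_coinv_class.
apply: gspan_sum => p _; have gp : (0 < valence g p)%N.
  by apply: leq_trans i0 _; move/forallP: gi.
rewrite (split_decomp gp) scalerDr scalerA mulVf ?natK_neq0 // scale1r addrC addKr.
apply/gspanZ/gspan_sum => g' sg; apply: gspan_gclass; exact: proper_split_ge sg.
Qed.

Lemma nabla_ge v e i (X : coinv K v e) :
  X \in coinv_ge i -> nabla_coinv X \in coinv_ge i.
Proof.
move=> /coinv_geP gX; apply/coinv_geP; move: gX; apply: gspan_map => g /forallP gi.
rewrite [X in gspan _ X]nabla_coinv_class; apply: gspan_sum => -[x y] /= _.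
apply: gspan_sum => g' /andP[/forallP eg ng]; apply/gspan_gclass/forallP => u.
apply: leq_trans (gi u) _; rewrite (valence_new _ ng) -addnA.
apply: leq_trans (leq_addr _ _); rewrite valence_half.
by apply: leq_sum => h _; rewrite (eqP (eg h)).
Qed.

Lemma D_ge v e i (X : coinv K v.+1 e) :
  X \in coinv_ge i -> D_coinv X \in coinv_ge i.
Proof.
move=> /coinv_geP gX; apply/coinv_geP; move: gX; apply: gspan_map => g /forallP gi.
rewrite [X in gspan _ X]D_coinv_class; apply: gspan_sum => x _; apply: gspanZ.
apply: gspan_sum => g' /forallP rg; apply/gspan_gclass/forallP => u.
apply: leq_trans (gi (lift x u)) _; rewrite !valence_half; apply: leq_sum => h _.
case: (eqVneq (g h) (lift x u)) => // gh; have := rg h.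
by rewrite gh neq_liftl eq_lift /= => ->.
Qed.

End GraphSpans.

(** * Kernel and image of the deletion of isolated vertices *)

Section IsolatedVerticesAndLeaves.
Variable K : fieldType.
Hypothesis charK : [pchar K] =i pred0.

Lemma res_gform0 v e (q : 'I_v.+1) (g : lgraph v.+1 e) h a b :
  g h = q -> res q (gform K g h.1) a b = 0.
Proof.
by case: h => k [] /= gq; rewrite /res /gform /efm gq neq_liftl ?andbF.
Qed.

Lemma isolated_term v e (q : 'I_v.+1) (g : lgraph v.+1 e) :
  wedge (fun k => inc (res q (gform K g k))) = (valence g q == 0)%:R *: gclass K g.
Proof.
have [gq|] := eqVneq; last first.
  rewrite -lt0n => /valence_gt0P[h gh]; rewrite scale0r.
  apply: (@wedge_zero _ _ _ _ h.1) => a b _; rewrite /inc.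
  by do 2!case: unlift => // ?; rewrite (res_gform0 _ _ gh).
rewrite scale1r -wedge_gform -(wedge_vperm (lift_perm ord_max q 1) (gform K g)).
have gN k i : (q == g (k, i)) = false.
  apply/negbTE; apply/eqP => gk; have: (0 < valence g q)%N.
    by apply/valence_gt0P; exists (k, i).
  by rewrite gq.
apply: eq_wedge => k a b _.
case: (unliftP ord_max a) => [a' ->|->]; case: (unliftP ord_max b) => [b' ->|->];
  by rewrite !vertexE /res /gform /efm ?gN ?andbF.
Qed.

Definition isolated v e (g : lgraph v e) : nat := #|[set x | valence g x == 0]|.

Lemma add_rm_isolated v e (g : lgraph v.+1 e) :
  add_isolated (rm_isolated (gclass K g)) = (isolated g)%:R *: gclass K g.
Proof.
have term q : add_isolated (wedge (fun k => res q (gform K g k))) =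
    (valence g q == 0)%:R *: gclass K g.
  by rewrite add_isolated_wedge // isolated_term.
rewrite -[in LHS]wedge_gform rm_isolated_wedge // linear_sum.
rewrite (eq_bigr _ (fun q _ => term q)).
rewrite -scaler_suml -natr_sum; congr (_%:R *: _).
rewrite /isolated -sum1_card [RHS]big_mkcond; apply: eq_bigr => x _.
by rewrite inE; case: eqP.
Qed.

Lemma rm_isolated_ge1 v e (X : coinv K v.+1 e) :
  X \in coinv_ge 1 -> rm_isolated X = 0.
Proof.
move=> /coinv_geP gX; apply: (@gspan_pred0 K v e xpred0) => //; move: gX.
apply: (gspan_map (f := @rm_isolated K v e)) => g /forallP g1.
rewrite /= -wedge_gform rm_isolated_wedge // big1 => [|q _]; first exact: gspan0.
have /valence_gt0P[h gh] := g1 q.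
by apply: (@wedge_zero _ _ _ _ h.1) => a b _; rewrite (res_gform0 _ _ gh).
Qed.

Lemma isolated_relabel v e s t f (g : lgraph v e) :
  isolated (relabel s t f g) = isolated g.
Proof.
rewrite /isolated -[LHS](card_preimset _ (@perm_inj _ s)).
by apply: eq_card => x; rewrite !inE valence_relabel.
Qed.

Lemma rm_isolated_ker v e (X : coinv K v.+1 e) :
  rm_isolated X = 0 -> X \in coinv_ge 1.
Proof.
move=> rX; apply/coinv_geP.
(* Deleting and re-adding an isolated vertex multiplies a graph by [isolated g]; dividing by it
   recovers the part of [X] with isolated vertices, which is therefore 0. On the other graphs
   [0^-1 = 0]. *)
pose phi (g : lgraph v.+1 e) := (isolated g)%:R^-1 *: gclass K g.
have phi_relabel s t f g : phi (relabel s t f g) = (-1) ^+ odd_perm t *: phi g.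
  by rewrite /phi isolated_relabel gclass_relabel !scalerA mulrC.
pose phiL : {linear coinv K v.+1 e -> coinv K v.+1 e} :=
  HB.pack (coinv_map phi)
    (GRing.isLinear.Build K _ _ _ (coinv_map phi) (coinv_map_linear phi_relabel)).
have phiE g : phiL (gclass K g) = phi g by exact: coinv_map_class.
have: phiL (add_isolated (rm_isolated X)) = 0 by rewrite rX !linear0.
have [c ->] := coinv_gclass X; rewrite !linear_sum.
under eq_bigr => g _ do rewrite !linearZ_LR /= add_rm_isolated -[coinv_map _]/(phiL : _ -> _)
   linearZ_LR phiE.
rewrite (bigID (fun g => isolated g == 0)) /= big1 ?add0r => [|g /eqP->]; last first.
  by rewrite scale0r scaler0.
move=> S0; exists c; rewrite (bigID (min_valence 1)) /= [X in _ + X](_ : _ = 0) ?addr0 //.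
have isoE g : ~~ min_valence 1 g = (isolated g != 0).
  rewrite /isolated cards_eq0; congr (~~ _).
  apply/forallP/eqP => [g1|g0 x].
    by apply/setP=> x; rewrite !inE; have := g1 x; case: valence.
  by rewrite lt0n; apply/negP => gx; have := in_set0 x; rewrite -g0 inE gx.
rewrite -[RHS]S0; apply: eq_big => [//|g].
rewrite isoE /phi -lt0n => g0; rewrite !scalerA; congr (_ *: _).
by rewrite -mulrA divff ?mulr1 // natK_neq0.
Qed.

(** By [rm_add_isolated], adding and then removing an isolated vertex multiplies a graph with [n] of
    them by [n + 1], which is invertible. *)
Lemma rm_isolated_onto v e (X : coinv K v.+1 e) : exists Y, rm_isolated Y = X.
Proof.
have [c ->] := coinv_gclass X.
exists (\sum_g (c g * (isolated g).+1%:R^-1) *: add_isolated (gclass K g)).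
rewrite linear_sum; apply: eq_bigr => g _; rewrite linearZ_LR /=.
rewrite rm_add_isolated // add_rm_isolated -{1}[gclass K g]scale1r -scalerDl.
by rewrite scalerA -mulrA -natr1 [_ + 1]addrC mulVf ?mulr1 // addrC natr1 natK_neq0.
Qed.

End IsolatedVerticesAndLeaves.

(** * Triangularity with respect to the number of leaves *)

Section LeafSplitTriangular.
Variable K : fieldType.
Hypothesis charK : [pchar K] =i pred0.

Definition leaves v e (g : lgraph v e) : nat := #|[set x | valence g x == 1]|.

Definition joins v e (g : lgraph v.+1 e) q (p : 'I_v) k : bool :=
  ((g (k, false) == q) && (g (k, true) == lift q p)) ||
  ((g (k, false) == lift q p) && (g (k, true) == q)).

Lemma gform_joins v e (g : lgraph v.+1 e) q (p : 'I_v) k :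
  gform K g k q (lift q p) + gform K g k (lift q p) q = (joins g q p k)%:R.
Proof.
rewrite /gform /efm /joins ![q == _]eq_sym ![lift q p == _]eq_sym.
case: (eqVneq (g (k, false)) q) => [->|ne].
  by rewrite neq_liftr /= orbF addr0.
by rewrite /= add0r.
Qed.

(* Twice the eigenvalue of the leading part of [leaf_split] at [g]: a leaf whose
   neighbour is not a leaf counts twice. *)
Definition weight v e (g : lgraph v.+1 e) : nat :=
  (\sum_q \sum_(p < v) \sum_k
    ((valence g q == 1) && joins g q p k) * (1 + (1 < valence g (lift q p))))%N.

Section Leaf.
Variables (v e : nat) (g : lgraph v.+1 e.+1) (q : 'I_v.+1) (p : 'I_v) (k : 'I_e.+1).
Hypothesis g_k : joins g q p k.

Let touch k' (x : 'I_v.+1) := (g (k', false) == x) || (g (k', true) == x).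

Let valence_touch x :
  valence g x = (touch k x + \sum_(j < e) touch (lift k j) x)%N.
Proof. by rewrite valence_edges (bigD1_ord k). Qed.

Let touch_q : touch k q.
Proof. by case/orP: g_k => /andP[/eqP a /eqP b]; rewrite /touch a b eqxx ?orbT. Qed.

Let touch_lift u : touch k (lift q u) = (u == p).
Proof.
by case/orP: g_k => /andP[/eqP a /eqP b]; rewrite /touch a b !vertexE ?orbF eq_sym.
Qed.

Lemma leaf_term_not_leaf : valence g q != 1%N ->
  leaf_term (gform K g) q p k = 0.
Proof.
rewrite valence_touch touch_q add1n eqSS.
rewrite sum_nat_eq0 => /forallPn[j]; rewrite eqb0 negbK => tq.
have [i gi] : exists i, g (lift k j, i) = q.
  by case/orP: tq => /eqP; [exists false | exists true].
apply: (@wedge_zero _ _ _ _ (lift ord_max j)) => a b _; rewrite snoc_lift /sub.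
by case: eqP => // _; apply: (res_gform0 _ _ _ (h := (lift k j, i))).
Qed.

Hypothesis q_leaf : valence g q = 1%N.

Let no_touch j : ~~ touch (lift k j) q.
Proof.
move: q_leaf; rewrite valence_touch touch_q add1n => -[/eqP].
by rewrite sum_nat_eq0 => /forallP/(_ j); rewrite eqb0.
Qed.

(** The default [p] is never taken: only the edge [k] ends at the leaf [q]. *)
Let rest_end (h : 'I_e * bool) : 'I_v := odflt p (unlift q (g (lift k h.1, h.2))).

Let rest_endE h : lift q (rest_end h) = g (lift k h.1, h.2).
Proof.
rewrite /rest_end; case: unliftP => [u -> //|gq].
have := no_touch h.1; rewrite /touch.
by case: h gq => j [] /= ->; rewrite eqxx ?orbT.
Qed.

Let rest_subproof : [forall j,
  [ffun h => rest_end h] (j, false) != [ffun h => rest_end h] (j, true)].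
Proof.
by apply/forallP=> j; rewrite !ffunE -(inj_eq (@lift_inj _ q)) !rest_endE ends_neq.
Qed.

Let rest : lgraph v e := LGraph rest_subproof.

Let restE h : lift q (rest h) = g (lift k h.1, h.2).
Proof. by rewrite /= ffunE rest_endE. Qed.

Let rest_valence u : valence g (lift q u) = ((u == p) + valence rest u)%N.
Proof.
rewrite valence_touch touch_lift valence_edges; congr (_ + _)%N.
by apply: eq_bigr => j _; rewrite /touch -!(restE (j, _)) !eq_lift.
Qed.

Let leaf_term_rest :
  leaf_term (gform K g) q p k = \sum_(g' | split_at p rest g') gclass K g'.
Proof.
rewrite split_wedge; apply: eq_wedge_snoc => // j a b ne; rewrite /sub.
case: eqP => // _; rewrite /res /gform /efm.
by rewrite -(restE (j, false)) -(restE (j, true)) !eq_lift.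
Qed.

Let antenna_rest : (-1) ^+ (e + k) *: \sum_(g' | antenna_at p rest g') gclass K g' =
  gclass K g.
Proof.
rewrite antenna_wedge.
have -> : wedge (snoc (fun j => inc (gform K rest j)) (efm K (lift ord_max p) ord_max)) =
    (-1) ^+ (e + k) *: gclass K g.
  have -> : (-1) ^+ (e + k) = (-1) ^+ (odd_perm (lift_perm (@ord_max e) k 1)) :> K.
    by rewrite odd_lift_perm odd_perm1 addbF signr_addb !signr_odd exprD.
  rewrite -(wedge_gform K g) -(wedge_perm (lift_perm ord_max q 1)).
  apply: wedge_sym => // j a b ne.
  case: (unliftP ord_max j) => [{}j ->|->].
    rewrite snoc_lift lift_perm_lift perm1.
    have gq c : (c == g (lift k j, false)) = (c == lift q (rest (j, false))).
      by rewrite -(restE (j, false)).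
    have gq' c : (c == g (lift k j, true)) = (c == lift q (rest (j, true))).
      by rewrite -(restE (j, true)).
    case: (unliftP ord_max a) ne => [a' ->|->]; case: (unliftP ord_max b) => [b' ->|->];
      by rewrite !vertexE /gform /efm !gq !gq' !vertexE.
  rewrite snoc_max lift_perm_id /gform /efm.
  case/orP: g_k => /andP[/eqP -> /eqP ->];
  case: (unliftP ord_max a) ne => [a' ->|->]; case: (unliftP ord_max b) => [b' ->|->];
    by rewrite !vertexE //= ?addr0 ?add0r.
by rewrite scalerA -expr2 sqrr_sign scale1r.
Qed.

(** With [q] removed, splitting [p] yields two antennas, each of which is [g] again, and proper
    splittings, where the leaf is gone and no new one appears. If [p] was itself a leaf, it is
    isolated after the removal and its only splitting is one antenna; hence the factor. *)
Lemma leaf_term_leaf : min_valence 1 g ->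
  exists2 Y, gspan [pred g' | min_valence 1 g' && (leaves g' < leaves g)%N] Y &
    (-1) ^+ (e + k) *: leaf_term (gform K g) q p k =
    (1 + (1 < valence g (lift q p)))%N%:R *: gclass K g + Y.
Proof.
move=> /forallP g1; rewrite leaf_term_rest -antenna_rest.
have := rest_valence p; rewrite eqxx add1n => ->; rewrite ltnS.
case: posnP => [p0|p0].
  by exists 0; [apply: gspan0 | rewrite split_isolated // -[false.+1%:R]/1 scale1r addr0].
rewrite split_decomp //.
exists ((-1) ^+ (e + k) *: \sum_(g' | proper_split p rest g') gclass K g'); last first.
  by rewrite scalerDr !scalerA mulrC.
apply/gspanZ/gspan_sum => g' sg'; apply: gspan_gclass.
have /and3P[sg p2 m2] := sg'; apply/andP; split.
  apply/forallP => x; case: (unliftP ord_max x) => [u ->|->]; last exact: ltnW.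
  have [->|ne] := eqVneq u p; first exact: ltnW.
  rewrite (split_valence_other sg) //; have := g1 (lift q u).
  by rewrite rest_valence (negPf ne).
(* The halves of [p] are not leaves and the other vertices keep their valence, so that [leaf_of]
   embeds the leaves of [g'] into those of [g] other than [q]. *)
pose leaf_of (x : 'I_v.+1) := if unlift ord_max x is Some u then lift q u else q.
have leaf_of_inj : injective leaf_of.
  move=> x y; rewrite /leaf_of.
  case: (unliftP ord_max x) => [a ->|->]; case: (unliftP ord_max y) => [b ->|->] //.
  - by move/lift_inj->.
  - by move/eqP; rewrite neq_liftl.
  - by move/eqP; rewrite neq_liftr.
rewrite /leaves -(card_imset _ leaf_of_inj).
apply: (@leq_ltn_trans #|[set x | valence g x == 1] :\ q|); last first.
  by rewrite [X in (_ < X)%N](cardsD1 q) inE q_leaf.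
apply/subset_leq_card/subsetP => y /imsetP[x + ->{y}]; rewrite inE.
rewrite /leaf_of; case: (unliftP ord_max x) => [u ->|->] x1; last first.
  by rewrite (eqP x1) in m2.
have [up|ne] := eqVneq u p; first by rewrite up in x1; rewrite (eqP x1) in p2.
rewrite !inE neq_liftl rest_valence (negPf ne) /=.
by rewrite -(split_valence_other sg ne).
Qed.

End Leaf.

Lemma leaf_split_triangular v e (g : lgraph v.+1 e.+1) : min_valence 1 g ->
  exists2 Y, gspan [pred g' | min_valence 1 g' && (leaves g' < leaves g)%N] Y &
    leaf_split (gform K g) = ((weight g)%:R / 2%:R) *: gclass K g + Y.
Proof.
move=> g1; set P := [pred g' | _].
pose ok (X : coinv K v.+1 e.+1) (w : nat) :=
  exists2 Y, gspan P Y & X = w%:R *: gclass K g + Y.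
have ok_sum (I : finType) (F : I -> coinv K v.+1 e.+1) (w : I -> nat) :
    (forall i, ok (F i) (w i)) -> ok (\sum_i F i) (\sum_i w i)%N.
  move=> FE; elim/big_rec2: _ => [|i n X _ [Y PY ->]].
    by exists 0; rewrite ?scale0r ?addr0 //; apply: gspan0.
  have [Z PZ ->] := FE i; exists (Z + Y); first exact: gspanD.
  by rewrite natrD scalerDl addrACA.
have [Y PY YE] : ok (\sum_q \sum_p \sum_(k < e.+1)
   ((-1) ^+ (e + k) * (gform K g k q (lift q p) + gform K g k (lift q p) q)) *:
     leaf_term (gform K g) q p k) (weight g).
  do 3!apply: (ok_sum _ _ _) => ?; rewrite gform_joins; case: (boolP (joins _ _ _ _)) => gk.
    case: eqP => [gq|/eqP gq].
      have [Y PY YE] := leaf_term_leaf gk gq g1.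
      by exists Y; rewrite // mul1n mulr1 YE.
    exists 0; first exact: gspan0.
    by rewrite (leaf_term_not_leaf gk) // scaler0 mul0n scale0r addr0.
  exists 0; first exact: gspan0.
  by rewrite mulr0 scale0r andbF mul0n scale0r addr0.
exists (2%:R^-1 *: Y); first exact: gspanZ.
by rewrite /leaf_split YE scalerDr scalerA mulrC.
Qed.

Lemma weight_gt0 v e (g : lgraph v.+1 e) : (0 < leaves g)%N -> (0 < weight g)%N.
Proof.
case/card_gt0P => q; rewrite inE => gq.
have /valence_gt0P[[k i] gk] : (0 < valence g q)%N by rewrite (eqP gq).
have [p gp] : exists p, g (k, ~~ i) = lift q p.
  have : q != g (k, ~~ i).
    rewrite -gk; have := ends_neq g k; case: (i) => //=.
    by rewrite eq_sym.
  by case/unlift_some => p -> _; exists p.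
have gj : joins g q p k.
  by rewrite /joins; case: i gk gp => /= -> ->; rewrite !eqxx ?orbT.
rewrite /weight (bigD1 q) //= (bigD1 p) //= (bigD1 k) //= gq gj.
by rewrite mul1n -!addnA.
Qed.

End LeafSplitTriangular.

(** * The full graph complex and the conjugation of [tdelta] to [twisted] *)

Section FullComplex.
Variable K : fieldType.
Hypothesis charK : [pchar K] =i pred0.
Implicit Types c : fGC K.

(** As [c v e] lives on [v.+1] vertices, this is minus the sign of the parity of vertices plus
    edges. The commutation relations are those of either sign. *)
Definition eps c : fGC K := fun v e => (-1) ^+ (v + e) *: c v e.

Fact eps_linear : linear eps.
Proof.
move=> a c c'; apply: fGCP => v e.
rewrite -[RHS]/(a *: ((-1) ^+ (v + e) *: c v e) + (-1) ^+ (v + e) *: c' v e).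
rewrite -[LHS]/((-1) ^+ (v + e) *: (a *: c v e + c' v e)) scalerDr.
by rewrite !scalerA mulrC.
Qed.

HB.instance Definition _ := GRing.isLinear.Build K (fGC K) (fGC K) _ eps eps_linear.

Definition fleaf c : fGC K := fun v e => rm_leaf (c v.+1 e.+1).

Fact fleaf_linear : linear fleaf.
Proof. by move=> a c c'; apply: fGCP => v e; apply: linearP. Qed.

HB.instance Definition _ := GRing.isLinear.Build K (fGC K) (fGC K) _ fleaf fleaf_linear.

(* Over a field containing a square root [i] of -1, [twisted] is [delta + i nabla]
   up to rescaling by powers of [i]. *)
Definition twisted : {linear fGC K -> fGC K} := delta \+ (@nabla K \o eps).

Lemma twistedE c : twisted c = delta c + nabla (eps c).
Proof. by []. Qed.

Lemma eps_eps c : eps (eps c) = c.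
Proof. by apply: fGCP => v e; rewrite /eps scalerA -expr2 sqrr_sign scale1r. Qed.

Lemma eps_delta c : eps (delta c) = delta (eps c).
Proof.
apply: fGCP => -[|v] [|e]; rewrite /eps /delta ?scaler0 // linearZ_LR.
by rewrite addSn addnS !exprS !mulN1r opprK.
Qed.

Lemma eps_nabla c : eps (nabla c) = - nabla (eps c).
Proof.
apply: fGCP => v [|e]; rewrite /eps /nabla ?scaler0 -[RHS]/(- _) ?oppr0 // linearZ_LR.
by rewrite addnS exprS mulN1r scaleNr.
Qed.

Lemma eps_D c : eps (Dop c) = - Dop (eps c).
Proof.
apply: fGCP => v e; rewrite -[RHS]/(- D_coinv ((-1) ^+ (v.+1 + e) *: c v.+1 e)).
rewrite [X in - X]linearZ_LR /= /eps.
by rewrite addSn exprS mulN1r scaleNr opprK.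
Qed.

Lemma fdelta_delta c : delta (delta c) = 0.
Proof.
apply: fGCP => -[|v] [|e] //; rewrite /delta.
by case: v e => [|v] [|e]; rewrite ?linear0 //; apply: delta_delta.
Qed.

Lemma fnabla_nabla c : nabla (nabla c) = 0.
Proof.
apply: fGCP => v [|[|e]] //; rewrite /nabla ?linear0 //.
exact: nabla_nabla.
Qed.

(** For graphs with a single vertex, [D_delta] passes through graphs without vertices, which are not
    in [fGC]. *)
Lemma delta_coinv0 e (X : coinv K 0 e) : delta_coinv X = 0.
Proof.
have [a ->] := coinv_gclass X; rewrite linear_sum big1 // => g _.
rewrite linearZ_LR; apply/eqP; rewrite scaler_eq0; apply/orP; right; apply/eqP.
by rewrite [LHS]delta_coinv_class /delta_graph big_ord0.
Qed.

Lemma fD_delta c : Dop (delta c) - delta (Dop c) = nabla c.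
Proof.
apply: fGCP => v e; rewrite -[LHS]/(Dop (delta c) v e - delta (Dop c) v e).
case: e => [|e]; first by case: v => [|v]; rewrite /Dop /delta linear0 subrr.
rewrite -[nabla c v e.+1](D_delta charK (c v e)).
by case: v => [|v] //; rewrite [X in _ = _ - X]delta_coinv0.
Qed.

Lemma fdelta_nabla c : delta (nabla c) = - nabla (delta c).
Proof.
rewrite -!fD_delta linearB /= !fdelta_delta.
by rewrite subr0 linear0 sub0r opprK.
Qed.

Lemma twisted_twisted c : twisted (twisted c) = 0.
Proof.
rewrite !twistedE !linearD /= fdelta_delta add0r eps_delta eps_nabla linearN /=.
by rewrite eps_eps fnabla_nabla oppr0 addr0 fdelta_nabla addNr.
Qed.

Lemma fGC_geP i c : reflect (forall v e, c v e \in coinv_ge i) (c \in fGC_ge K i).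
Proof. exact: asboolP. Qed.

Lemma fdelta_ge i c : (0 < i <= 2)%N -> c \in fGC_ge K i -> delta c \in fGC_ge K i.
Proof.
move=> i12 /fGC_geP ci; apply/fGC_geP => -[|v] [|e]; rewrite ?rpred0 //.
exact: delta_ge.
Qed.

Lemma fnabla_ge i c : c \in fGC_ge K i -> nabla c \in fGC_ge K i.
Proof.
move=> /fGC_geP ci; apply/fGC_geP => v [|e]; rewrite ?rpred0 //.
exact: nabla_ge.
Qed.

Lemma fD_ge i c : c \in fGC_ge K i -> Dop c \in fGC_ge K i.
Proof. by move=> /fGC_geP ci; apply/fGC_geP => v e; apply: D_ge. Qed.

Lemma eps_ge i c : c \in fGC_ge K i -> eps c \in fGC_ge K i.
Proof. by move=> /fGC_geP ci; apply/fGC_geP => v e; rewrite /eps rpredZ //; apply: ci. Qed.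

Lemma twisted_ge i c : (0 < i <= 2)%N -> c \in fGC_ge K i -> twisted c \in fGC_ge K i.
Proof.
by move=> i12 ci; rewrite twistedE rpredD ?fdelta_ge // fnabla_ge // eps_ge.
Qed.

Lemma fD_D c : c \in fGC_ge K 2 -> Dop (Dop c) = 0.
Proof.
move=> /fGC_geP c2; apply: fGCP => v e; rewrite /Dop.
have /coinv_geP := c2 v.+2 e; move: (c v.+2 e) => X gX.
apply: (@gspan_pred0 K _ _ xpred0) => //; move: gX.
have -> : D_coinv (D_coinv X) = (@D_coinv K _ e \o @D_coinv K _ e) X by [].
by apply: gspan_map => g g2; rewrite [X in gspan _ X]D_D //; apply: gspan0.
Qed.

Lemma fD_nabla c : c \in fGC_ge K 2 -> Dop (nabla c) = - nabla (Dop c).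
Proof.
move=> c2; rewrite -!fD_delta linearB /= !fD_D ?fdelta_ge //.
by rewrite linear0 sub0r subr0.
Qed.

Lemma tdeltaE c : tdelta c = delta c + Dop (nabla c).
Proof. by []. Qed.

Definition conj_to c : fGC K := c - Dop (eps c).
Definition conj_from c : fGC K := c + Dop (eps c).

Lemma conj_from_ge c : c \in fGC_ge K 2 -> conj_from c \in fGC_ge K 2.
Proof. by move=> c2; rewrite rpredD // fD_ge // eps_ge. Qed.

Lemma D_eps_D_eps c : c \in fGC_ge K 2 -> Dop (eps (Dop (eps c))) = 0.
Proof. by move=> c2; rewrite eps_D eps_eps linearN /= fD_D ?oppr0. Qed.

Lemma conj_toK c : c \in fGC_ge K 2 -> conj_from (conj_to c) = c.
Proof.
by move=> c2; rewrite /conj_from /conj_to !linearB /= D_eps_D_eps // subr0 subrK.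
Qed.

Lemma conj_fromK c : c \in fGC_ge K 2 -> conj_to (conj_from c) = c.
Proof.
by move=> c2; rewrite /conj_from /conj_to !linearD /= D_eps_D_eps // oppr0 addr0 addrK.
Qed.

(** On the right, [- D eps nabla eps] is [D nabla]; on the left, [D nabla D eps] vanishes because
    [D] and [nabla] anticommute and [D] squares to zero. The remaining terms agree by [fD_delta]. *)
Lemma tdelta_conj c : c \in fGC_ge K 2 -> tdelta (conj_to c) = conj_to (twisted c).
Proof.
move=> c2; rewrite tdeltaE twistedE /conj_to !linearB !linearD /=.
have -> : Dop (nabla (Dop (eps c))) = 0.
  rewrite -[nabla _]opprK -fD_nabla ?eps_ge // linearN /=.
  by rewrite fD_D ?oppr0 // fnabla_ge // eps_ge.
rewrite subr0 eps_delta eps_nabla eps_eps linearN /= -[nabla (eps c)]fD_delta.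
set A := delta c; set B := Dop (nabla c); set X := delta _; set Y := Dop (delta _).
by rewrite opprK addrA [Y - X]addrC [A + _]addrA addrK.
Qed.

Lemma tdelta_ge c : c \in fGC_ge K 2 -> tdelta c \in fGC_ge K 2.
Proof.
by move=> c2; rewrite tdeltaE rpredD ?fdelta_ge // fD_ge // fnabla_ge.
Qed.

Lemma tdelta_tdelta c : c \in fGC_ge K 2 -> tdelta (tdelta c) = 0.
Proof.
move=> c2; rewrite -(conj_fromK c2); set c' := conj_from c.
have c'2 : c' \in fGC_ge K 2 by apply: conj_from_ge.
rewrite tdelta_conj // tdelta_conj ?twisted_ge // twisted_twisted /conj_to.
by rewrite !linear0 addr0.
Qed.

End FullComplex.
Arguments twisted {K}.

(** * Acyclicity without isolated vertices *)

Section Acyclicity.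
Variable K : fieldType.
Hypothesis charK : [pchar K] =i pred0.

Lemma sum_valence v e (g : lgraph v e) : (\sum_x valence g x = e * 2)%N.
Proof.
under eq_bigr => x _ do rewrite valence_half.
rewrite exchange_big /= (eq_bigr (fun=> 1)%N) => [|h _]; last first.
  by rewrite (bigD1 (g h)) //= eqxx big1 // => x /negPf; rewrite eq_sym => ->.
by rewrite sum1_card card_prod card_ord card_bool.
Qed.

Lemma min_valence_bound v e i (g : lgraph v e) : min_valence i g -> (v * i <= e * 2)%N.
Proof.
move=> /forallP gi; rewrite -(sum_valence g) -[X in (X * _ <= _)%N]card_ord -sum_nat_const.
exact: leq_sum.
Qed.

Lemma coinv_ge_eq0 v e i (X : coinv K v e) :
  (e * 2 < v * i)%N -> X \in coinv_ge i -> X = 0.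
Proof.
move=> small /coinv_geP; apply: gspan_pred0 => g; apply/negbTE/negP.
by move/min_valence_bound; rewrite leqNgt small.
Qed.

Lemma coinv1_eq0 e (X : coinv K 1 e.+1) : X = 0.
Proof.
have [c ->] := coinv_gclass X; rewrite big1 // => g.
by have := ends_neq g ord0; rewrite !ord1 eqxx.
Qed.

(** A primitive [Y0] among all graphs need not be free of isolated vertices. But deleting them from
    [Y0] gives a [nabla]-cocycle, whose primitive lifts along the surjection [rm_isolated];
    subtracting [nabla] of the lift moves [Y0] into the kernel. This goes down two degrees, hence
    [e.+2]. *)
Lemma nabla_exact v e (X : coinv K v.+1 e.+2) :
    X \in coinv_ge 1 -> nabla_coinv X = 0 ->
  exists2 Y : coinv K v.+1 e.+1, Y \in coinv_ge 1 & nabla_coinv Y = X.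
Proof.
case: v X => [|v] X X1 dX.
  by exists 0; rewrite ?rpred0 // linear0 [RHS]coinv1_eq0.
have N0 w : (w.+2 * (2 * w.+2.-1))%:R != 0 :> K by apply: natK_neq0.
have solve w f (Z : coinv K w.+2 f.+1) : nabla_coinv Z = 0 ->
    nabla_coinv ((w.+2 * (2 * w.+2.-1))%:R^-1 *: rm_edge Z) = Z.
  move=> dZ; rewrite linearZ_LR /=; have := rm_edge_nabla charK Z.
  by rewrite dZ linear0 add0r => ->; rewrite scalerA mulVf ?scale1r.
pose Y0 := (v.+2 * (2 * v.+2.-1))%:R^-1 *: rm_edge X.
have dY0 : nabla_coinv Y0 = X := solve v _ X dX.
have onto w (Z : coinv K w.+1 e.+1) : nabla_coinv Z = 0 -> exists Y, nabla_coinv Y = Z.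
  case: w Z => [|w] Z dZ; first by exists 0; rewrite linear0 [RHS]coinv1_eq0.
  by eexists; apply: solve.
have [Z dZ] : exists Z, nabla_coinv Z = rm_isolated Y0.
  by apply: onto; rewrite -rm_isolated_nabla // dY0 rm_isolated_ge1.
have [Z' Z'E] := rm_isolated_onto charK Z.
exists (Y0 - nabla_coinv Z'); last first.
  by rewrite linearB /= dY0 nabla_nabla // subr0.
apply: rm_isolated_ker => //.
by rewrite linearB /= rm_isolated_nabla // Z'E dZ subrr.
Qed.

Definition in_degree i N (c : fGC K) : Prop :=
  c \in fGC_ge K i /\ forall v e, e != N -> c v e = 0.

Lemma in_degreeB i N c c' : in_degree i N c -> in_degree i N c' -> in_degree i N (c - c').
Proof.
move=> [ci cN] [ci' cN']; split; first exact: rpredB.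
by move=> v e ne; rewrite -[LHS]/(c v e - c' v e) cN // cN' // subr0.
Qed.

Lemma in_degreeD i N c c' : in_degree i N c -> in_degree i N c' -> in_degree i N (c + c').
Proof.
move=> [ci cN] [ci' cN']; split; first exact: rpredD.
by move=> v e ne; rewrite -[LHS]/(c v e + c' v e) cN // cN' // addr0.
Qed.

Lemma in_degree_twisted i N c : (0 < i <= 2)%N ->
  in_degree i N c -> in_degree i N.+1 (twisted c).
Proof.
move=> i12 [ci cN]; split; first exact: twisted_ge.
move=> v e ne; rewrite -[LHS]/(delta c v e + nabla (eps c) v e).
case: e ne => [|e] ne; first by case: v => [|v]; rewrite addr0.
rewrite /nabla /eps cN // scaler0 linear0 addr0.
by case: v => [//|v]; rewrite /delta cN // linear0.
Qed.

(** On the component with fewest vertices the cocycle condition involves [nabla] alone, so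
    [nabla_exact] removes this component, at the expense of the next one through [delta]. At most
    twice as many vertices as edges occur; [k] counts the components still to be treated. *)
Lemma twisted_exact1 N c : in_degree 1 N.+2 c -> twisted c = 0 ->
  exists2 u, in_degree 1 N.+1 u & twisted u = c.
Proof.
pose fill v e (Z : coinv K v.+1 e.+2) : coinv K v.+1 e.+1 :=
  if pselect (exists2 Y : coinv K v.+1 e.+1, Y \in coinv_ge 1 & nabla_coinv Y = Z)
  is left H then s2val (cid2 H) else 0.
have fill_ge v e Z : fill v e Z \in coinv_ge 1.
  by rewrite /fill; case: pselect => [H|_]; rewrite ?rpred0 //; case: (cid2 H).
have fillE v e Z : Z \in coinv_ge 1 -> nabla_coinv Z = 0 -> nabla_coinv (fill v e Z) = Z.
  move=> Z1 dZ; rewrite /fill; case: pselect => [H|]; last by case; apply: nabla_exact.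
  by case: (cid2 H).
pose vanish k (c : fGC K) := forall v e, (v < k)%N -> c v e = 0 :> coinv K v.+1 e.
suff: forall k c, vanish (N.+2 * 2 - k)%N c -> in_degree 1 N.+2 c -> twisted c = 0 ->
    exists2 u, in_degree 1 N.+1 u & twisted u = c.
  move=> /(_ (N.+2 * 2)%N c); apply; by rewrite subnn.
elim=> [|k IH] {}c c_van cN dc.
  exists 0; first by split=> //; rewrite rpred0.
  rewrite linear0; apply: fGCP => v e; case: (ltnP v (N.+2 * 2)) => ve.
    by rewrite c_van // subn0.
  case: cN => /fGC_geP c1 cN; have [ee|ne] := eqVneq e N.+2; last by rewrite cN.
  by rewrite [RHS](coinv_ge_eq0 (i := 1)) // ee muln1.
have [kN|kN] := leqP (N.+2 * 2) k.
  by apply: IH => //; rewrite (eqP kN); move: c_van; rewrite subnS (eqP kN).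
set m := (N.+2 * 2 - k.+1)%N in c_van; have mE : (N.+2 * 2 - k = m.+1)%N by rewrite /m; lia.
(* The sign cancels that of [eps], so that [nabla (eps u)] is precisely the component [c m N.+2]. *)
pose u : fGC K := fun v e =>
  match e with
  | f.+1 => if (v == m) && (f == N) then (-1) ^+ (v + f.+1) *: fill v f (c v f.+2) else 0
  | 0 => 0
  end.
have uN : in_degree 1 N.+1 u.
  split; first by apply/fGC_geP => v [|e]; rewrite /u ?rpred0 //; case: ifP => _;
    rewrite ?rpred0 // rpredZ // fill_ge.
  by move=> v [|e] //; rewrite eqSS /u => /negPf->; rewrite andbF.
have [c1 cE] := cN; move/fGC_geP: c1 => c1.
have dcm : nabla_coinv (c m N.+2) = 0.
  have /(congr1 (fun c => c m N.+3)) := dc.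
  rewrite -[LHS]/(delta c m N.+3 + nabla_coinv ((-1) ^+ (m + N.+2) *: c m N.+2)).
  have -> : delta c m N.+3 = 0.
    by case: (m) c_van => [//|w] c_van; rewrite /delta c_van // linear0.
  rewrite add0r linearZ_LR => /eqP; rewrite scaler_eq0 signr_eq0 /= => /eqP.
  exact.
have du : vanish m.+1 (c - twisted u).
  move=> v e vm; rewrite -[LHS]/(c v e - (delta u v e + nabla (eps u) v e)).
  have -> : delta u v e = 0.
    case: v e vm => [|v] [|e] //; rewrite /delta /u ltnS => vm.
    case: e => [|e]; rewrite ?linear0 //.
    by rewrite (ltn_eqF vm) linear0.
  rewrite add0r; have [vltm|vgem] := ltnP v m.
    rewrite c_van // sub0r; case: e => [|[|e]]; rewrite /nabla ?oppr0 //.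
      by rewrite /eps /u scaler0 linear0 oppr0.
    by rewrite /eps /u (ltn_eqF vltm) /= scaler0 linear0 oppr0.
  have {vm vgem} -> : v = m by apply/eqP; rewrite eqn_leq -ltnS vm vgem.
  have [->|ne] := eqVneq e N.+2.
    rewrite /nabla /eps /u !eqxx /= scalerA -expr2 sqrr_sign scale1r.
    by rewrite fillE // subrr.
  rewrite cE // sub0r; case: e ne => [|[|e]]; rewrite /nabla ?oppr0 //.
    by rewrite /eps /u scaler0 linear0 oppr0.
  rewrite !eqSS /eps /u => /negPf->; rewrite andbF.
  by rewrite scaler0 linear0 oppr0.
have [|||w wN wE] := IH (c - twisted u).
- by rewrite mE.
- by apply: in_degreeB => //; apply: in_degree_twisted.
- by rewrite linearB dc twisted_twisted // subr0.
exists (w + u); first exact: in_degreeD.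
by rewrite linearD wE subrK.
Qed.

End Acyclicity.

(** * From valence at least 1 to valence at least 2 *)

Section LeafReduction.
Variable K : fieldType.
Hypothesis charK : [pchar K] =i pred0.

Lemma gspan_linear v e v' e' (P : pred (lgraph v e)) (Q : pred (lgraph v' e'))
    (f : coinv K v e -> coinv K v' e') X : linear f ->
  (forall g, P g -> gspan Q (f (gclass K g))) -> gspan P X -> gspan Q (f X).
Proof.
move=> lin_f.
pose fL : {linear coinv K v e -> coinv K v' e'} :=
  HB.pack f (GRing.isLinear.Build K _ _ _ f lin_f).
exact: (gspan_map (f := fL)).
Qed.

Lemma rm_leaf_ge2 v e (X : coinv K v.+1 e.+1) : X \in coinv_ge 2 -> rm_leaf X = 0.
Proof.
move=> /coinv_geP gX; apply: (@gspan_pred0 K _ _ xpred0) => //; move: gX.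
apply: (gspan_map (f := @rm_leaf K v e)) => g /forallP g2.
rewrite /= -wedge_gform rm_leaf_wedge // big1 => [|x _]; first exact: gspan0.
rewrite /cut big1 // => k _.
have := g2 x; rewrite valence_edges (bigD1_ord k) //=.
have [->|] := eqVneq (\sum_(i < e) ((g (lift k i, false) == x) ||
    (g (lift k i, true) == x)))%N 0%N; first by rewrite addn0; case: (_ || _).
rewrite sum_nat_eq0 => /forallPn[j]; rewrite eqb0 negbK => tx _.
have [i gi] : exists i, g (lift k j, i) = x.
  by case/orP: tx => /eqP; [exists false | exists true].
rewrite (@wedge_zero _ _ _ _ j) ?scaler0 // => a b _.
exact: (res_gform0 _ _ _ (h := (lift k j, i))).
Qed.

Lemma fleaf_ge2 (c : fGC K) : c \in fGC_ge K 2 -> fleaf c = 0.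
Proof. by move=> /fGC_geP c2; apply: fGCP => v e; apply: rm_leaf_ge2. Qed.

Definition leaf_laplacian v e (X : coinv K v.+1 e.+1) : coinv K v.+1 e.+1 :=
  rm_leaf (delta_coinv X) + delta_coinv (rm_leaf X).

Lemma leaf_laplacian_linear v e : linear (@leaf_laplacian v e).
Proof.
pose f : {linear coinv K v.+1 e.+1 -> coinv K v.+1 e.+1} :=
  (@rm_leaf K v.+1 e.+1 \o @delta_coinv K v.+1 e.+1) \+
  (@delta_coinv K v e \o @rm_leaf K v e).
exact: (linearP f).
Qed.

Lemma leaf_laplacian_gclass v e (g : lgraph v.+1 e.+1) : min_valence 1 g ->
  leaf_laplacian (gclass K g) = - leaf_split (gform K g).
Proof.
move=> g1; rewrite /leaf_laplacian -wedge_gform rm_leaf_delta // wedge_gform.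
rewrite [rm_isolated _]rm_isolated_ge1 ?linear0 ?oppr0 ?add0r //.
exact/coinv_geP/gspan_gclass.
Qed.

(** The signs of [eps] make the [nabla] part the anticommutator of [rm_leaf_nabla], a multiple of
    [rm_isolated], which vanishes in the absence of isolated vertices. *)
Lemma leaf_laplacianE (c : fGC K) v e : c \in fGC_ge K 1 ->
  (twisted (fleaf c) + fleaf (twisted c)) v e.+1 = leaf_laplacian (c v e.+1).
Proof.
move=> /fGC_geP c1.
rewrite -[LHS]/((delta (fleaf c) v e.+1 + nabla (eps (fleaf c)) v e.+1) +
   rm_leaf (delta_coinv (c v e.+1) + nabla_coinv (eps c v.+1 e.+1))).
rewrite linearD /= addrC addrACA -[RHS]addr0; congr (_ + _).
  by congr (_ + _); case: v c1 => [|v] c1 //; rewrite [RHS]delta_coinv0.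
rewrite /nabla /eps /fleaf !linearZ_LR /= addSn addnS !exprS !mulN1r opprK -scalerDr.
by rewrite rm_leaf_nabla // rm_isolated_ge1 ?scaler0.
Qed.

Section FixedDegree.
Variable N : nat.

(** The lexicographic order on the pair of the number of leaves and the weight: lower terms in the
    triangular form have fewer leaves but possibly larger weight. *)
Let below v n m : pred (lgraph v.+1 N.+1) := fun g => min_valence 1 g &&
  ((leaves g < n) || (leaves g == n) && (weight g < m))%N.

Let bounded n m (u : fGC K) : Prop :=
  (forall v, gspan (below n m) (u v N.+1)) /\
  (forall v e, e != N.+1 -> u v e = 0).

Let bounded_ge n m u : bounded n m u -> u \in fGC_ge K 1.
Proof.
move=> [us u0]; apply/fGC_geP => v e; have [->|ne] := eqVneq e N.+1.
  by apply/coinv_geP; apply: gspan_sub (us v) => g /andP[].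
by rewrite u0 // rpred0.
Qed.

Let bounded_sub n m n' m' u :
  (forall v (g : lgraph v.+1 N.+1), below n m g -> below n' m' g) ->
  bounded n m u -> bounded n' m' u.
Proof. by move=> sub [us u0]; split=> // v; apply: gspan_sub (us v); apply: sub. Qed.

(* Replacing [u] by [u - (2 / m) M u], where [M] is minus the graded commutator
   of [twisted] and [fleaf], removes the graphs of weight [m]. *)
Let bounded_step n m u : (0 < n)%N -> fleaf (twisted u) = 0 ->
  bounded n m.+1 u -> exists2 u', bounded n m u' & twisted u' = twisted u.
Proof.
move=> n0 fz bu; have u1 := bounded_ge bu.
(* For [m = 0] there is nothing to remove, since a graph with [n > 0] leaves has positive weight. *)
case: m bu => [|m] bu.
  exists u => //; apply: bounded_sub bu => v g /andP[g1 /orP[ltn|/andP[/eqP gn gw]]].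
    by rewrite /below g1 ltn.
  have := weight_gt0 (g := g); rewrite gn => /(_ n0); move: gw.
  by case: weight.
have [us u0] := bu; pose a : K := 2%:R / m.+1%:R.
pose Mu := twisted (fleaf u) + fleaf (twisted u).
(* [twisted Mu] vanishes because [twisted] squares to zero and [fleaf (twisted u) = 0]. *)
exists (u + a *: Mu); last first.
  rewrite linearD linearZ_LR (_ : twisted Mu = 0) ?scaler0 ?addr0 //.
  by rewrite linearD twisted_twisted // add0r fz linear0.
split=> [v|v e ne]; last first.
  rewrite -[LHS]/(u v e + a *: (twisted (fleaf u) v e + fleaf (twisted u) v e)).
  rewrite u0 // fz addr0 add0r.
  have fu0 w f : f != N -> fleaf u w f = 0.
    by move=> nf; rewrite /fleaf u0 ?linear0 // eqSS.
  rewrite -[twisted _ v e]/(delta (fleaf u) v e + nabla (eps (fleaf u)) v e).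
  case: e ne => [|e] ne; first by case: (v) => [|w]; rewrite addr0 scaler0.
  rewrite /nabla /eps fu0 // scaler0 linear0 addr0.
  by case: (v) => [|w]; rewrite ?scaler0 // /delta fu0 // linear0 scaler0.
rewrite -[X in gspan _ X]/(u v N.+1 + a *: Mu v N.+1) /Mu leaf_laplacianE //.
move: (us v); apply: (@gspan_linear _ _ _ _ _ _ (fun X => X + a *: leaf_laplacian X)).
  move=> b X Y; rewrite leaf_laplacian_linear scalerDr !scalerA mulrC -scalerA.
  by rewrite addrACA -scalerDr.
move=> g /andP[g1 gb]; rewrite leaf_laplacian_gclass //.
have [Y PY ->] := leaf_split_triangular charK g1.
have lower : gspan (below n m.+1) Y.
  apply: gspan_sub PY => g' /andP[g'1 lt]; rewrite /below g'1 /=.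
  apply/orP; left; apply: leq_trans lt _.
  by case/orP: gb => [/ltnW//|/andP[/eqP-> _]].
rewrite opprD scalerDr addrA; apply: gspanD; last first.
  by rewrite scalerN -scaleNr; apply: gspanZ.
rewrite scalerN scalerA -scaleNr -[X in X + _]scale1r -scalerDl.
case/orP: gb => [lt|/andP[/eqP gn]]; first by apply/gspanZ/gspan_gclass; rewrite /below g1 lt.
rewrite ltnS leq_eqVlt => /orP[/eqP->|lt]; last first.
  by apply/gspanZ/gspan_gclass; rewrite /below g1 gn eqxx lt orbT.
rewrite /a mulrA mulfVK ?natK_neq0 // divff ?natK_neq0 // subrr scale0r.
exact: gspan0.
Qed.

(** The number of vertices is at most twice the number of edges, so finitely many graphs occur and
    one number of steps serves all components of the product. *)
Let weight_bound : exists m, forall v (g : lgraph v.+1 N.+1),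
  min_valence 1 g -> (weight g < m)%N.
Proof.
exists (\sum_(v < N.+1 * 2) \sum_(g : lgraph v.+1 N.+1) weight g).+1%N => v g g1.
rewrite ltnS; have vN : (v < N.+1 * 2)%N by have := min_valence_bound g1; rewrite muln1.
rewrite (bigD1 (Ordinal vN)) //= (bigD1 g) //= -addnA; exact: leq_addr.
Qed.

Lemma leaf_reduction (u : fGC K) : in_degree 1 N.+1 u -> fleaf (twisted u) = 0 ->
  exists2 u', in_degree 2 N.+1 u' & twisted u' = twisted u.
Proof.
move=> [/fGC_geP u1 u0] fz; have [M wM] := weight_bound.
have drop_m n m (w : fGC K) : (0 < n)%N -> fleaf (twisted w) = 0 -> bounded n m w ->
    exists2 w', bounded n 0 w' & twisted w' = twisted w.
  move=> n0; elim: m w => [|m IH] w fw bw; first by exists w.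
  have [w1 bw1 dw1] := bounded_step n0 fw bw.
  by have [|w2 bw2 dw2] := IH w1 _ bw1; [rewrite dw1 | exists w2; rewrite ?dw2].
have drop_n n (w : fGC K) : fleaf (twisted w) = 0 -> bounded n.+1 0 w ->
    exists2 w', bounded 1 0 w' & twisted w' = twisted w.
  elim: n w => [|n IH] w fw bw; first by exists w.
  have [|w1 bw1 dw1] := @drop_m n.+1 M w isT fw.
    (* As [M] exceeds all weights, having fewer than [n.+2] leaves is the same as lying below
       [(n.+1, M)]. *)
    apply: bounded_sub bw => v g /andP[g1]; rewrite ltn0 andbF orbF ltnS leq_eqVlt.
    by rewrite /below g1 wM // andbT orbC.
  by have [|w2 bw2 dw2] := IH w1 _ bw1; [rewrite dw1 | exists w2; rewrite ?dw2].
have [|u' [us' u0'] du'] := @drop_n (N.+1 * 2)%N u fz.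
  split=> // v; have /coinv_geP := u1 v N.+1; apply: gspan_sub => g g1.
  rewrite /below g1 ltnS /leaves; apply/orP; left.
  apply: leq_trans (max_card _) _; rewrite card_ord -[v.+1]muln1.
  exact: min_valence_bound g1.
exists u' => //; split=> //; apply/fGC_geP => v e.
have [->|ne] := eqVneq e N.+1; last by rewrite u0' // rpred0.
apply/coinv_geP; apply: gspan_sub (us' v) => g /andP[/forallP g1].
rewrite ltn0 andbF orbF ltnS leqn0 cards_eq0 => /eqP g0; apply/forallP => x.
rewrite ltn_neqAle g1 andbT; apply/negP => /eqP gx.
by have := in_set0 x; rewrite -g0 inE -gx.
Qed.

End FixedDegree.

Lemma twisted_exact2 N (c : fGC K) : in_degree 2 N c -> twisted c = 0 ->
  exists2 u, in_degree 2 N.-1 u & twisted u = c.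
Proof.
(* Degrees 0 and 1 contain no graph of valence at least 2. *)
case: N => [|[|N]] cN dc.
- exists 0; first by split=> //; rewrite rpred0.
  rewrite linear0; case: cN => /fGC_geP c2 cN; apply: fGCP => v e.
  have [->|ne] := eqVneq e 0%N; last by rewrite cN.
  by rewrite [RHS](coinv_ge_eq0 (i := 2)).
- exists 0; first by split=> //; rewrite rpred0.
  rewrite linear0; case: cN => /fGC_geP c2 cN; apply: fGCP => v e.
  have [->|ne] := eqVneq e 1%N; last by rewrite cN.
  case: v => [|v]; first by rewrite [RHS]coinv1_eq0.
  by rewrite [RHS](coinv_ge_eq0 (i := 2)).
have c1 : in_degree 1 N.+2 c.
  have [/fGC_geP c2 cN'] := cN; split=> //; apply/fGC_geP => v e.
  apply/coinv_geP; have /coinv_geP := c2 v e; apply: gspan_sub => g /forallP g2.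
  by apply/forallP => x; apply: ltnW.
have [u uN du] := twisted_exact1 charK c1 dc.
have [|u' uN' du'] := leaf_reduction uN; last by exists u'; rewrite ?du'.
by rewrite du fleaf_ge2 //; case: cN.
Qed.

Lemma tdelta_exact N (c : fGC K) : in_degree 2 N c -> tdelta c = 0 ->
  exists2 u, in_degree 2 N.-1 u & tdelta u = c.
Proof.
have conjN n (x : fGC K) : in_degree 2 n x -> in_degree 2 n (Dop (eps x)).
  move=> [x2 xn]; split; first by rewrite fD_ge // eps_ge.
  by move=> v e ne; rewrite /Dop /eps xn // scaler0 linear0.
move=> cN dc; have [c2 _] := cN.
have dc' : twisted (conj_from c) = 0.
  have c'2 := conj_from_ge c2; rewrite -(conj_toK charK (twisted_ge charK _ c'2)) //.
  by rewrite -tdelta_conj // conj_fromK // dc /conj_from !linear0 addr0.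
have [|u uN du] := @twisted_exact2 N _ _ dc'; first exact/in_degreeD/conjN.
have [u2 _] := uN; exists (conj_to u); first exact/in_degreeB/conjN.
by rewrite tdelta_conj // du conj_fromK.
Qed.

End LeafReduction.

(* An abstract [submodClosed] is not inferred to be closed under opposites. *)
Lemma submodN (K : fieldType) (V : lmodType K) (U : submodClosed V) x :
  x \in U -> - x \in U.
Proof. by move=> Ux; rewrite -scaleN1r rpredZ. Qed.

Lemma submodB (K : fieldType) (V : lmodType K) (U : submodClosed V) x y :
  x \in U -> y \in U -> x - y \in U.
Proof. by move=> Ux Uy; rewrite rpredD // submodN. Qed.

(** * Isomorphisms of subquotients *)

Section Subquotients.
Variables (K : fieldType) (V W : lmodType K).
Variables (Z B : submodClosed V) (Z' B' : submodClosed W).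

Lemma sqclass_eq0 x : x \in Z -> reflect (sqclass Z B x = 0) (x \in B).
Proof.
move=> Zx; rewrite -[X in X \in B]subr0 -(sqclass0 Z B).
by apply: sqclassP => //; apply: rpred0.
Qed.

(** Linearity is asked on [Z] only, because class maps such as [page_class] send everything outside
    their domain to 0. *)
Lemma induced_isoP (f : V -> W) :
    (forall a x y, x \in Z -> y \in Z -> f (a *: x + y) = a *: f x + f y) ->
    {in Z, forall x, f x \in Z'} ->
    {in Z, forall x, (f x \in B') = (x \in B)} ->
    (forall y, y \in Z' -> exists2 x, x \in Z & y - f x \in B') ->
  induced_iso f Z B Z' B'.
Proof.
move=> f_lin fZ fB f_onto.
pose phi (X : subquot Z B) : subquot Z' B' := sqclass Z' B' (f (\val (repr X))).
have fD x y : x \in Z -> y \in Z -> f (x - y) = f x - f y.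
  by move=> Zx Zy; rewrite addrC -scaleN1r f_lin // scaleN1r addrC.
have phiE x : x \in Z -> phi (sqclass Z B x) = sqclass Z' B' (f x).
  move=> Zx; rewrite /phi; set y := \val _; have Zy : y \in Z by exact: valP.
  apply/(sqclassP _ (fZ _ Zy) (fZ _ Zx)); rewrite -fD // fB; last exact: submodB.
  apply/(sqclassP _ Zy Zx); rewrite {1}/sqclass /y valKd; exact: lproj_repr.
have phi_lin : linear phi.
  move=> a X Y; have [x Zx ->] := sqclass_surj X; have [y Zy ->] := sqclass_surj Y.
  rewrite -sqclass_linear // !phiE ?rpredD ?rpredZ // f_lin //.
  by rewrite sqclass_linear ?fZ.
have phi_inj : injective phi.
  move=> X Y; have [x Zx ->] := sqclass_surj X; have [y Zy ->] := sqclass_surj Y.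
  rewrite !phiE // => /(sqclassP _ (fZ _ Zx) (fZ _ Zy)).
  by rewrite -fD // fB; [move/(sqclassP _ Zx Zy) | exact: submodB].
have phi_onto Y : exists X, phi X = Y.
  have [y Zy ->] := sqclass_surj Y; have [x Zx yx] := f_onto y Zy.
  by exists (sqclass Z B x); rewrite phiE //; apply/esym/sqclassP; rewrite ?fZ.
pose psi Y := sval (cid (phi_onto Y)).
have psiK : cancel psi phi by move=> Y; exact: svalP (cid (phi_onto Y)).
pose phiL : {linear subquot Z B -> subquot Z' B'} :=
  HB.pack phi (GRing.isLinear.Build K (subquot Z B) (subquot Z' B') _ phi phi_lin).
exists phiL.
  by exists psi => // X; apply: phi_inj; rewrite psiK.
by move=> x Zx; split; [apply: fZ | apply: phiE].
Qed.

End Subquotients.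

(** * The spectral sequence of a filtered complex, and convergence in the acyclic case *)

Section FilteredComplex.
Variables (K : fieldType) (V : lmodType K) (d : {linear V -> V}).
Variables (A F : int -> submodClosed V) (fc : filtered_complex d A F).

Lemma page_cycleP p b n x :
  reflect [/\ x \in A n, x \in F b & d x \in F (b + p)] (x \in page_cycle d A F p b n).
Proof. exact: and3P. Qed.

Lemma page_boundP p b n x :
  reflect (exists y z, [/\ y \in page_cycle d A F (p - 1) (b + 1) n,
      z \in page_cycle d A F (p - 1) (b - p + 1) (n - 1) & x = y + d z])
    (x \in page_bound d A F p b n).
Proof. exact: asboolP. Qed.

Lemma page_class_eq0 r b n x : x \in page_cycle d A F r%:Z b n ->
  reflect (page_class d A F r b n x = 0) (x \in page_bound d A F r%:Z b n).
Proof. exact: sqclass_eq0. Qed.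

Lemma page_surj r b n (X : page d A F r b n) :
  exists2 x, x \in page_cycle d A F r%:Z b n & X = page_class d A F r b n x.
Proof. exact: sqclass_surj. Qed.

Lemma page_diff_diff r b n b' n' b'' n'' (Hb : b' = b + r%:Z) (Hn : n' = n + 1)
    (Hb' : b'' = b' + r%:Z) (Hn' : n'' = n' + 1) (X : page d A F r b n) :
  page_diff fc Hb' Hn' (page_diff fc Hb Hn X) = 0.
Proof.
have [x Zx ->] := page_surj X; rewrite (page_diff_class fc Hb Hn Zx).
rewrite (page_diff_class fc Hb' Hn' (page_cycle_diff fc Hb Hn Zx)).
by have /page_cycleP[Ax _ _] := Zx; rewrite (fc_square fc Ax) [LHS]sqclass0.
Qed.

Lemma page_cycleS p b n x :
  x \in page_cycle d A F (p + 1) b n -> x \in page_cycle d A F p b n.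
Proof.
move=> /page_cycleP[Ax Fx Fdx]; apply/page_cycleP; split=> //.
by apply: (fc_decreasing fc); rewrite -addrA.
Qed.

Lemma page_next r b n :
  induced_iso (page_class d A F r b n)
    (page_cycle d A F r.+1%:Z b n) (page_bound d A F r.+1%:Z b n)
    (ker_in (full (page d A F r b n))
      (page_diff fc (erefl (b + r%:Z)) (erefl (n + 1))))
    (im_of (full (page d A F r (b - r%:Z) (n - 1)))
      (page_diff fc (esym (subrK r%:Z b)) (esym (subrK 1 n)))).
Proof.
have rS : r.+1%:Z = r%:Z + 1 by rewrite -addn1 PoszD.
have rSK : r.+1%:Z - 1 = r%:Z by rewrite rS addrK.
have idx : b - r.+1%:Z + 1 = b - r%:Z by rewrite rS opprD addrA subrK.
have cycS x : x \in page_cycle d A F r.+1%:Z b n -> x \in page_cycle d A F r%:Z b n.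
  by rewrite rS; apply: page_cycleS.
apply: induced_isoP => [a x y Zx Zy|x Zx|x Zx|Y].
- by apply: sqclass_linear; apply: cycS.
- apply/andP; split=> //; apply/eqP.
  apply: etrans (page_diff_class fc erefl erefl (cycS _ Zx)) _.
  have /page_cycleP[Ax Fx Fdx] := Zx; apply/page_class_eq0.
    exact: (page_cycle_diff fc erefl erefl (cycS _ Zx)).
  apply/page_boundP; exists (d x), 0; rewrite rpred0 linear0 addr0; split=> //.
  apply/page_cycleP; rewrite (fc_degree fc) // (fc_square fc Ax) rpred0.
  by split=> //; move: Fdx; rewrite rS addrA.
- have /page_cycleP[Ax Fx Fdx] := Zx; apply/asboolP/page_boundP.
    case=> W _; have [w Zw ->] := page_surj W; move=> xw0.
    have xw := etrans xw0 (page_diff_class fc (esym (subrK r%:Z b)) (esym (subrK 1 n)) Zw).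
    have Zdw := page_cycle_diff fc (esym (subrK r%:Z b)) (esym (subrK 1 n)) Zw.
    have /page_boundP[y [z [Zy Zz yz]]] : x - d w \in page_bound d A F r%:Z b n.
      by apply/(sqclassP _ (cycS _ Zx) Zdw).
    exists y, (w + z); rewrite rSK; split.
    + have /page_cycleP[Ay Fy _] := Zy; apply/page_cycleP; split=> //.
      have /page_cycleP[Aw _ _] := Zw; have /page_cycleP[Az _ _] := Zz.
      have -> : d y = d x.
        have -> : y = x - d w - d z by rewrite yz addrK.
        by rewrite !linearB /= (fc_square fc Aw) (fc_square fc Az) !subr0.
      by move: Fdx; rewrite rS addrA addrAC.
    + rewrite idx; apply: rpredD => //.
      have /page_cycleP[Az Fz Fdz] := Zz; apply/page_cycleP; split=> //.
        exact: (fc_decreasing fc).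
      by move: Fdz; rewrite subrK addrACA addrN addr0 -addrA addNr addr0.
    by rewrite linearD addrCA -yz addrC subrK.
  rewrite rSK idx => -[y [z [Zy Zz xyz]]].
  exists (page_class d A F r (b - r%:Z) (n - 1) z) => //.
  apply: etrans (esym (page_diff_class fc (esym (subrK r%:Z b)) (esym (subrK 1 n)) Zz)).
  have Zdz := page_cycle_diff fc (esym (subrK r%:Z b)) (esym (subrK 1 n)) Zz.
  apply/(sqclassP _ (cycS _ Zx) Zdz); rewrite xyz addrK.
  apply/page_boundP; exists y, 0; rewrite rpred0 linear0 addr0; split=> //.
  by apply: page_cycleS; rewrite subrK.
have [x Zx ->] := page_surj Y => /andP[_ /eqP Y0].
have := etrans (esym (page_diff_class fc erefl erefl Zx)) Y0.
have Zdx := page_cycle_diff fc (erefl (b + r%:Z)) (erefl (n + 1)) Zx.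
move=> /(page_class_eq0 Zdx)/page_boundP[y [z [Zy Zz dx]]].
move: Zz; rewrite !addrK => Zz.
have /page_cycleP[Ax Fx _] := Zx; have /page_cycleP[Az Fz _] := Zz.
(* [z] has filtration [b + 1], so that [x - z] has the class of [x], while its image under [d] is
   [y], one step deeper than [b + r]. *)
have Zxz : x - z \in page_cycle d A F r.+1%:Z b n.
  apply/page_cycleP; split; rewrite ?submodB //; first exact: (fc_decreasing fc).
  have /page_cycleP[_ Fy _] := Zy; rewrite linearB dx /= addrK.
  by move: Fy; rewrite rS addrA.
exists (x - z) => //.
suff -> : page_class d A F r b n (x - z) = page_class d A F r b n x by rewrite subrr rpred0.
apply/(sqclassP _ (cycS _ Zxz) Zx); rewrite addrAC subrr add0r submodN //.
apply/page_boundP; exists z, 0; rewrite rpred0 linear0 addr0; split=> //.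
Qed.

Lemma filtered_spectral_sequence : spectral_sequence fc.
Proof.
by split=> [*|*]; [apply: page_diff_diff | apply: page_next].
Qed.

(* Both sides of the isomorphism required by [converges] vanish. *)
Lemma acyclic_converges :
    (forall n x, x \in A n -> d x = 0 -> exists2 y, y \in A (n - 1) & d y = x) ->
    (forall n, exists lo, {subset A n <= F lo}) ->
    (forall n, exists hi, forall x, x \in A n -> x \in F hi -> x = 0) ->
  (forall n (X : coh d A n), X = 0) /\ converges d A F.
Proof.
move=> exact_d lowA highA.
have coh0 n (X : coh d A n) : X = 0.
  have [x + ->] := sqclass_surj X; move=> Zx; have /andP[Ax /eqP dx] := Zx.
  apply/sqclass_eq0 => //; have [y Ay dy] := exact_d n x Ax dx.
  by apply/asboolP; exists y.
have F_le b k x : x \in F (b + k%:Z) -> x \in F b.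
  elim: k => [|k IH]; first by rewrite addr0.
  rewrite -addn1 PoszD addrA => /(fc_decreasing fc); exact: IH.
split=> // n; split.
- by exists 0 => X; rewrite (coh0 n X) rpred0.
- by exists 0 => X _; apply: coh0.
move=> b; have [lo lowF] := lowA (n - 1); have [hi highF] := highA (n + 1).
(* From this page on, [d] of a page cycle lies in [F hi], hence vanishes, and every element of
   degree [n - 1] has filtration at least [b - r + 1], so that primitives are admissible in page
   boundaries. *)
exists (absz (hi - b)%R + absz (b + 1 - lo)%R)%N => r r0.
have page0 (X : page d A F r b n) : X = 0.
  have [x Zx ->] := page_surj X; have /page_cycleP[Ax Fx Fdx] := Zx.
  have dx : d x = 0.
    apply: highF; first exact: (fc_degree fc).
    have [k kE] : exists k : nat, b + r%:Z = hi + k%:Z.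
      by exists (absz (b + r%:Z - hi)%R); lia.
    by move: Fdx; rewrite kE; apply: F_le.
  have [y Ay dy] := exact_d n x Ax dx.
  apply/sqclass_eq0 => //; apply/page_boundP; exists 0, y.
  rewrite rpred0 add0r dy; split=> //; apply/page_cycleP; rewrite dy; split=> //.
    have [k kE] : exists k : nat, lo = b - r%:Z + 1 + k%:Z.
      by exists (absz (lo - (b - r%:Z + 1))%R); lia.
    by have := lowF y Ay; rewrite kE; apply: F_le.
  by have -> : b - r%:Z + 1 + (r%:Z - 1) = b by lia.
pose S := subquot (@coh_filt K V d A F n b) (@coh_filt K V d A F n (b + 1)).
have S0 (X : S) : X = 0.
  have [x Zx ->] := sqclass_surj X; apply/sqclass_eq0 => //.
  by rewrite (coh0 n x) rpred0.
pose phi (X : S) : page d A F r b n := 0.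
have phi_lin : linear phi by move=> a X Y; rewrite /phi scaler0 addr0.
pose phiL : {linear S -> page d A F r b n} :=
  HB.pack phi (GRing.isLinear.Build K S (page d A F r b n) _ phi phi_lin).
exists phiL.
  by exists (fun=> 0) => X; rewrite ?(S0 X) // [RHS]page0.
by move=> x _ _; rewrite [RHS]page0.
Qed.

End FilteredComplex.

(** * The filtration of the graph complex by $e - v$ *)

Section Supports.
Variable K : fieldType.
Hypothesis charK : [pchar K] =i pred0.
Implicit Types (c : fGC K) (P Q R : nat -> nat -> bool).

Lemma suppP P c :
  reflect (forall v e, ~~ P v.+1 e -> c v e = 0) (c \in @fGC_supp K P).
Proof. exact: asboolP. Qed.

Lemma supp_sub P Q c : (forall v e, P v e -> Q v e) ->
  c \in @fGC_supp K P -> c \in @fGC_supp K Q.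
Proof.
move=> PQ /suppP cP; apply/suppP => v e nQ; apply: cP.
by apply: contra nQ; apply: PQ.
Qed.

Lemma supp_delta P Q c : (forall v e, P v e -> Q v.+1 e.+1) ->
  c \in @fGC_supp K P -> delta c \in @fGC_supp K Q.
Proof.
move=> PQ /suppP cP; apply/suppP => -[|v] [|e] // nQ.
by rewrite /delta cP ?linear0 //; apply: contra nQ; apply: PQ.
Qed.

Lemma supp_D_nabla P Q c : (forall v e, P v.+1 e -> Q v e.+1) ->
  c \in @fGC_supp K P -> Dop (nabla c) \in @fGC_supp K Q.
Proof.
move=> PQ /suppP cP; apply/suppP => v [|e] nQ; rewrite /Dop /nabla ?linear0 //.
by rewrite cP ?linear0 //; apply: contra nQ; apply: PQ.
Qed.

Lemma supp_tdelta P Q c : (forall v e, P v e -> Q v.+1 e.+1) ->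
  (forall v e, P v.+1 e -> Q v e.+1) ->
  c \in @fGC_supp K P -> tdelta c \in @fGC_supp K Q.
Proof.
by move=> PQ PQ' cP; rewrite tdeltaE rpredD ?(supp_delta PQ) ?(supp_D_nabla PQ').
Qed.

Lemma supp_disjoint P Q c : (forall v e, P v e -> Q v e -> false) ->
  c \in @fGC_supp K P -> c \in @fGC_supp K Q -> c = 0.
Proof.
move=> PQ /suppP cP /suppP cQ; apply: fGCP => v e.
have [Pv|] := boolP (P v.+1 e); last exact: cP.
by apply: cQ; apply/negP => /(PQ _ _ Pv).
Qed.

Definition psel P c : fGC K := fun v e => if P v.+1 e then c v e else 0.

Lemma psel_supp P c : psel P c \in @fGC_supp K P.
Proof. by apply/suppP => v e /negPf nP; rewrite /psel nP. Qed.

Lemma psel_sub P Q c : c \in @fGC_supp K Q -> psel P c \in @fGC_supp K Q.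
Proof. by move=> /suppP cQ; apply/suppP => v e /cQ c0; rewrite /psel c0 if_same. Qed.

Lemma psel_ge P i c : c \in fGC_ge K i -> psel P c \in fGC_ge K i.
Proof.
move=> /fGC_geP ci; apply/fGC_geP => v e; rewrite /psel; case: ifP => // _.
by rewrite rpred0.
Qed.

Lemma psel_compl P Q R c : (forall v e, Q v e -> ~~ P v e -> R v e) ->
  c \in @fGC_supp K Q -> c - psel P c \in @fGC_supp K R.
Proof.
move=> QR /suppP cQ; apply/suppP => v e nR.
rewrite -[LHS]/(c v e - psel P c v e) /psel; case: ifP => [_|/negbT nP].
  by rewrite subrr.
by rewrite subr0 cQ //; apply: contra nR => /QR; apply.
Qed.

Lemma degreeP i n c : reflect (c \in fGC_ge K i /\
  c \in @fGC_supp K (fun v e => e%:Z == n)) (c \in fGC_degree K i n).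
Proof. exact: andP. Qed.

Lemma partP i b n c : reflect (c \in fGC_degree K i n /\
  c \in @fGC_supp K (fun v e => e%:Z - v%:Z == b)) (c \in fGC_part K i b n).
Proof. exact: andP. Qed.

Lemma in_degreeP i N c : in_degree i N c <-> c \in fGC_degree K i N%:Z.
Proof.
split=> [[ci cN]|/degreeP[ci /suppP cN]].
  by apply/degreeP; split=> //; apply/suppP => v e; apply: cN.
by split=> // v e ne; apply: cN; apply: contra ne.
Qed.

Lemma psel_degree P i n c : c \in fGC_degree K i n -> psel P c \in fGC_degree K i n.
Proof. by move=> /degreeP[ci cn]; apply/degreeP; rewrite psel_ge // psel_sub. Qed.

Lemma tdelta_degree n c : c \in fGC_degree K 2 n -> tdelta c \in fGC_degree K 2 (n + 1).
Proof.
move=> /degreeP[c2 cn]; apply/degreeP; split; first exact: tdelta_ge.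
by apply: supp_tdelta cn => v e /eqP<-; apply/eqP; lia.
Qed.

Lemma tdelta_filt b c : c \in fGC_filt K b -> tdelta c \in fGC_filt K b.
Proof. by apply: supp_tdelta => v e; lia. Qed.

Lemma D_nabla_filt b c : c \in fGC_filt K b -> Dop (nabla c) \in fGC_filt K (b + 2).
Proof. by apply: supp_D_nabla => v e; lia. Qed.

Lemma filt_le b b' c : b <= b' -> c \in fGC_filt K b' -> c \in fGC_filt K b.
Proof. by move=> le_b; apply: supp_sub => v e; apply: le_trans. Qed.

Lemma graph_filtered_complex :
  filtered_complex tdelta (fGC_degree K 2) (fGC_filt K).
Proof.
split=> [n c|n c /degreeP[c2 _]|n b c _|b c].
- exact: tdelta_degree.
- exact: tdelta_tdelta.
- exact: tdelta_filt.
by apply: filt_le; lia.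
Qed.

(** Two half-edges at every vertex give $v \le e$. *)
Lemma degree_filt0 n c : c \in fGC_degree K 2 n -> c \in fGC_filt K 0.
Proof.
move=> /degreeP[/fGC_geP c2 _]; apply/suppP => v e neg.
by apply: (coinv_ge_eq0 (i := 2)) => //; lia.
Qed.

(** A graph has at least one vertex, so $e - v < e$. *)
Lemma degree_filt_large n c :
  c \in fGC_degree K 2 n -> c \in fGC_filt K (n + 1) -> c = 0.
Proof. by move=> /degreeP[_]; apply: supp_disjoint => v e; lia. Qed.

Lemma tdelta_exact_degree n c : c \in fGC_degree K 2 n -> tdelta c = 0 ->
  exists2 u, u \in fGC_degree K 2 (n - 1) & tdelta u = c.
Proof.
have zero : c = 0 -> exists2 u, u \in fGC_degree K 2 (n - 1) & tdelta u = c.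
  by move=> ->; exists 0; rewrite ?rpred0 ?linear0.
case: n zero => [[|N]|N] zero cn dc.
- apply: zero; apply: (degree_filt_large cn).
  have [/fGC_geP c2 cN] : in_degree 2 0 c by apply/in_degreeP.
  apply/suppP => v e _; have [->|ne] := eqVneq e 0%N; last exact: cN.
  exact: (coinv_ge_eq0 (i := 2)).
- have [|u /in_degreeP uN du] := @tdelta_exact _ charK N.+1 c _ dc; first exact/in_degreeP.
  by exists u => //; rewrite (_ : Posz N.+1 - 1 = N%:Z) //; lia.
by apply: zero; have /degreeP[_ /suppP c0] := cn; apply: fGCP => v e; apply: c0; lia.
Qed.

(** [tdelta] raises the number of edges by exactly one, so primitives of the components of a formal
    sum are found degree by degree and assembled in the product. *)
Lemma tdelta_acyclic (X : homology (fGC_ge K 2) tdelta (fGC_ge K 2) tdelta) : X = 0.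
Proof.
have [c Zc ->] := sqclass_surj X; have /andP[c2 /eqP dc] := Zc.
apply/sqclass_eq0 => //; apply/asboolP.
pose comp N := psel (fun v e => e == N) c.
have comp_N N : in_degree 2 N (comp N).
  split; first exact: psel_ge.
  by move=> v e /negPf ne; rewrite /comp /psel ne.
have tdelta_eq (x y : fGC K) e : (forall v, x v e = y v e) ->
    forall v, tdelta x v e.+1 = tdelta y v e.+1.
  move=> exy v.
  rewrite -[LHS]/(delta x v e.+1 + D_coinv (nabla_coinv (x v.+1 e))).
  rewrite -[RHS]/(delta y v e.+1 + D_coinv (nabla_coinv (y v.+1 e))) exy.
  by congr (_ + _); case: v => [//|v]; rewrite /delta exy.
have tdelta_0 (x : fGC K) v : tdelta x v 0%N = 0.
  rewrite -[LHS]/(delta x v 0%N + D_coinv 0) linear0 addr0.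
  by case: v.
have d_comp N : tdelta (comp N) = 0.
  apply: fGCP => v [|e]; first exact: tdelta_0.
  have [->|ne] := eqVneq N e.
    rewrite (@tdelta_eq _ c) => [|w]; first by rewrite dc.
    by rewrite /comp /psel eqxx.
  rewrite (@tdelta_eq _ 0) => [|w]; first by rewrite linear0.
  by rewrite /comp /psel eq_sym (negPf ne).
pose U N := sval (cid2 (tdelta_exact charK (comp_N N) (d_comp N))).
have U2 N : U N \in fGC_ge K 2 by rewrite /U; case: (cid2 _) => u /= [].
have dU N : tdelta (U N) = comp N by rewrite /U; case: (cid2 _).
exists (fun v e => U e.+1 v e).
  by apply/fGC_geP => v e; have /fGC_geP := U2 e.+1; apply.
apply: fGCP => v [|e].
  by rewrite tdelta_0; have /fGC_geP c2' := c2; apply: (coinv_ge_eq0 (i := 2)).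
rewrite (tdelta_eq _ (U e.+1)) // dU /comp /psel eqxx //.
Qed.

(** [D nabla] raises $e - v$ by 2, so modulo filtration [b + 1] only [delta] is left of [tdelta],
    and every class is represented by its component with $e - v = b$. *)
Lemma graph_first_page b n :
  induced_iso id
    (ker_in (fGC_part K 2 b n) delta)
    (im_of (fGC_part K 2 b (n - 1)) delta)
    (page_cycle tdelta (fGC_degree K 2) (fGC_filt K) 1%:Z b n)
    (page_bound tdelta (fGC_degree K 2) (fGC_filt K) 1%:Z b n).
Proof.
pose B : nat -> nat -> bool := fun v e => e%:Z - v%:Z == b.
have delta_B c : c \in @fGC_supp K B -> delta c \in @fGC_supp K B.
  by apply: supp_delta => v e; rewrite /B; lia.
have delta_F b' c : c \in fGC_filt K b' -> delta c \in fGC_filt K b'.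
  by apply: supp_delta => v e; lia.
have B_F c : c \in @fGC_supp K B -> c \in fGC_filt K b.
  by apply: supp_sub => v e; rewrite /B; lia.
have BF0 c : c \in @fGC_supp K B -> c \in fGC_filt K (b + 1) -> c = 0.
  by apply: supp_disjoint => v e; rewrite /B; lia.
have D_nabla_degree m c : c \in fGC_degree K 2 m -> Dop (nabla c) \in fGC_degree K 2 (m + 1).
  move=> /degreeP[c2 cm]; apply/degreeP; split; first by rewrite fD_ge // fnabla_ge.
  by apply: supp_D_nabla cm => v e /eqP<-; apply/eqP; lia.
have sel_F c : c \in fGC_filt K b -> c - psel B c \in fGC_filt K (b + 1).
  by apply: psel_compl => v e; rewrite /B; lia.
apply: induced_isoP => [//|c|c|c].
- move=> /andP[/partP[cn cb] /eqP dc]; apply/page_cycleP; split=> //; first exact: B_F.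
  rewrite tdeltaE dc add0r; apply: (@filt_le _ (b + 2)); first lia.
  exact/D_nabla_filt/B_F.
- move=> /andP[/partP[cn cb] /eqP dc]; apply/page_boundP/asboolP.
    rewrite subrr => -[y [z [/page_cycleP[yn yF _] /page_cycleP[zn zF _] cE]]].
    rewrite subrK in zF.
    exists (psel B z).
      by apply/partP; rewrite psel_degree // psel_supp.
    apply/eqP; rewrite -subr_eq0; apply/eqP/BF0.
      by apply: rpredB => //; apply/delta_B/psel_supp.
    have -> : c - delta (psel B z) = y + delta (z - psel B z) + Dop (nabla z).
      by rewrite cE tdeltaE linearB /= !addrA [LHS]addrAC.
    rewrite !rpredD ?delta_F ?sel_F //; apply: (@filt_le _ (b + 2)); first lia.
    exact: D_nabla_filt.
  move=> [w /partP[wn wb] ->].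
  (* [delta w] is [tdelta w] minus [Dop (nabla w)], and the latter has filtration [b + 2]. *)
  exists (- Dop (nabla w)), w; rewrite subrr subrK; split.
  + have DF : Dop (nabla w) \in fGC_filt K (b + 1).
      by apply: (@filt_le _ (b + 2)); [lia | apply/D_nabla_filt/B_F].
    have Dn := D_nabla_degree _ _ wn; rewrite subrK in Dn.
    by rewrite rpredN; apply/page_cycleP; rewrite addr0 tdelta_filt.
  + by apply/page_cycleP; rewrite addr0 tdelta_filt B_F.
  by rewrite tdeltaE addrCA addNr addr0.
move=> /page_cycleP[cn cF dcF]; exists (psel B c).
  apply/andP; split; first by apply/partP; rewrite psel_degree // psel_supp.
  apply/eqP/BF0; first by rewrite delta_B // psel_supp.
  rewrite [X in X \in _](_ : _ = tdelta c - delta (c - psel B c) - Dop (nabla c)); last first.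
    by rewrite tdeltaE linearB /= opprB addrAC addrK addrC subrK.
  rewrite !rpredB ?delta_F ?sel_F //; apply: (@filt_le _ (b + 2)); first lia.
  exact: D_nabla_filt.
apply/page_boundP; exists (c - psel B c), 0; rewrite linear0 addr0 rpred0; split=> //.
apply/page_cycleP; rewrite subrr addr0 tdelta_filt ?sel_F //; split=> //.
by rewrite rpredB // psel_degree.
Qed.

(* [tdelta] preserves the parity of [e - v], and a component whose parity differs
   from that of [b] lies one step further down the filtration. *)
Lemma graph_odd_pages (fc : filtered_complex tdelta (fGC_degree K 2) (fGC_filt K))
    (r : nat) (b n b' n' : int) (Hb : b' = b + r%:Z) (Hn : n' = n + 1)
    (X : page tdelta (fGC_degree K 2) (fGC_filt K) r b n) :
  odd r -> page_diff fc Hb Hn X = 0.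
Proof.
move=> odd_r; have [c Zc ->] := page_surj X; rewrite page_diff_class //.
have /page_cycleP[cn cF dcF] := Zc.
pose E : nat -> nat -> bool := fun v e => (2 %| e%:Z - v%:Z - b)%Z.
pose O : nat -> nat -> bool := fun v e => ~~ E v e.
have E_tdelta x : x \in @fGC_supp K E -> tdelta x \in @fGC_supp K E.
  by apply: supp_tdelta => v e; rewrite /E; lia.
have O_tdelta x : x \in @fGC_supp K O -> tdelta x \in @fGC_supp K O.
  by apply: supp_tdelta => v e; rewrite /O /E; lia.
set x0 := psel E c; pose x1 := c - x0.
have x1O : x1 \in @fGC_supp K O.
  by apply: (@psel_compl _ (fun _ _ => true)) => //; apply/suppP.
have x1F : x1 \in fGC_filt K (b + 1).
  by apply: psel_compl cF => v e; rewrite /E; lia.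
have x0n : x0 \in fGC_degree K 2 n by apply: psel_degree.
have x1n : x1 \in fGC_degree K 2 n by rewrite rpredB.
have dE v e : tdelta c v e = tdelta x0 v e + tdelta x1 v e.
  by rewrite -[RHS]/((tdelta x0 + tdelta x1) v e) -linearD /x1 addrC subrK.
(* The components of [tdelta x0] have the parity of [b]. For odd [r] that of [b + r] is the other
   one, so filtration [b + r] improves to [b + r + 1]. *)
have dx0F : tdelta x0 \in fGC_filt K (b + r%:Z + 1).
  apply/suppP => v e nF; have /suppP d0 := E_tdelta _ (psel_supp E c).
  have /suppP d1 := O_tdelta _ x1O; have /suppP dc := dcF.
  have [Ev|] := boolP (E v.+1 e); last exact: d0.
  have := dE v e; rewrite d1 ?negbK // addr0 => <-; apply: dc.
  by move: nF Ev odd_r; rewrite /E; lia.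
have dx1F : tdelta x1 \in fGC_filt K (b + r%:Z).
  have -> : tdelta x1 = tdelta c - tdelta x0 by rewrite -linearB.
  by apply: (submodB dcF); apply: (filt_le _ dx0F); lia.
have Zdc := page_cycle_diff fc Hb Hn Zc.
(* Both parts are page boundaries: [tdelta x0] by being one step deeper, [tdelta x1] by coming from
   filtration [b + 1]. *)
apply/(page_class_eq0 Zdc)/page_boundP; exists (tdelta x0), x1; rewrite Hb Hn !addrK.
split; [apply/page_cycleP|apply/page_cycleP|].
- rewrite tdelta_degree // dx0F; split=> //.
  by have /degreeP[x02 _] := x0n; rewrite tdelta_tdelta // rpred0.
- by split; [exact: x1n | exact: x1F | apply: (filt_le _ dx1F); lia].
by rewrite -linearD /x1 addrC subrK.
Qed.

End Supports.

Theorem corollary3p9 (K : fieldType) (charK : [pchar K] =i pred0) :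
  [/\ forall c : fGC K, c \in fGC_ge K 2 ->
        delta c \in fGC_ge K 2 /\ delta (delta c) = 0,
      forall c : fGC K, c \in fGC_ge K 2 ->
        tdelta c \in fGC_ge K 2 /\ tdelta (tdelta c) = 0,
      forall X : homology (fGC_ge K 2) tdelta (fGC_ge K 2) tdelta, X = 0
    & exists fc : filtered_complex tdelta (fGC_degree K 2) (fGC_filt K),
      [/\ spectral_sequence fc,
          forall b n : int,
            induced_iso id
              (ker_in (fGC_part K 2 b n) delta)
              (im_of (fGC_part K 2 b (n - 1)) delta)
              (page_cycle tdelta (fGC_degree K 2) (fGC_filt K) 1%:Z b n)
              (page_bound tdelta (fGC_degree K 2) (fGC_filt K) 1%:Z b n),
          converges tdelta (fGC_degree K 2) (fGC_filt K),
          forall (n : int) (X : coh tdelta (fGC_degree K 2) n), X = 0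
        & forall (r : nat) (b n b' n' : int)
            (Hb : b' = b + r%:Z) (Hn : n' = n + 1)
            (X : page tdelta (fGC_degree K 2) (fGC_filt K) r b n),
            odd r -> page_diff fc Hb Hn X = 0]].
Proof.
have fc := graph_filtered_complex charK.
have [coh0 conv] : (forall n (X : coh tdelta (fGC_degree K 2) n), X = 0) /\
    converges tdelta (fGC_degree K 2) (fGC_filt K).
  apply: (acyclic_converges fc) => n; first exact: tdelta_exact_degree.
    by exists 0 => c; apply: degree_filt0.
  by exists (n + 1) => c; apply: degree_filt_large.
split=> [c c2|c c2||].
- by rewrite fdelta_ge // fdelta_delta.
- by rewrite tdelta_ge // tdelta_tdelta.
- exact: tdelta_acyclic.
exists fc; split=> //; [exact: filtered_spectral_sequence | exact: graph_first_page |].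
by move=> r b n b' n' Hb Hn X; apply: graph_odd_pages.
Qed.
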